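(* Let $R$ be a Noetherian commutative ring of Krull dimension $\le4$, let $P_0$ be a finitely generated projective $R$-module of constant rank $2$ and let $\theta_0:R\xrightarrow{\cong}\det(P_0)$ be a trivialization of its determinant. Let $P_4=P_0\oplus Re_3\oplus Re_4$. Then the map $V:Um(P_0\oplus R)/SL(P_0\oplus R)\to\tilde V_{SL}(R)$ is injective if and only if $SL(P_4)e_4=Sp(\chi)e_4$ for all non-degenerate alternating forms $\chi$ on $P_4$ such that $[P_4,\chi_0\perp\psi_2,\chi]\in\tilde V(R)$.
   Context: For a finitely generated projective $R$-module $P$: $P^{\vee}=\mathrm{Hom}_R(P,R)$; $Um(P)$ is the set of epimorphisms $P\to R$; $SL(P)$ is the group of automorphisms of determinant $1$, acting on the right on $Um(P)$ by precomposition and on the left on $P$. For a non-degenerate alternating form $\chi$ on $P$, $Sp(\chi)=\{\varphi\in\mathrm{Aut}(P):\varphi^t\chi\varphi=\chi\}$. $SL(P_4)e_4$ and $Sp(\chi)e_4$ denote the orbits of $e_4\in P_4$; $Re_3,Re_4$ are free of rank one on $e_3,e_4$, and $P_0\oplus R$ is identified with $P_0\oplus Re_3$. An alternating isomorphism on $P$ is an isomorphism $f:P\to P^{\vee}$ with $f(p)(p)=0$ for all $p$ (the same as a non-degenerate alternating form); the pulled-back form along $h$ is $h^{\vee}fh=h^tfh$. Triples $(P,f_0,f_1)$, $(P',f_0',f_1')$ with alternating isomorphisms are isometric if there is an isomorphism $h:P\to P'$ with $f_i=h^{\vee}f_i'h$, $i=0,1$; $[P,f_0,f_1]$ is the isometry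 class. $V(R)$ is the quotient of the free abelian group on isometry classes of triples by (1) $[P\oplus P',g\perp g',f\perp f']=[P,g,f]+[P',g',f']$ and (2) $[P,f_0,f_1]+[P,f_1,f_2]=[P,f_0,f_2]$. $V_{SL}(R)$ is the quotient by (1), (2) and (3) $[P,g,f]=[P,g,\varphi^{\vee}f\varphi]$ for $\varphi\in SL(P)$. Let $A_{2n}(R)$ be the set of invertible alternating $2n\times2n$ matrices, $\psi_2=\begin{pmatrix}0&1\\-1&0\end{pmatrix}$, $\psi_{2n+2}=\psi_{2n}\perp\psi_2$, $A(R)=\mathrm{colim}_n A_{2n}(R)$ along $M\mapsto M\perp\psi_2$. For a group $G$ with $E(R)\subset G\subset SL(R)$ write $M\sim_GN$ ($M\in A_{2m}(R)$, $N\in A_{2n}(R)$) if $M\perp\psi_{2n+2s}=E^t(N\perp\psi_{2m+2s})E$ for some $s\in\mathbb N$ and $E\in SL_{2m+2n+2s}(R)\cap G$. $W'_G(R)=A(R)/{\sim_G}$ is an abelian group under $\perp$, and $W_G(R)$ is the kernel of the Pfaffian $W'_G(R)\to R^{\times}$; write $W_E$, $W_{SL}$ for $G=E(R)$, $SL(R)$. The assignment $M\mapsto[R^{2m},\psi_{2m},M]$ induces isomorphisms $W'_E(R)\cong V(R)$ and $W'_{SL}(R)\cong V_{SL}(R)$; $\tilde V(R)$ and $\tilde V_{SL}(R)$ are the subgroups corresponding to $W_E(R)$ and $W_{SL}(R)$. There is a canonical epimorphism $\tilde V(R)\to\tilde V_{SL}(R)$. The map $V$: let $\chi_0(p,q)=\theta_0^{-1}(p\wedge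 q)$ on $P_0$. For $a\in Um(P_0\oplus R)$ put $P(a)=\ker a$, choose a section $s:R\to P_0\oplus R$ of $a$, and let $i_s:P_0\oplus R\to P(a)\oplus R$, $i_s(p)=(p-s(a(p)),a(p))$. The exact sequence $0\to P(a)\to P_0\oplus R\xrightarrow{a}R\to0$ gives an isomorphism $\det(P_0)\cong\det(P(a))$ independent of $s$ (through $\det(P_0)\cong\det(P_0\oplus R)$, $x\wedge y\mapsto x\wedge y\wedge(0,1)$, and $\det(P(a))\cong\det(P_0\oplus R)$, $p\wedge q\mapsto p\wedge q\wedge s(1)$); composing with $\theta_0$ yields $\theta:R\xrightarrow{\cong}\det(P(a))$. Put $\chi_a(p,q)=\theta^{-1}(p\wedge q)$ on $P(a)$ and $V(a,s)=(i_s\oplus1)^t(\chi_a\perp\psi_2)(i_s\oplus1)$, a non-degenerate alternating form on $P_0\oplus R^2$. The class $[P_0\oplus R^2,\chi_0\perp\psi_2,V(a,s)]$ lies in $\tilde V(R)$ and is independent of $s$; its image $V(a)$ in $\tilde V_{SL}(R)$ depends only on the class of $a$ in $Um(P_0\oplus R)/SL(P_0\oplus R)$, which defines $V$. *)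

(* Defs.v *)
From HB Require Import structures.
From mathcomp Require Import all_boot all_order all_algebra.
From mathcomp Require Import boolp classical_sets generic_quotient.
Set Implicit Arguments.
Unset Strict Implicit.
Unset Printing Implicit Defensive.
Import GRing.Theory.
Local Open Scope ring_scope.

Section Rings.
Context {R : comPzRingType}.

Record is_ideal (I : R -> Prop) : Prop := IsIdeal {
  ideal0 : I 0;
  idealD : forall x y, I x -> I y -> I (x + y);
  idealM : forall r x, I x -> I (r * x) }.

Record is_prime (p : R -> Prop) : Prop := IsPrime {
  prime_ideal : is_ideal p;
  prime_proper : ~ p 1;
  prime_mul : forall x y, p (x * y) -> p x \/ p y }.

Lemma prime_above (I : R -> Prop) : is_ideal I -> ~ I 1 ->
  exists2 p, is_prime p & forall x, I x -> p x.
Proof.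
move=> idI I1.
pose T := {J : set R | is_ideal J /\ ~ J 1 /\ forall x, I x -> J x}.
pose le (J K : T) := `[< forall x, sval J x -> sval K x >].
pose bot : T := exist _ I (conj idI (conj I1 (fun x h => h))).
have [||||P maxP] := @Zorn T le.
- by move=> J; apply/asboolP.
- by move=> J K L /asboolP h /asboolP k; apply/asboolP => x /h /k.
- move=> [J hJ] [K hK] /asboolP h /asboolP k; apply: eq_exist.
  by apply/seteqP; split.
- move=> A totA.
  have [[J0 AJ0]|A0] := pselect (exists J, A J); last first.
    by exists bot => s As; case: A0; exists s.
  pose U : set R := fun x => exists2 J : T, A J & sval J x.
  have idU : is_ideal U.
    split.
    + by exists J0 => //; case: (svalP J0) => [[]].
    + move=> x y [J AJ Jx] [K AK Ky].
      have [/asboolP h|/asboolP h] := totA _ _ AJ AK.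
        exists K => //; case: (svalP K) => [[_ hD _] _]; exact: hD (h _ Jx) Ky.
      by exists J => //; case: (svalP J) => [[_ hD _] _]; exact: hD Jx (h _ Ky).
    + move=> r x [J AJ Jx]; exists J => //.
      by case: (svalP J) => [[_ _ hM] _]; exact: hM.
  have U1 : ~ U 1 by move=> [J _ J1]; case: (svalP J) => _ [].
  have IU : forall x, I x -> U x.
    by move=> x Ix; exists J0 => //; case: (svalP J0) => _ [_]; exact.
  exists (exist _ U (conj idU (conj U1 IU))) => s As.
  by apply/asboolP => x sx; exists s.
have [[P0 PD PM] [P1 IP]] := svalP P.
exists (sval P) => //; split => // x y Pxy.
have [|nPx] := pselect (sval P x); first by left.
right; apply: contrapT => nPy.
pose J z (w : R) := exists2 q, sval P q & exists r, w = q + r * z.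
have idJ z : is_ideal (J z).
  split.
  - by exists 0 => //; exists 0; rewrite mul0r addr0.
  - move=> _ _ [q Pq [r ->]] [q' Pq' [r' ->]]; exists (q + q'); first exact: PD.
    by exists (r + r'); rewrite mulrDl addrACA.
  - move=> s _ [q Pq [r ->]]; exists (s * q); first exact: PM.
    by exists (s * r); rewrite mulrDr mulrA.
have PJ z w : sval P w -> J z w.
  by move=> Pw; exists w => //; exists 0; rewrite mul0r addr0.
have J1 z : ~ sval P z -> J z 1.
  move=> nPz; apply: contrapT => nJ1.
  pose K : T := exist _ (J z : set R) (conj (idJ z) (conj nJ1 (fun w h => PJ z w (IP w h)))).
  have EK : K = P by apply: maxP; apply/asboolP => w; exact: PJ.
  apply: nPz; rewrite -EK /=; exists 0 => //; exists 1; by rewrite mul1r add0r.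
have [q Pq [r Eq]] := J1 x nPx.
have [q' Pq' [r' Eq']] := J1 y nPy.
apply: P1; suff : sval P ((q + r * x) * (q' + r' * y)) by rewrite -Eq -Eq' mulr1.
rewrite mulrDl !mulrDr.
apply: (PD); first by apply: (PD); [exact: PM | rewrite mulrC; exact: PM].
apply: (PD); first by exact: PM.
by rewrite mulrACA; exact: PM.
Qed.

Definition Noetherian : Prop :=
  forall I : R -> Prop, is_ideal I ->
  exists (n : nat) (g : 'I_n -> R),
    forall x, I x <-> exists c : 'I_n -> R, x = \sum_i c i * g i.

(* No strictly increasing chain p 0 < p 1 < ... < p n.+1 of prime ideals. *)
Definition Krull_dim_le (n : nat) : Prop :=
  ~ exists p : nat -> R -> Prop,
      (forall i, (i <= n.+1)%N -> is_prime (p i)) /\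
      (forall i, (i <= n)%N ->
         (forall x, p i x -> p i.+1 x) /\ exists x, p i.+1 x /\ ~ p i x).

End Rings.
Arguments Noetherian R : clear implicits.
Arguments Krull_dim_le R n : clear implicits.

(* The R-module with generators I and relations rel: formal linear
   combinations modulo the congruence generated by the module laws and rel. *)
Inductive mterm (R I : Type) : Type :=
| MZero
| MGen of I
| MAdd of mterm R I & mterm R I
| MScale of R & mterm R I.
Arguments MZero {R I}.
Arguments MGen {R I}.

Inductive meq (R : pzRingType) (I : Type) (rel : mterm R I -> mterm R I -> Prop) :
  mterm R I -> mterm R I -> Prop :=
| meq_rel x y : rel x y -> meq rel x y
| meq_refl x : meq rel x x
| meq_sym x y : meq rel x y -> meq rel y x
| meq_trans y x z : meq rel x y -> meq rel y z -> meq rel x z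
| meq_add x x' y y' : meq rel x x' -> meq rel y y' -> meq rel (MAdd x y) (MAdd x' y')
| meq_scale r x x' : meq rel x x' -> meq rel (MScale r x) (MScale r x')
| meq_addA x y z : meq rel (MAdd x (MAdd y z)) (MAdd (MAdd x y) z)
| meq_addC x y : meq rel (MAdd x y) (MAdd y x)
| meq_add0 x : meq rel (MAdd MZero x) x
| meq_addN x : meq rel (MAdd (MScale (-1) x) x) MZero
| meq_scaleA r s x : meq rel (MScale r (MScale s x)) (MScale (r * s) x)
| meq_scale1 x : meq rel (MScale 1 x) x
| meq_scaleDr r x y : meq rel (MScale r (MAdd x y)) (MAdd (MScale r x) (MScale r y))
| meq_scaleDl r s x : meq rel (MScale (r + s) x) (MAdd (MScale r x) (MScale s x)).

Section PresentedModule.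
Local Open Scope quotient_scope.
Context (R : comPzRingType) (I : Type) (rel : mterm R I -> mterm R I -> Prop).

HB.instance Definition _ := gen_eqMixin (mterm R I).
HB.instance Definition _ := gen_choiceMixin (mterm R I).

Definition meqb (x y : mterm R I) : bool := `[< meq rel x y >].

Lemma meqb_equiv : equiv_class_of meqb.
Proof.
split=> [x|x y|y x z].
- by apply/asboolP; exact: meq_refl.
- by apply/asboolP/asboolP; exact: meq_sym.
- by move=> /asboolP h /asboolP k; apply/asboolP; exact: meq_trans h k.
Qed.

Canonical meqb_equiv_rel := EquivRelPack meqb_equiv.

Definition pmod : Type := {eq_quot meqb}.
HB.instance Definition _ := Choice.on pmod.

Definition pmod_pi (x : mterm R I) : pmod := \pi_({eq_quot meqb}) x.

Lemma pmod_eqP x y : pmod_pi x = pmod_pi y <-> meq rel x y.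
Proof. by split=> [/eqquotP/asboolP|h] //; apply/eqquotP/asboolP. Qed.

Lemma pmod_ind (P : pmod -> Prop) : (forall x, P (pmod_pi x)) -> forall q, P q.
Proof. by move=> h q; rewrite -[q]reprK; exact: h. Qed.

Definition pmod_repr (q : pmod) : mterm R I := repr q.
Lemma pmod_reprP x : meq rel (pmod_repr (pmod_pi x)) x.
Proof. by apply/pmod_eqP; rewrite /pmod_repr /pmod_pi reprK. Qed.

Definition pmod_add (p q : pmod) := pmod_pi (MAdd (pmod_repr p) (pmod_repr q)).
Definition pmod_scale r (p : pmod) := pmod_pi (MScale r (pmod_repr p)).

Lemma pmod_piD x y : pmod_add (pmod_pi x) (pmod_pi y) = pmod_pi (MAdd x y).
Proof. by apply/pmod_eqP; apply: meq_add; exact: pmod_reprP. Qed.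
Lemma pmod_piZ r x : pmod_scale r (pmod_pi x) = pmod_pi (MScale r x).
Proof. by apply/pmod_eqP; apply: meq_scale; exact: pmod_reprP. Qed.

Lemma pmod_addA : associative pmod_add.
Proof.
elim/pmod_ind=> x; elim/pmod_ind=> y; elim/pmod_ind=> z; rewrite !pmod_piD.
by apply/pmod_eqP; exact: meq_addA.
Qed.
Lemma pmod_addC : commutative pmod_add.
Proof.
elim/pmod_ind=> x; elim/pmod_ind=> y; rewrite !pmod_piD.
by apply/pmod_eqP; exact: meq_addC.
Qed.
Lemma pmod_add0 : left_id (pmod_pi MZero) pmod_add.
Proof.
by elim/pmod_ind=> x; rewrite !pmod_piD; apply/pmod_eqP; exact: meq_add0.
Qed.
Lemma pmod_addN : left_inverse (pmod_pi MZero) (pmod_scale (-1)) pmod_add.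
Proof.
elim/pmod_ind=> x; rewrite !pmod_piZ !pmod_piD.
by apply/pmod_eqP; exact: meq_addN.
Qed.
HB.instance Definition _ :=
  GRing.isZmodule.Build pmod pmod_addA pmod_addC pmod_add0 pmod_addN.

Lemma pmod_scaleA r s (q : pmod) :
  pmod_scale r (pmod_scale s q) = pmod_scale (r * s) q.
Proof.
elim/pmod_ind: q => x; rewrite !pmod_piZ.
by apply/pmod_eqP; exact: meq_scaleA.
Qed.
Lemma pmod_scale1 : left_id 1 pmod_scale.
Proof.
by elim/pmod_ind=> x; rewrite !pmod_piZ; apply/pmod_eqP; exact: meq_scale1.
Qed.
Lemma pmod_scaleDr : right_distributive pmod_scale +%R.
Proof.
move=> r; elim/pmod_ind=> x; elim/pmod_ind=> y.
rewrite /GRing.add /= !(pmod_piZ, pmod_piD).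
by apply/pmod_eqP; exact: meq_scaleDr.
Qed.
Lemma pmod_scaleDl (q : pmod) :
  {morph pmod_scale^~ q : r s / r + s}.
Proof.
elim/pmod_ind: q => x r s.
rewrite /= [RHS]/GRing.add /= !(pmod_piZ, pmod_piD).
by apply/pmod_eqP; exact: meq_scaleDl.
Qed.
HB.instance Definition _ := GRing.Zmodule_isLmodule.Build R pmod
  pmod_scaleA pmod_scale1 pmod_scaleDr pmod_scaleDl.

Definition pmod_gen (i : I) : pmod := pmod_pi (MGen i).

Lemma pmod_genP (Q : pmod -> Prop) :
  Q 0 -> (forall x y, Q x -> Q y -> Q (x + y)) ->
  (forall r x, Q x -> Q (r *: x)) -> (forall i, Q (pmod_gen i)) ->
  forall q, Q q.
Proof.
move=> Q0 QD QZ QG; elim/pmod_ind; elim=> [|i|x hx y hy|r x hx].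
- exact: Q0.
- exact: QG.
- have <- : pmod_pi x + pmod_pi y = pmod_pi (MAdd x y) by exact: pmod_piD.
  exact: QD.
- have <- : r *: pmod_pi x = pmod_pi (MScale r x) by exact: pmod_piZ.
  exact: QZ.
Qed.

Lemma pmod_genE x y : rel x y -> pmod_pi x = pmod_pi y.
Proof. by move=> h; apply/pmod_eqP; exact: meq_rel. Qed.

Section Lift.
Context (N : lmodType R) (f : I -> N).
Fixpoint meval (x : mterm R I) : N :=
  match x with
  | MZero => 0
  | MGen i => f i
  | MAdd x y => meval x + meval y
  | MScale r x => r *: meval x
  end.
Definition pmod_lift (q : pmod) : N := meval (pmod_repr q).

Context (frel : forall x y, rel x y -> meval x = meval y).
Lemma meval_eq x y : meq rel x y -> meval x = meval y.
Proof.
elim=> //=.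
- by move=> ? ? ? _ -> _ ->.
- by move=> ? ? ? ? _ -> _ ->.
- by move=> ? ? ? _ ->.
- by move=> *; rewrite addrA.
- by move=> *; rewrite addrC.
- by move=> *; rewrite add0r.
- by move=> *; rewrite scaleN1r addNr.
- by move=> *; rewrite scalerA.
- by move=> *; rewrite scale1r.
- by move=> *; rewrite scalerDr.
- by move=> *; rewrite scalerDl.
Qed.
Lemma pmod_liftE x : pmod_lift (pmod_pi x) = meval x.
Proof. by apply: meval_eq; exact: pmod_reprP. Qed.
Lemma pmod_lift_linear : linear pmod_lift.
Proof.
move=> r; elim/pmod_ind=> x; elim/pmod_ind=> y.
have -> : r *: pmod_pi x + pmod_pi y = pmod_pi (MAdd (MScale r x) y).
  by rewrite [_ *: _]pmod_piZ [_ + _]pmod_piD.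
by rewrite !pmod_liftE.
Qed.
End Lift.
End PresentedModule.

Section Exterior.
Context (R : comPzRingType) (M : lmodType R).

(* Exterior square and cube of M, by generators x ^ y (resp. x ^ y ^ z) and
   the relations of multilinearity and alternation. *)
Inductive ext2_rel : mterm R (M * M) -> mterm R (M * M) -> Prop :=
| Ext2Dl x x' y : ext2_rel (MGen (x + x', y)) (MAdd (MGen (x, y)) (MGen (x', y)))
| Ext2Dr x y y' : ext2_rel (MGen (x, y + y')) (MAdd (MGen (x, y)) (MGen (x, y')))
| Ext2Zl r x y : ext2_rel (MGen (r *: x, y)) (MScale r (MGen (x, y)))
| Ext2Zr r x y : ext2_rel (MGen (x, r *: y)) (MScale r (MGen (x, y)))
| Ext2xx x : ext2_rel (MGen (x, x)) MZero.

Definition Ext2 : lmodType R := pmod ext2_rel.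
Definition wedge2 (x y : M) : Ext2 := pmod_gen ext2_rel (x, y).

Inductive ext3_rel :
  mterm R (M * M * M) -> mterm R (M * M * M) -> Prop :=
| Ext3D1 x x' y z : ext3_rel (MGen (x + x', y, z)) (MAdd (MGen (x, y, z)) (MGen (x', y, z)))
| Ext3D2 x y y' z : ext3_rel (MGen (x, y + y', z)) (MAdd (MGen (x, y, z)) (MGen (x, y', z)))
| Ext3D3 x y z z' : ext3_rel (MGen (x, y, z + z')) (MAdd (MGen (x, y, z)) (MGen (x, y, z')))
| Ext3Z1 r x y z : ext3_rel (MGen (r *: x, y, z)) (MScale r (MGen (x, y, z)))
| Ext3Z2 r x y z : ext3_rel (MGen (x, r *: y, z)) (MScale r (MGen (x, y, z)))
| Ext3Z3 r x y z : ext3_rel (MGen (x, y, r *: z)) (MScale r (MGen (x, y, z)))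
| Ext3xxz x z : ext3_rel (MGen (x, x, z)) MZero
| Ext3xyy x y : ext3_rel (MGen (x, y, y)) MZero
| Ext3xyx x y : ext3_rel (MGen (x, y, x)) MZero.

Definition Ext3 : lmodType R := pmod ext3_rel.
Definition wedge3 (x y z : M) : Ext3 := pmod_gen ext3_rel (x, y, z).
End Exterior.

Record liso (R : pzRingType) (M N : lmodType R) := LIso {
  liso_fun :> {linear M -> N};
  liso_inv : N -> M;
  lisoK : cancel liso_fun liso_inv;
  liso_invK : cancel liso_inv liso_fun }.

Definition Linear_of (R : pzRingType) (U V : lmodType R) (f : U -> V)
    (lf : linear f) : {linear U -> V} :=
  HB.pack f (GRing.isLinear.Build _ _ _ _ f lf).

Section Modules.
Context (R : comPzRingType).

Definition finitely_generated (P : lmodType R) : Prop :=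
  exists (n : nat) (g : {linear 'rV[R]_n -> P}), forall p, exists v, g v = p.

Definition projective (P : lmodType R) : Prop :=
  forall (M N : lmodType R) (g : {linear M -> N}) (f : {linear P -> N}),
    (forall y, exists x, g x = y) ->
    exists h : {linear P -> M}, forall p, g (h p) = f p.

Record fg_projective (P : lmodType R) : Prop := FGProjective {
  fgp_fg : finitely_generated P;
  fgp_proj : projective P }.

(* The localization of P at the prime p is free of rank n.  A basis of the
   localization can be rescaled by units to consist of images of elements
   e i of P; the two clauses say that these generate, resp. are linearly
   independent, after inverting the complement of p. *)
Definition free_at (p : R -> Prop) (P : lmodType R) (n : nat) : Prop :=
  exists e : 'I_n -> P,
    (forall x, exists s, ~ p s /\ exists c : 'I_n -> R, s *: x = \sum_i c i *: e i) /\
    (forall c : 'I_n -> R, \sum_i c i *: e i = 0 ->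
       forall i, exists s, ~ p s /\ s * c i = 0).

Definition constant_rank (P : lmodType R) (n : nat) : Prop :=
  forall p : R -> Prop, is_prime p -> free_at p P n.

Lemma linear_ext_zero (N : lmodType R) (w : N) :
  (forall p : R -> Prop, is_prime p -> exists s, ~ p s /\ s *: w = 0) -> w = 0.
Proof.
move=> h; pose I (r : R) := r *: w = 0.
have [I1|nI1] := pselect (I 1); first by rewrite -[w]scale1r.
have idI : is_ideal I.
  split; rewrite /I; first by rewrite scale0r.
  - by move=> x y hx hy; rewrite scalerDl hx hy addr0.
  - by move=> r x hx; rewrite -scalerA hx scaler0.
have [p hp Ip] := prime_above idI nI1.
by have [s [ns /Ip]] := h p hp.
Qed.

Lemma fgp_retract (P Q : lmodType R) (i : {linear P -> Q}) (r : {linear Q -> P}) :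
  (forall p, r (i p) = p) -> fg_projective Q -> fg_projective P.
Proof.
move=> ri [[n [g gs]] pQ]; split.
  exists n, (r \o g) => p; have [v gv] := gs (i p).
  by exists v; rewrite /= gv ri.
move=> M N g' f' sg; have [h hE] := pQ M N g' (f' \o r) sg.
by exists (h \o i) => p; rewrite /= hE /= ri.
Qed.

Lemma fgp_prod (P Q : lmodType R) :
  fg_projective P -> fg_projective Q -> fg_projective (P * Q)%type.
Proof.
move=> [[n [g gs]] pP] [[m [k ks]] pQ]; split.
  pose l (v : 'rV[R]_(n + m)) : P * Q := (g (lsubmx v), k (rsubmx v)).
  have ll : linear l.
    by move=> a u v; rewrite /l !linearP.
  pose L : {linear _ -> _} := Linear_of ll.
  exists (n + m)%N, L => -[p q].
  have [u gu] := gs p; have [v kv] := ks q.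
  by exists (row_mx u v); rewrite /L /= /l row_mxKl row_mxKr gu kv.
move=> M N g' f sg.
pose il (x : P) : P * Q := (x, 0); pose ir (y : Q) : P * Q := (0, y).
have lil : linear il by move=> a u v; congr pair; rewrite /= ?scaler0 ?addr0.
have lir : linear ir by move=> a u v; congr pair; rewrite /= ?scaler0 ?addr0.
pose IL : {linear _ -> _} := Linear_of lil.
pose IR : {linear _ -> _} := Linear_of lir.
have [h1 e1] := pP M N g' (f \o IL) sg.
have [h2 e2] := pQ M N g' (f \o IR) sg.
pose h (x : P * Q) := h1 x.1 + h2 x.2.
have lh : linear h.
  by move=> a u v; rewrite /h /= !linearP scalerDr addrACA.
exists (Linear_of lh) => -[x y].
rewrite /= /h /= linearD e1 e2 /= -linearD; congr (f _).
by congr pair; rewrite ?addr0 ?add0r.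
Qed.

Lemma fgp_row n : fg_projective 'rV[R]_n.
Proof.
split; first by exists n, idfun => p; exists p.
move=> M N g f sg.
have [y yE] := fin_all_exists (fun i : 'I_n => sg (f (delta_mx 0 i))).
pose h (v : 'rV[R]_n) := \sum_i v 0 i *: y i.
have lh : linear h.
  move=> a u v; rewrite /h scaler_sumr -big_split /=.
  by apply: eq_bigr => i _; rewrite !mxE scalerDl scalerA.
exists (Linear_of lh) => v.
rewrite /= /h linear_sum [in RHS](row_sum_delta v) linear_sum.
by apply: eq_bigr => i _; rewrite !linearZ /= yE.
Qed.

Lemma fgp_regular : fg_projective (R^o : lmodType R).
Proof.
pose i (x : R^o) : 'rV[R]_1 := x *: 1%:M.
pose r (v : 'rV[R]_1) : R^o := v 0 0.
have li : linear i by move=> a u v; rewrite /i scalerDl scalerA.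
have lr : linear r by move=> a u v; rewrite /r !mxE.
apply: (@fgp_retract _ _ (Linear_of li)
  (Linear_of lr)) (fgp_row 1) => p.
by rewrite /= /r /i !mxE eqxx mulr1.
Qed.

Lemma fgp_separated (P : lmodType R) (x : P) : fg_projective P ->
  (forall f : {linear P -> R^o}, f x = 0) -> x = 0.
Proof.
move=> [[n [g gs]] pP] fx.
have [h hE] := pP _ _ g idfun gs.
rewrite -[x]/(idfun x) -hE; suff -> : h x = 0 by rewrite linear0.
apply/rowP => j; rewrite mxE.
pose c (v : 'rV[R]_n) : R^o := v 0 j.
have lc : linear c by move=> a u v; rewrite /c !mxE.
pose C : {linear _ -> _} := Linear_of lc.
exact: (fx (C \o h)).
Qed.
End Modules.

Section Wedge.
Context (R : comPzRingType) (M : lmodType R).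
Implicit Types x y z : M.

Local Notation "x ^^ y" := (wedge2 x y) (at level 40).

Lemma wedge2Dl x x' y : (x + x') ^^ y = x ^^ y + x' ^^ y.
Proof. by rewrite [RHS]pmod_piD; apply: pmod_genE; constructor. Qed.
Lemma wedge2Dr x y y' : x ^^ (y + y') = x ^^ y + x ^^ y'.
Proof. by rewrite [RHS]pmod_piD; apply: pmod_genE; constructor. Qed.
Lemma wedge2Zl r x y : (r *: x) ^^ y = r *: (x ^^ y).
Proof. by rewrite [RHS]pmod_piZ; apply: pmod_genE; constructor. Qed.
Lemma wedge2Zr r x y : x ^^ (r *: y) = r *: (x ^^ y).
Proof. by rewrite [RHS]pmod_piZ; apply: pmod_genE; constructor. Qed.
Lemma wedge2xx x : x ^^ x = 0.
Proof. by apply: pmod_genE; constructor. Qed.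
Lemma wedge2C x y : x ^^ y = - (y ^^ x).
Proof.
apply/eqP; rewrite -subr_eq0 opprK; apply/eqP.
have := wedge2xx (x + y).
by rewrite wedge2Dl !wedge2Dr !wedge2xx add0r addr0.
Qed.

Lemma wedge3D1 x x' y z : wedge3 (x + x') y z = wedge3 x y z + wedge3 x' y z.
Proof. by rewrite [RHS]pmod_piD; apply: pmod_genE; constructor. Qed.
Lemma wedge3D2 x y y' z : wedge3 x (y + y') z = wedge3 x y z + wedge3 x y' z.
Proof. by rewrite [RHS]pmod_piD; apply: pmod_genE; constructor. Qed.
Lemma wedge3D3 x y z z' : wedge3 x y (z + z') = wedge3 x y z + wedge3 x y z'.
Proof. by rewrite [RHS]pmod_piD; apply: pmod_genE; constructor. Qed.
Lemma wedge3Z1 r x y z : wedge3 (r *: x) y z = r *: wedge3 x y z.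
Proof. by rewrite [RHS]pmod_piZ; apply: pmod_genE; constructor. Qed.
Lemma wedge3Z2 r x y z : wedge3 x (r *: y) z = r *: wedge3 x y z.
Proof. by rewrite [RHS]pmod_piZ; apply: pmod_genE; constructor. Qed.
Lemma wedge3Z3 r x y z : wedge3 x y (r *: z) = r *: wedge3 x y z.
Proof. by rewrite [RHS]pmod_piZ; apply: pmod_genE; constructor. Qed.
Lemma wedge3xxz x z : wedge3 x x z = 0.
Proof. by apply: pmod_genE; constructor. Qed.
Lemma wedge3xyy x y : wedge3 x y y = 0.
Proof. by apply: pmod_genE; constructor. Qed.
Lemma wedge3xyx x y : wedge3 x y x = 0.
Proof. by apply: pmod_genE; constructor. Qed.
Definition wedge3D := (wedge3D1, wedge3D2, wedge3D3).
Definition wedge3Z := (wedge3Z1, wedge3Z2, wedge3Z3).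
Definition wedge3_alt := (wedge3xxz, wedge3xyy, wedge3xyx).

Lemma wedge3_swap23 x y z : wedge3 x y z = - wedge3 x z y.
Proof.
apply/eqP; rewrite -subr_eq0 opprK; apply/eqP.
have := wedge3xyy x (y + z).
by rewrite !wedge3D !wedge3_alt add0r addr0.
Qed.
Lemma wedge3_swap12 x y z : wedge3 x y z = - wedge3 y x z.
Proof.
apply/eqP; rewrite -subr_eq0 opprK; apply/eqP.
have := wedge3xxz (x + y) z.
by rewrite !wedge3D !wedge3_alt add0r addr0.
Qed.

Definition locally_2gen : Prop := forall p : R -> Prop, is_prime p ->
  exists e1 e2 : M, forall x, exists s, ~ p s /\
    exists c d, s *: x = c *: e1 + d *: e2.

Lemma wedge3_vanish : locally_2gen -> forall x y z, wedge3 x y z = 0.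
Proof.
move=> h x y z; apply: linear_ext_zero => p hp.
have [e1 [e2 he]] := h p hp.
have [s [ns [c [d Ex]]]] := he x.
have [s' [ns' [c' [d' Ey]]]] := he y.
have [s'' [ns'' [c'' [d'' Ez]]]] := he z.
exists (s * s' * s''); split.
  by move=> /(prime_mul hp) [/(prime_mul hp) []|].
rewrite -!scalerA -wedge3Z3 -wedge3Z2 -wedge3Z1 Ex Ey Ez.
by rewrite !wedge3D !wedge3Z !wedge3_alt !scaler0 !addr0.
Qed.
End Wedge.

Lemma constant_rank2_local (R : comPzRingType) (P : lmodType R) :
  constant_rank P 2 -> locally_2gen P.
Proof.
move=> h p hp; have [e [he _]] := h p hp.
exists (e ord0), (e (lift ord0 ord0)) => x; have [s [ns [c E]]] := he x.
exists s; split => //; exists (c ord0), (c (lift ord0 ord0)).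
by rewrite E !big_ord_recl big_ord0 addr0.
Qed.

Section Contraction.
Context (R : comPzRingType) (M K : lmodType R)
  (pr : {linear M -> K}) (a : {linear M -> R^o}).

Definition contr_fun (t : M * M * M) : Ext2 K :=
  (a t.2 : R) *: wedge2 (pr t.1.1) (pr t.1.2)
  - (a t.1.2 : R) *: wedge2 (pr t.1.1) (pr t.2)
  + (a t.1.1 : R) *: wedge2 (pr t.1.2) (pr t.2).

Lemma contr_rel x y : ext3_rel x y -> meval contr_fun x = meval contr_fun y.
Proof.
have AC (V : lmodType R) (x1 x2 y1 y2 z1 z2 : V) :
    x1 + x2 - (y1 + y2) + (z1 + z2) = x1 - y1 + z1 + (x2 - y2 + z2).
  by rewrite opprD [x1 + x2 + _]addrACA [LHS]addrACA.
have lZ (V : lmodType R) (r : R) (x1 y1 z1 : V) :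
    r *: (x1 - y1 + z1) = r *: x1 - r *: y1 + r *: z1.
  by rewrite scalerDr scalerBr.
have pZ r u : pr (r *: u) = r *: pr u by rewrite linearZ.
have aZ r u : a (r *: u) = r * (a u : R) :> R by rewrite linearZ.
case; rewrite /= /contr_fun /=.
- by move=> u u' v w; rewrite !linearD !wedge2Dl !scalerDr scalerDl AC.
- by move=> u v v' w; rewrite !linearD !wedge2Dl !wedge2Dr !scalerDr scalerDl AC.
- by move=> u v w w'; rewrite !linearD !wedge2Dr !scalerDr scalerDl AC.
- by move=> r u v w; rewrite lZ !pZ !aZ !wedge2Zl !scalerA !(mulrC r).
- by move=> r u v w; rewrite lZ !pZ !aZ !wedge2Zl !wedge2Zr !scalerA !(mulrC r).
- by move=> r u v w; rewrite lZ !pZ !aZ !wedge2Zr !scalerA !(mulrC r).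
- by move=> u w; rewrite wedge2xx scaler0 sub0r addNr.
- by move=> u v; rewrite wedge2xx scaler0 subrr add0r.
- by move=> u v; rewrite wedge2xx scaler0 subr0 (wedge2C (pr v)) scalerN subrr.
Qed.

Definition contr : Ext3 M -> Ext2 K := pmod_lift contr_fun.
HB.instance Definition _ := GRing.isLinear.Build R (Ext3 M) (Ext2 K) *:%R contr
  (pmod_lift_linear contr_rel).
Lemma contrE x y z : contr (wedge3 x y z) =
  (a z : R) *: wedge2 (pr x) (pr y) - (a y : R) *: wedge2 (pr x) (pr z)
  + (a x : R) *: wedge2 (pr y) (pr z).
Proof. exact: pmod_liftE contr_rel _. Qed.
End Contraction.

Section WedgeLast.
Context (R : comPzRingType) (K M : lmodType R) (i : {linear K -> M}) (v : M).

Definition wedge_last_fun (t : K * K) : Ext3 M := wedge3 (i t.1) (i t.2) v.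
Lemma wedge_last_rel x y :
  ext2_rel x y -> meval wedge_last_fun x = meval wedge_last_fun y.
Proof.
by case; rewrite /= /wedge_last_fun /= => *;
  rewrite ?linearD ?linearZ /= ?(wedge3D, wedge3Z, wedge3_alt).
Qed.
Definition wedge_last : Ext2 K -> Ext3 M := pmod_lift wedge_last_fun.
HB.instance Definition _ := GRing.isLinear.Build R (Ext2 K) (Ext3 M) *:%R wedge_last
  (pmod_lift_linear wedge_last_rel).
Lemma wedge_lastE x y : wedge_last (wedge2 x y) = wedge3 (i x) (i y) v.
Proof. exact: pmod_liftE wedge_last_rel _. Qed.

Context (pr : {linear M -> K}) (a : {linear M -> R^o}).
Context (pri : forall k, pr (i k) = k) (prv : pr v = 0)
  (ai : forall k, a (i k) = 0) (av : a v = 1)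
  (dec : forall m, m = i (pr m) + (a m : R) *: v)
  (van : forall x y z : K, wedge3 x y z = 0).

Lemma wedge_lastK : cancel wedge_last (contr pr a).
Proof.
apply: pmod_genP => [|x y hx hy|r x hx|[x y]].
- by rewrite linear0 /= linear0.
- by rewrite linearD /= linearD /= hx hy.
- by rewrite linearZ /= linearZ /= hx.
- rewrite wedge_lastE contrE !pri prv !ai av !scale0r subr0 addr0.
  by rewrite scale1r.
Qed.

Let img3_fun (t : K * K * K) : Ext3 M := wedge3 (i t.1.1) (i t.1.2) (i t.2).
Let img3_rel x y : ext3_rel x y -> meval img3_fun x = meval img3_fun y.
Proof.
by case; rewrite /= /img3_fun /= => *;
  rewrite ?linearD ?linearZ /= ?(wedge3D, wedge3Z, wedge3_alt).
Qed.
Let img3_0 x y z : wedge3 (i x) (i y) (i z) = 0.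
Proof.
have -> : wedge3 (i x) (i y) (i z) = pmod_lift img3_fun (wedge3 x y z).
  by rewrite [RHS](pmod_liftE img3_rel).
rewrite van; exact: (pmod_liftE img3_rel MZero).
Qed.

Lemma contrK : cancel (contr pr a) wedge_last.
Proof.
apply: pmod_genP => [|x y hx hy|r x hx|[[x y] z]].
- by rewrite linear0 /= linear0.
- by rewrite linearD /= linearD /= hx hy.
- by rewrite linearZ /= linearZ /= hx.
- rewrite -[pmod_gen _ _]/(wedge3 x y z) contrE !(linearD, linearN, linearZ) /=.
  rewrite !wedge_lastE [in RHS](dec x) [in RHS](dec y) [in RHS](dec z).
  rewrite !wedge3D !wedge3Z !wedge3_alt img3_0 !scaler0 !addr0 add0r.
  rewrite (wedge3_swap23 _ v) (wedge3_swap12 v) (wedge3_swap23 _ v) !scalerN.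
  by rewrite opprK.
Qed.

Definition wedge_last_liso : liso (Ext2 K) (Ext3 M) :=
  @LIso _ _ _ (wedge_last : {linear _ -> _}) (contr pr a) wedge_lastK contrK.
End WedgeLast.

(* An isomorphism P -> P^v, seen as the form (p, q) |-> f(p)(q), with
   f(p)(p) = 0; the last two fields are injectivity and surjectivity of
   P -> P^v. *)
Record altiso (R : comPzRingType) (P : lmodType R) := AltIso {
  aform :> P -> P -> R;
  aform_linl : forall q, scalar (fun p => aform p q);
  aform_linr : forall p, scalar (aform p);
  aform_alt : forall p, aform p p = 0;
  aform_inj : forall p, (forall q, aform p q = 0) -> p = 0;
  aform_surj : forall g : {linear P -> R^o}, exists p, forall q, aform p q = g q }.

Section Forms.
Context (R : comPzRingType).

Lemma scalar_facts (V : lmodType R) (f : V -> R) : scalar f ->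
  [/\ f 0 = 0, forall x y, f (x + y) = f x + f y & forall r x, f (r *: x) = r * f x].
Proof.
move=> h.
have D x y : f (x + y) = f x + f y by have := h 1 x y; rewrite scale1r mul1r.
have f0 : f 0 = 0 by apply: (@addrI _ (f 0)); rewrite -D !addr0.
by split => // r x; have := h r x 0; rewrite f0 !addr0.
Qed.

Section Perp.
Context (P Q : lmodType R) (f : altiso P) (g : altiso Q).
Definition perp_form (x y : P * Q) : R := f x.1 y.1 + g x.2 y.2.
Let lf := fun q => scalar_facts (aform_linl f q).
Let lg := fun q => scalar_facts (aform_linl g q).
Let rf := fun q => scalar_facts (aform_linr f q).
Let rg := fun q => scalar_facts (aform_linr g q).

Lemma perp_linl y : scalar (perp_form^~ y).
Proof.
move=> a u v; rewrite /perp_form /= aform_linl [X in _ + X]aform_linl.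
by rewrite mulrDr addrACA.
Qed.
Lemma perp_linr x : scalar (perp_form x).
Proof.
move=> a u v; rewrite /perp_form /= aform_linr [X in _ + X]aform_linr.
by rewrite mulrDr addrACA.
Qed.
Lemma perp_alt x : perp_form x x = 0.
Proof. by rewrite /perp_form !aform_alt addr0. Qed.
Lemma perp_inj x : (forall y, perp_form x y = 0) -> x = 0.
Proof.
case: x => p q h; congr pair; [apply: (@aform_inj _ _ f)|apply: (@aform_inj _ _ g)] => y.
- have := h (y, 0); rewrite /perp_form /=.
  by have [-> _ _] := rg q; rewrite addr0.
- have := h (0, y); rewrite /perp_form /=.
  by have [-> _ _] := rf p; rewrite add0r.
Qed.
Lemma perp_surj (k : {linear (P * Q)%type -> R^o}) :
  exists x, forall y, perp_form x y = k y.
Proof.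
pose il (x : P) : P * Q := (x, 0); pose ir (y : Q) : P * Q := (0, y).
have lil : linear il by move=> a u v; congr pair; rewrite /= ?scaler0 ?addr0.
have lir : linear ir by move=> a u v; congr pair; rewrite /= ?scaler0 ?addr0.
have [p hp] := aform_surj f (k \o Linear_of lil).
have [q hq] := aform_surj g (k \o Linear_of lir).
exists (p, q) => -[u v]; rewrite /perp_form hp hq /= -linearD; congr (k _).
by congr pair; rewrite ?addr0 ?add0r.
Qed.
Definition perp : altiso (P * Q)%type :=
  AltIso perp_linl perp_linr perp_alt perp_inj perp_surj.
End Perp.

Section Pullback.
Context (P Q : lmodType R) (h : {linear P -> Q}) (bh : bijective h) (f : altiso Q).
Definition pullback_form (x y : P) : R := f (h x) (h y).
Lemma pullback_linl y : scalar (pullback_form^~ y).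
Proof. by move=> a u v; rewrite /pullback_form linearP aform_linl. Qed.
Lemma pullback_linr x : scalar (pullback_form x).
Proof. by move=> a u v; rewrite /pullback_form linearP aform_linr. Qed.
Lemma pullback_alt x : pullback_form x x = 0.
Proof. exact: aform_alt. Qed.
Lemma pullback_inj x : (forall y, pullback_form x y = 0) -> x = 0.
Proof.
move=> E; apply: (bij_inj bh); rewrite linear0; apply: (@aform_inj _ _ f) => y.
by have [k _ kK] := bh; rewrite -(kK y); exact: E.
Qed.
Lemma pullback_surj (g : {linear P -> R^o}) :
  exists x, forall y, pullback_form x y = g y.
Proof.
have [k hK kK] := bh.
have lk : linear k.
  by move=> a u v; apply: (bij_inj bh); rewrite linearP !kK.
have [x hx] := aform_surj f (g \o Linear_of lk).
by exists (k x) => y; rewrite /pullback_form kK hx /= hK.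
Qed.
Definition pullback : altiso P :=
  AltIso pullback_linl pullback_linr pullback_alt pullback_inj pullback_surj.
End Pullback.

Section Psi2.
Definition psi2_form (x y : R^o * R^o) : R := (x.1 : R) * y.2 - (x.2 : R) * y.1.
Lemma psi2_linl y : scalar (psi2_form^~ y).
Proof.
move=> a u v; rewrite /psi2_form /= /GRing.scale /=.
by rewrite mulrBr !mulrDl opprD addrACA !mulrA.
Qed.
Lemma psi2_linr x : scalar (psi2_form x).
Proof.
move=> a u v; rewrite /psi2_form /= /GRing.scale /=.
by rewrite mulrBr !(mulrDr x.1, mulrDr x.2) opprD addrACA !(mulrCA a).
Qed.
Lemma psi2_alt x : psi2_form x x = 0.
Proof. by rewrite /psi2_form mulrC subrr. Qed.
Lemma psi2_inj x : (forall y, psi2_form x y = 0) -> x = 0.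
Proof.
case: x => a b h; congr pair.
- by have := h (0, 1); rewrite /psi2_form /= mulr1 mulr0 subr0.
- have := h (1, 0); rewrite /psi2_form /= mulr1 mulr0 sub0r.
  by move=> /eqP; rewrite oppr_eq0 => /eqP.
Qed.
Lemma psi2_surj (g : {linear (R^o * R^o)%type -> R^o}) :
  exists x, forall y, psi2_form x y = g y.
Proof.
pose e1 : (R^o * R^o)%type := (1, 0); pose e2 : (R^o * R^o)%type := (0, 1).
exists (g e2, - g e1) => -[a b]; rewrite /psi2_form /= mulNr opprK.
have -> : (a, b) = b *: e2 + a *: e1.
  by congr pair; rewrite /= scaler0 ?add0r ?addr0 /GRing.scale /= mulr1.
by rewrite linearD !linearZ /= /GRing.scale /= !(mulrC (g _ : R)).
Qed.
Definition psi2 : altiso (R^o * R^o)%type :=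
  AltIso psi2_linl psi2_linr psi2_alt psi2_inj psi2_surj.
End Psi2.

Section Reassoc.
Context (P : lmodType R).
Definition reassoc (x : P * R^o * R^o) : P * (R^o * R^o) := (x.1.1, (x.1.2, x.2)).
Lemma reassoc_linear : linear reassoc. Proof. by []. Qed.
Lemma reassoc_bij : bijective reassoc.
Proof. by exists (fun y => (y.1, y.2.1, y.2.2)); [case=> [[]] | case=> ? []]. Qed.
(* f _|_ psi_2 on P + R + R, the last two summands carrying psi_2. *)
Definition perp_psi2 (f : altiso P) : altiso (P * R^o * R^o)%type :=
  @pullback _ _ (Linear_of reassoc_linear) reassoc_bij (perp f psi2).
End Reassoc.

Section Trivialization.
Context (K : lmodType R) (fgpK : fg_projective K)
  (van : forall x y z : K, wedge3 x y z = 0) (theta : liso R^o (Ext2 K)).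
(* (p, q) |-> theta^-1 (p ^ q); it is non-degenerate when Ext3 K = 0. *)
Definition triv_form (x y : K) : R := liso_inv theta (wedge2 x y).

Lemma liso_inv_scalar : scalar (liso_inv theta : Ext2 K -> R).
Proof.
move=> a u v; apply: (can_inj (lisoK theta)).
rewrite [RHS](@linearP _ _ _ _ theta a (liso_inv theta u) (liso_inv theta v)).
by rewrite !liso_invK.
Qed.
Lemma triv_linl y : scalar (triv_form^~ y).
Proof.
move=> a u v; rewrite /triv_form wedge2Dl wedge2Zl; exact: liso_inv_scalar.
Qed.
Lemma triv_linr x : scalar (triv_form x).
Proof.
move=> a u v; rewrite /triv_form wedge2Dr wedge2Zr; exact: liso_inv_scalar.
Qed.
Lemma triv_alt x : triv_form x x = 0.
Proof. by rewrite /triv_form wedge2xx; have [-> _ _] := scalar_facts liso_inv_scalar. Qed.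

Lemma triv_contr (f : {linear K -> R^o}) (x y z : K) :
  (f z : R) *: wedge2 x y - (f y : R) *: wedge2 x z + (f x : R) *: wedge2 y z = 0.
Proof. by have := contrE (idfun : {linear K -> K}) f x y z; rewrite van linear0. Qed.

Lemma triv_inj x : (forall y, triv_form x y = 0) -> x = 0.
Proof.
move=> h.
have h2 y : wedge2 x y = 0.
  rewrite -(liso_invK theta (wedge2 x y)) [liso_inv _ _]h.
  exact: linear0.
apply: fgp_separated => // f.
have Z (q : Ext2 K) : (f x : R) *: q = 0.
  elim/pmod_genP: q => [|p q hp hq|r q hq|[y z]].
  - by rewrite scaler0.
  - by rewrite scalerDr hp hq addr0.
  - by rewrite scalerA mulrC -scalerA hq scaler0.
  - by have := triv_contr f x y z; rewrite !h2 !scaler0 subr0 add0r.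
have := Z (theta 1); rewrite -linearZ => E.
have := congr1 (liso_inv theta) E; rewrite lisoK -(linear0 theta) lisoK.
by rewrite /GRing.scale /= mulr1.
Qed.

Lemma triv_surj (f : {linear K -> R^o}) : exists x, forall y, triv_form x y = f y.
Proof.
have Z (q : Ext2 K) : exists x, forall y, wedge2 x y = (f y : R) *: q.
  elim/pmod_genP: q => [|p q [u hu] [v hv]|r q [u hu]|[u v]].
  - by exists 0 => y; rewrite scaler0 -(scale0r 0) wedge2Zl scale0r.
  - by exists (u + v) => y; rewrite wedge2Dl hu hv scalerDr.
  - by exists (r *: u) => y; rewrite wedge2Zl hu !scalerA mulrC.
  - exists ((f v : R) *: u - (f u : R) *: v) => y.
    rewrite wedge2Dl -scaleN1r !wedge2Zl scaleN1r.
    have := triv_contr f u v y => /eqP.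
    rewrite -addrA addr_eq0 opprD opprK => /eqP ->.
    by [].
have [x hx] := Z (theta 1); exists x => y.
rewrite /triv_form hx; have [_ _ ->] := scalar_facts liso_inv_scalar.
by rewrite lisoK mulr1.
Qed.

Definition triv_altiso : altiso K :=
  AltIso triv_linl triv_linr triv_alt triv_inj triv_surj.
End Trivialization.
End Forms.

Record Um (R : pzRingType) (P : lmodType R) := UmPack {
  um_fun :> {linear P -> R^o};
  um_surj : forall r, exists x, um_fun x = r }.

Section Kernel.
Context (R : pzRingType) (M : lmodType R) (a : {linear M -> R^o}).
Definition ker_pred : {pred M} := [pred x | a x == 0].
Lemma ker_pred_closed : submod_closed ker_pred.
Proof.
split=> [|r x y]; rewrite !inE ?linear0 // => /eqP ax /eqP ay.
by rewrite linearP ax ay scaler0 addr0.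
Qed.
HB.instance Definition _ := GRing.isSubmodClosed.Build R M ker_pred ker_pred_closed.
Record kermod : Type := Ker { ker_val : M; ker_valP : ker_val \in ker_pred }.
HB.instance Definition _ := [isSub for ker_val].
HB.instance Definition _ := [Choice of kermod by <:].
HB.instance Definition _ := [SubChoice_isSubLmodule of kermod by <:].
End Kernel.


Record section_of (R : pzRingType) (P : lmodType R) (a : Um P) := SectionOf {
  sec_fun :> {linear R^o -> P};
  secK : forall r, a (sec_fun r) = r }.

Section Isos.
Context (R : pzRingType) (L M N : lmodType R).
Lemma liso_inv_linear (f : liso M N) : linear (liso_inv f).
Proof.
by move=> a u v; apply: (can_inj (lisoK f)); rewrite linearP !liso_invK.
Qed.
Definition liso_sym (f : liso M N) : liso N M :=
  @LIso _ _ _ (Linear_of (liso_inv_linear f)) f (liso_invK f) (lisoK f).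
Definition liso_trans (f : liso L M) (g : liso M N) : liso L N :=
  @LIso _ _ _ (g \o f) (liso_inv f \o liso_inv g)
    (can_comp (lisoK g) (lisoK f)) (can_comp (liso_invK f) (liso_invK g)).
End Isos.

Section KernelProj.
Context (R : comPzRingType) (M : lmodType R) (a : Um M) (s : section_of a).

Lemma ker_proj_in (x : M) : x - s (a x) \in ker_pred a.
Proof. by rewrite inE linearB secK subrr. Qed.
Definition ker_proj (x : M) : kermod a := Ker (ker_proj_in x).
Lemma ker_proj_linear : linear ker_proj.
Proof.
move=> r x y; apply: val_inj; rewrite [RHS]linearP /=.
by rewrite (linearP a) (linearP s) opprD -scalerN addrACA -scalerDr.
Qed.
HB.instance Definition _ := GRing.isLinear.Build R M (kermod a) *:%R ker_proj ker_proj_linear.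

Lemma ker_val0 (k : kermod a) : a (val k) = 0.
Proof. by apply/eqP; exact: ker_valP. Qed.

Lemma ker_projK (k : kermod a) : ker_proj (val k) = k.
Proof. by apply: val_inj; rewrite /= ker_val0 linear0 subr0. Qed.

(* i_s : M -> ker a + R, for a section s of a. *)
Definition ker_split (x : M) : kermod a * R^o := (ker_proj x, a x).
Lemma ker_split_linear : linear ker_split.
Proof. by move=> r x y; congr pair; rewrite linearP. Qed.

Lemma ker_splitK : cancel ker_split (fun y => val y.1 + s y.2).
Proof. by move=> x; rewrite /= subrK. Qed.
Lemma ker_splitVK : cancel (fun y => val y.1 + s y.2) ker_split.
Proof.
move=> [k r]; congr pair.
  by apply: val_inj; rewrite /= linearD ker_val0 add0r secK addrK.
by rewrite linearD ker_val0 add0r secK.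
Qed.

Definition stab_split (x : M * R^o) : kermod a * R^o * R^o := (ker_split x.1, x.2).
Lemma stab_split_linear : linear stab_split.
Proof. by move=> r x y; congr pair; exact: ker_split_linear. Qed.
Lemma stab_split_bij : bijective stab_split.
Proof.
exists (fun y => (val y.1.1 + s y.1.2, y.2)) => -[x r]; rewrite /stab_split /=.
  by congr pair; exact: ker_splitK.
by rewrite ker_splitVK.
Qed.

Lemma fgp_ker : fg_projective M -> fg_projective (kermod a).
Proof. by apply: (@fgp_retract _ _ _ (val : {linear kermod a -> M}) ker_proj) ker_projK. Qed.

Lemma ker_local_2gen_at (p : R -> Prop) (e1 e2 e3 : M) : is_prime p ->
  ~ p (a e3) ->
  (forall x, exists t, ~ p t /\ exists c1 c2 c3,
     t *: x = c1 *: e1 + c2 *: e2 + c3 *: e3) ->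
  exists u1 u2 : kermod a, forall x, exists t, ~ p t /\
    exists c d, t *: x = c *: u1 + d *: u2.
Proof.
move=> hp h3 h.
have aZ r x : a (r *: x) = r * (a x : R) :> R by rewrite linearZ.
have inK (e : M) : (a e3 : R) *: e - (a e : R) *: e3 \in ker_pred a.
  by rewrite inE linearB /= !aZ mulrC subrr.
exists (Ker (inK e1)), (Ker (inK e2)) => x.
have [t [nt [c1 [c2 [c3 E]]]]] := h (val x).
exists (a e3 * t); split; first by move=> /(prime_mul hp) [].
exists c1, c2; apply: val_inj.
rewrite -[LHS]/((a e3 * t) *: val x).
rewrite -[RHS]/(c1 *: ((a e3 : R) *: e1 - (a e1 : R) *: e3)
              + c2 *: ((a e3 : R) *: e2 - (a e2 : R) *: e3)).
have Ea : c1 * (a e1 : R) + c2 * (a e2 : R) + c3 * (a e3 : R) = 0.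
  by rewrite -!aZ -!linearD -E linearZ /= ker_val0 scaler0.
rewrite -scalerA E.
rewrite !scalerDr !scalerN !scalerA !(mulrC (a e3)).
rewrite [RHS]addrACA; congr (_ + _).
rewrite -opprD -scalerDl; apply/eqP; rewrite -subr_eq0 opprK -scalerDl.
by rewrite addrC Ea scale0r.
Qed.
End KernelProj.

Section Vaserstein.
Context (R : comPzRingType) (P0 : lmodType R).
Context (fgpP0 : fg_projective P0) (rkP0 : constant_rank P0 2).
Context (theta0 : liso R^o (Ext2 P0)).

Let van0 := wedge3_vanish (constant_rank2_local rkP0).

Definition chi0 : altiso P0 := triv_altiso fgpP0 van0 theta0.

Lemma fgp_P0R : fg_projective (P0 * R^o)%type.
Proof. exact: fgp_prod fgpP0 (fgp_regular R). Qed.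
Lemma fgp_P0RR : fg_projective (P0 * R^o * R^o)%type.
Proof. exact: fgp_prod fgp_P0R (fgp_regular R). Qed.

Definition inl0 (x : P0) : P0 * R^o := (x, 0).
Lemma inl0_linear : linear inl0.
Proof. by move=> a u v; congr pair; rewrite /= ?scaler0 ?addr0. Qed.
HB.instance Definition _ := GRing.isLinear.Build R P0 (P0 * R^o)%type *:%R inl0 inl0_linear.
Definition fst0 : {linear (P0 * R^o)%type -> P0} := fst.
Definition snd0 : {linear (P0 * R^o)%type -> R^o} := snd.

Lemma inl0_dec (m : P0 * R^o) : m = inl0 (fst0 m) + (snd0 m : R) *: ((0, 1) : P0 * R^o).
Proof.
by case: m => x r; congr pair; rewrite /= ?scaler0 ?addr0 ?add0r // /GRing.scale /= mulr1.
Qed.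

(* x ^ y |-> x ^ y ^ (0, 1) *)
Definition det_stab : liso (Ext2 P0) (Ext3 (P0 * R^o)%type) :=
  @wedge_last_liso _ _ _ inl0 (0, 1) fst0 snd0
    (fun=> erefl) erefl (fun=> erefl) erefl inl0_dec van0.

Section At.
Context (a : Um (P0 * R^o)%type) (s : section_of a).

Lemma ker_local_2gen : locally_2gen (kermod a).
Proof.
move=> p hp; have [e1 [e2 he]] := constant_rank2_local rkP0 hp.
pose E1 := inl0 e1; pose E2 := inl0 e2; pose E3 : P0 * R^o := (0, 1).
have hE x : exists t, ~ p t /\ exists c1 c2 c3,
    t *: x = c1 *: E1 + c2 *: E2 + c3 *: E3.
  have [t [nt [c [d E]]]] := he x.1.
  exists t; split => //; exists c, d, (t * x.2).
  case: x E => x r /= E; congr pair; rewrite /= ?scaler0 ?addr0 ?add0r //.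
  by rewrite /GRing.scale /= mulr1.
have [t [nt [c1 [c2 [c3 E]]]]] := hE (s 1).
have [h3|/contrapT h3] := pselect (~ p (a E3)).
  exact: (ker_local_2gen_at hp h3 hE).
have [h2|/contrapT h2] := pselect (~ p (a E2)).
  apply: (ker_local_2gen_at (e1 := E1) (e2 := E3) hp h2) => x.
  have [r [nr [b1 [b2 [b3 F]]]]] := hE x.
  by exists r; split => //; exists b1, b3, b2; rewrite F addrAC.
have [h1|/contrapT h1] := pselect (~ p (a E1)).
  apply: (ker_local_2gen_at (e1 := E3) (e2 := E2) hp h1) => x.
  have [r [nr [b1 [b2 [b3 F]]]]] := hE x.
  by exists r; split => //; exists b3, b2, b1; rewrite F addrC [_ + b2 *: _]addrC addrA.
case: nt; have [[p0 pD pM] _ _] := hp.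
have := congr1 a E; rewrite linearZ /= secK !linearD !linearZ /= /GRing.scale /= mulr1.
by move=> ->; apply: (pD); [apply: (pD)|]; exact: pM.
Qed.

Lemma ker_wedge3 (x y z : kermod a) : wedge3 x y z = 0.
Proof. exact: wedge3_vanish ker_local_2gen x y z. Qed.

Lemma ker_dec (m : P0 * R^o) : m = val (ker_proj s m) + (a m : R) *: s 1.
Proof. by rewrite -linearZ /= /GRing.scale /= mulr1 subrK. Qed.
Lemma ker_proj_sec : ker_proj s (s 1) = 0.
Proof. by apply: val_inj; rewrite /= secK subrr. Qed.

(* p ^ q |-> p ^ q ^ s(1) *)
Definition det_ker : liso (Ext2 (kermod a)) (Ext3 (P0 * R^o)%type) :=
  @wedge_last_liso _ _ _ (val : {linear kermod a -> _}) (s 1) (ker_proj s) a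
    (ker_projK s) ker_proj_sec (@ker_val0 _ _ a) (secK s 1) ker_dec ker_wedge3.

(* R -> det P0 -> det (P0 + R) <- det (ker a) *)
Definition theta : liso R^o (Ext2 (kermod a)) :=
  liso_trans (liso_trans theta0 det_stab) (liso_sym det_ker).

Definition chi : altiso (kermod a) :=
  triv_altiso (fgp_ker s fgp_P0R) ker_wedge3 theta.

(* (i_s + 1)^t (chi_a _|_ psi_2) (i_s + 1) *)
Definition Vform : altiso (P0 * R^o * R^o)%type :=
  @pullback _ _ _ (Linear_of (stab_split_linear s)) (stab_split_bij s) (perp_psi2 chi).
End At.
End Vaserstein.

Section Groups.
Context (R : comPzRingType) (P : lmodType R).

(* The determinant of an endomorphism phi of a finitely generated projective
   module P of possibly non-constant rank: det (phi + id_Q) for any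
   complement Q such that P + Q is free of finite rank; it does not depend on
   the complement. *)
Definition has_det (phi : {linear P -> P}) (d : R) : Prop :=
  exists (n : nat) (Q : lmodType R) (f : {linear (P * Q)%type -> 'rV[R]_n})
    (A : 'M[R]_n),
    [/\ bijective f, forall x y, f (phi x, y) = f (x, y) *m A & \det A = d].

Definition in_SL (phi : {linear P -> P}) : Prop := bijective phi /\ has_det phi 1.

Definition in_Sp (c : altiso P) (phi : {linear P -> P}) : Prop :=
  bijective phi /\ forall x y, c (phi x) (phi y) = c x y.

Definition lin_orbit (G : {linear P -> P} -> Prop) (e x : P) : Prop :=
  exists phi : {linear P -> P}, G phi /\ phi e = x.
End Groups.

Definition Um_SL_equiv (R : comPzRingType) (P : lmodType R) (a b : Um P) : Prop :=
  exists phi : {linear P -> P}, in_SL phi /\ forall x, b x = a (phi x).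

Record triple (R : comPzRingType) := Triple {
  tmod : lmodType R;
  tfgp : fg_projective tmod;
  tform0 : altiso tmod;
  tform1 : altiso tmod }.

Definition isometric (R : comPzRingType) (t u : triple R) : Prop :=
  exists h : {linear tmod t -> tmod u},
    [/\ bijective h,
        forall x y, tform0 t x y = tform0 u (h x) (h y) &
        forall x y, tform1 t x y = tform1 u (h x) (h y)].

Section V.
Context (R : comPzRingType).
Local Notation term := (mterm int (triple R)).

(* Elements of V(R) and V_SL(R) are represented by formal Z-linear
   combinations of triples; V_eq and VSL_eq are the equalities of V(R) and
   V_SL(R).  The quotients are not formed as zmodTypes because triples
   live in a larger universe than the modules. *)
Definition V_class (P : lmodType R) (hP : fg_projective P) (f0 f1 : altiso P) : term :=
  MGen (Triple hP f0 f1).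

Inductive V_rel : term -> term -> Prop :=
| V_isometry t u : isometric t u -> V_rel (MGen t) (MGen u)
| V_perp P P' (hP : fg_projective P) (hP' : fg_projective P')
    (g f : altiso P) (g' f' : altiso P') :
    V_rel (V_class (fgp_prod hP hP') (perp g g') (perp f f'))
          (MAdd (V_class hP g f) (V_class hP' g' f'))
| V_trans P (hP : fg_projective P) (f0 f1 f2 : altiso P) :
    V_rel (MAdd (V_class hP f0 f1) (V_class hP f1 f2)) (V_class hP f0 f2).

Inductive VSL_rel : term -> term -> Prop :=
| VSL_V x y : V_rel x y -> VSL_rel x y
| VSL_SL P (hP : fg_projective P) (g f : altiso P) (phi : {linear P -> P})
    (sl : in_SL phi) : VSL_rel (V_class hP g f) (V_class hP g (pullback (proj1 sl) f)).

Definition V_eq : term -> term -> Prop := meq V_rel.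
Definition VSL_eq : term -> term -> Prop := meq VSL_rel.
End V.

Section AltMatrices.
Context (R : comPzRingType).

Record altmx (n : nat) := AltMx {
  altmx_val :> 'M[R]_n;
  altmx_skew : forall i j, altmx_val i j = - altmx_val j i;
  altmx_diag : forall i, altmx_val i i = 0;
  altmx_inv : exists N, altmx_val *m N = 1%:M /\ N *m altmx_val = 1%:M }.

Section Form.
Context (n : nat) (M : altmx n).
Definition mx_form (x y : 'rV[R]_n) : R := (x *m M *m y^T) 0 0.

Lemma mx_formE x y : mx_form x y = \sum_j (x *m M) 0 j * y 0 j.
Proof. by rewrite /mx_form mxE; apply: eq_bigr => j _; rewrite !mxE. Qed.

Lemma mx_linl y : scalar (mx_form^~ y).
Proof. by move=> a u v; rewrite /mx_form !mulmxDl -!scalemxAl !mxE. Qed.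
Lemma mx_linr x : scalar (mx_form x).
Proof.
by move=> a u v; rewrite /mx_form linearP /= mulmxDr -scalemxAr !mxE.
Qed.
Lemma mx_alt x : mx_form x x = 0.
Proof.
rewrite mx_formE.
under eq_bigr => j _ do rewrite mxE mulr_suml.
rewrite pair_big /=.
rewrite (bigID (fun p : 'I_n * 'I_n => (p.1 < p.2)%N)) /=.
rewrite [X in _ + X](bigID (fun p : 'I_n * 'I_n => p.1 == p.2)) /=.
rewrite [X in _ + (X + _)]big1 ?add0r; last first.
  by move=> [i j] /= /andP [_ /eqP ->]; rewrite altmx_diag mulr0 mul0r.
rewrite [X in _ + X](reindex_inj (h := fun p => (p.2, p.1))) /=; last first.
  by move=> [i j] [k l] [-> ->].
rewrite [X in _ + X](eq_bigl (fun p : 'I_n * 'I_n => (p.1 < p.2)%N)); last first.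
  by move=> [i j] /=; rewrite -leqNgt eq_sym -val_eqE /= ltn_neqAle andbC.
rewrite -big_split /= big1 // => -[i j] _ /=.
by rewrite (altmx_skew M i j) mulrN mulNr !(mulrAC _ (M _ _)) (mulrC (x 0 i)) subrr.
Qed.
Lemma mx_inj x : (forall y, mx_form x y = 0) -> x = 0.
Proof.
move=> h; have [N [MN _]] := altmx_inv M.
have E : x *m M = 0.
  apply/rowP => j; have := h (delta_mx 0 j).
  rewrite mx_formE (bigD1 j) //= big1 => [|k kj]; rewrite !mxE ?eqxx ?(negPf kj).
    by rewrite mulr1 addr0.
  by rewrite mulr0.
by rewrite -[x]mulmx1 -MN mulmxA E mul0mx.
Qed.
Lemma mx_surj (g : {linear 'rV[R]_n -> R^o}) : exists x, forall y, mx_form x y = g y.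
Proof.
have [N [_ NM]] := altmx_inv M.
exists ((\row_j (g (delta_mx 0 j) : R)) *m N) => y.
rewrite mx_formE -mulmxA NM mulmx1 [in RHS](row_sum_delta y) linear_sum.
by apply: eq_bigr => j _; rewrite mxE linearZ /= mulrC.
Qed.
Definition mx_altiso : altiso 'rV[R]_n :=
  AltIso mx_linl mx_linr mx_alt mx_inj mx_surj.
End Form.

Definition psi2_mx : 'M[R]_2 :=
  \matrix_(i, j) (if (i < j)%N then 1 else if (j < i)%N then -1 else 0).

(* psi_2 _|_ ... _|_ psi_2 (n copies) *)
Fixpoint psi_mx (n : nat) : 'M[R]_(n.*2) :=
  match n with
  | 0 => 0
  | n'.+1 => block_mx psi2_mx 0 0 (psi_mx n') : 'M[R]_(2 + n'.*2)
  end.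

Lemma psi2_mx_sq : psi2_mx *m psi2_mx = - 1%:M.
Proof.
apply/matrixP => i j; rewrite !mxE !big_ord_recl big_ord0 !mxE.
by case: i => [[|[|]]] // ?; case: j => [[|[|]]] // ?;
  rewrite /= ?(mulr0, mul0r, mulr1, mul1r, mulrN1, mulr0n, add0r, addr0, oppr0).
Qed.

Lemma psi_mx_sq n : psi_mx n *m psi_mx n = - 1%:M.
Proof.
elim: n => [|n IH]; first by apply/matrixP => -[].
rewrite /= (@mulmx_block _ 2 n.*2 2 n.*2 2 n.*2) !(mulmx0, mul0mx) !addr0 add0r.
rewrite psi2_mx_sq IH; apply: etrans (congr1 -%R (esym (@scalar_mx_block R 2 n.*2 1))).
by rewrite opp_block_mx !oppr0.
Qed.

Lemma psi_mx_skew n : (psi_mx n)^T = - psi_mx n.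
Proof.
elim: n => [|n IH]; first by apply/matrixP => -[].
rewrite /= (@tr_block_mx _ 2 n.*2 2 n.*2) IH !trmx0 [RHS](@opp_block_mx _ 2 n.*2 2 n.*2) !oppr0.
suff -> : psi2_mx^T = - psi2_mx by [].
apply/matrixP => i j; rewrite !mxE.
by case: ltngtP; rewrite ?opprK ?oppr0.
Qed.

Lemma psi_mx_diag n i : psi_mx n i i = 0.
Proof.
elim: n i => [|n IH] i; first by case: i.
rewrite /=; case: (@split_ordP 2 n.*2 i) => j ->.
  by apply: etrans (@block_mxEul _ 2 n.*2 2 n.*2 _ _ _ _ j j) _; rewrite mxE ltnn.
by apply: etrans (@block_mxEdr _ 2 n.*2 2 n.*2 _ _ _ _ j j) _.
Qed.

Lemma psi_mx_skewE n i j : psi_mx n i j = - psi_mx n j i.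
Proof. by have /matrixP/(_ j i) := psi_mx_skew n; rewrite !mxE. Qed.

Lemma psi_mx_inv n :
  exists N, psi_mx n *m N = 1%:M /\ N *m psi_mx n = 1%:M.
Proof.
by exists (- psi_mx n); rewrite mulmxN mulNmx psi_mx_sq opprK.
Qed.

Definition psi n : altmx n.*2 :=
  AltMx (@psi_mx_skewE n) (@psi_mx_diag n) (psi_mx_inv n).

(* The Pfaffian, by expansion along the first row; Pf (psi_mx n) = 1. *)
Fixpoint Pf (n : nat) : 'M[R]_(n.*2) -> R :=
  match n with
  | 0 => fun=> 1
  | n'.+1 => fun M : 'M[R]_(n'.*2.+2) =>
      \sum_(j < n'.*2.+1) (-1) ^+ j * M ord0 (lift ord0 j)
        * Pf (row' j (row' ord0 (col' j (col' ord0 M))))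
  end.

(* The image in V(R) of the kernel W_E(R) of the Pfaffian, under
   M |-> [R^2n, psi_2n, M]. *)
Definition in_Vtilde (x : mterm int (triple R)) : Prop :=
  exists (n : nat) (M : altmx n.*2),
    Pf M = 1 /\
    V_eq x (V_class (fgp_row R n.*2) (mx_altiso (psi n)) (mx_altiso M)).
End AltMatrices.

Section TheMap.
Context (R : comPzRingType) (P0 : lmodType R) (fgpP0 : fg_projective P0)
  (rkP0 : constant_rank P0 2) (theta0 : liso R^o (Ext2 P0)).

Definition chi0_psi2 : altiso (P0 * R^o * R^o)%type :=
  perp_psi2 (chi0 fgpP0 rkP0 theta0).

(* A representative of V(a), computed with a section s of a; its class does
   not depend on s. *)
Definition Vmap (a : Um (P0 * R^o)%type) (s : section_of a) : mterm int (triple R) :=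
  V_class (fgp_P0RR fgpP0) chi0_psi2 (Vform fgpP0 rkP0 theta0 s).

(* Injectivity of the map induced by Vmap from Um (P0 + R) / SL (P0 + R) to
   V_SL(R). *)
Definition Vmap_injective : Prop :=
  forall (a b : Um (P0 * R^o)%type) (s : section_of a) (t : section_of b),
    VSL_eq (Vmap s) (Vmap t) -> Um_SL_equiv a b.
Definition e4 : (P0 * R^o * R^o)%type := (0, 1).
End TheMap.
Arguments e4 {R} P0.

(* Main.v *)
From HB Require Import structures.
Require Import Defs.
From mathcomp Require Import all_boot all_order all_fingroup all_algebra.
From mathcomp Require Import boolp classical_sets.
From mathcomp Require Import ring.
Set Implicit Arguments.
Unset Strict Implicit.
Unset Printing Implicit Defensive.
Import GRing.Theory.
Local Open Scope ring_scope.

(** Why the theorem holds.  Let P4 = P0 + R + R, M = P0 + R, let e4 be the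
    last basis vector of P4, and call pf(chi) the Pfaffian of a form chi on P4
    relative to chi0 _|_ psi_2.

    A non-degenerate form chi on P4 has a unimodular linear form
    a = - chi(e4, -) on M.  A transvection that fixes e4 turns chi into
    (u chi_a) _|_ psi_2, transported along P4 = ker a + R + R, for some u in R:
    on the rank two module ker a every form is a multiple of chi_a.  The scalar u
    is pf(chi) ([pf_Uform]), so a form with pf(chi) = 1 is V(a) up to an
    automorphism of determinant 1 that fixes e4 ([normal_form]).  In particular
    this applies to the forms whose class lies in the image of W_E(R), because
    the relative Pfaffian is an invariant of V_SL(R) ([tpf_teq]).

    If V is injective, let chi be such a form and phi in SL(P4).  Then chi and
    its pullback along phi are V(b) and V(a) up to SL, so V(a) = V(b) and
    b = a th with th in SL(M).  Now chi and its pullback along phi (th + 1)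
    have the same linear form b, so that both become V(b) by automorphisms
    fixing e4; comparing them produces an isometry of chi with the same value
    at e4 as phi.  Conversely an isometry of chi becomes an element of SL(P4)
    after scaling e3, which does not move e4.

    If the orbits agree and V(a) = V(b), then the two forms become isometric by
    an automorphism of determinant 1 after adding some (Q, h) to P4
    ([VSL_eq_teq]).  Since (Q, h) is a summand of a hyperbolic space
    ([std_embedding]), one may take hyperbolic planes, and as dim R <= 4 these
    can be cancelled one by one ([hyperbolic_cancel]).  The hypothesis for
    chi = V(a), whose class does lie in the image of W_E(R) since pf(V(a)) = 1,
    lets one correct the isometry so that it fixes e4.  It then induces th on
    M = P4 / R e4 with b = a th, and det th = 1 because pf(V(a)) = pf(V(b)).

    Four tools carry this.  Determinants of endomorphisms of projective modules
    come from Sylvester's identity ([mdet_sylv]).  Pfaffians are handled as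
    alternating multilinear functions of a sequence of vectors, which makes the
    formula Pf(A^t M A) = det A Pf M an instance of the uniqueness of the
    determinant ([alternating_det]).  Equality in V_SL(R) is turned into
    stable isometry by computing with triples up to stable isometry
    ([VSL_eq_nf]).  Cancellation combines a stable range theorem, deduced from
    Kronecker's theorem ([kronecker], [stable_range]), with Eichler
    transformations ([unimodular_transitive]). *)

(** * Linear maps and determinants of endomorphisms *)
Section LinearMaps.
Context (R : comPzRingType).

Definition lpair (M N N' : lmodType R) (f : M -> N) (g : M -> N') (x : M) : N * N' :=
  (f x, g x).
Lemma lpair_linear (M N N' : lmodType R) (f : {linear M -> N}) (g : {linear M -> N'}) :
  linear (lpair f g).
Proof. by move=> c u v; congr pair; rewrite /= linearP. Qed.
HB.instance Definition _ (M N N' : lmodType R) (f : {linear M -> N}) (g : {linear M -> N'}) :=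
  GRing.isLinear.Build R M (N * N')%type *:%R (lpair f g) (lpair_linear f g).

Definition prod_map (M M' N N' : lmodType R) (f : {linear M -> N}) (f' : {linear M' -> N'}) :
  {linear (M * M')%type -> (N * N')%type} := lpair (f \o fst) (f' \o snd).

Lemma bij_linear_inv (M N : lmodType R) (f : {linear M -> N}) : bijective f ->
  exists g : {linear N -> M}, cancel f g /\ cancel g f.
Proof.
move=> [g fK gK].
have lg : linear g by move=> c u v; apply: (can_inj fK); rewrite linearP !gK.
by exists (Linear_of lg).
Qed.

Section Lker.
Context (M N : lmodType R) (f : {linear M -> N}).
Definition lker_pred : {pred M} := [pred x | `[< f x = 0 >]].
Lemma lker_pred_closed : submod_closed lker_pred.
Proof.
split=> [|r x y]; first by apply/asboolP; exact: linear0.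
by move=> /asboolP fx /asboolP fy; apply/asboolP; rewrite linearP fx fy scaler0 addr0.
Qed.
HB.instance Definition _ := GRing.isSubmodClosed.Build R M lker_pred lker_pred_closed.
Record lker : Type := Lker { lker_val : M; lker_valP : lker_val \in lker_pred }.
HB.instance Definition _ := [isSub for lker_val].
HB.instance Definition _ := [Choice of lker by <:].
HB.instance Definition _ := [SubChoice_isSubLmodule of lker by <:].
Lemma lkerE (k : lker) : f (val k) = 0.
Proof. by apply/asboolP; exact: lker_valP. Qed.
Lemma lkerP (x : M) : f x = 0 -> x \in lker_pred.
Proof. by move=> fx; apply/asboolP. Qed.
End Lker.
End LinearMaps.

Section Det.
Context (R : comPzRingType).
Implicit Types P Q K : lmodType R.

(** Both sides are the determinant of the block matrix L, cleared by row and by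
    column operations. *)
Lemma det_1addC m n (U : 'M[R]_(n, m)) (W : 'M[R]_(m, n)) :
  \det (1%:M + U *m W) = \det (1%:M + W *m U).
Proof.
pose L := block_mx (1%:M : 'M[R]_n) (- U) W 1%:M.
have E1 : block_mx (1%:M : 'M[R]_n) 0 (- W) (1%:M : 'M[R]_m) *m L
          = block_mx 1%:M (- U) 0 (1%:M + W *m U).
  rewrite mulmx_block !mul1mx !mul0mx !addr0 mulmx1 mulmxN mulNmx opprK addNr.
  by rewrite addrC.
have E2 : L *m block_mx (1%:M : 'M[R]_n) 0 (- W) (1%:M : 'M[R]_m)
          = block_mx (1%:M + U *m W) (- U) 0 1%:M.
  rewrite mulmx_block !mulmx1 !mulmx0 !add0r mulmxN mulNmx opprK mul1mx subrr.
  by [].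
have := congr1 determinant E1; have := congr1 determinant E2.
rewrite !det_mulmx !det_ublock !det_lblock !det1 !mul1r !mulr1 => -> -> //.
Qed.

(** When y is invertible this is the identity above for U / y.  The block matrix
    with y in its lower right corner proves it without dividing, which matters
    because it is used for a y that is not invertible. *)
Lemma det_scalar_addC (y : R) m n (U : 'M[R]_(n, m)) (W : 'M[R]_(m, n)) :
  y ^+ m * \det (y%:M + U *m W) = y ^+ n * \det (y%:M + W *m U).
Proof.
pose L := block_mx (1%:M : 'M[R]_n) (- U) W y%:M.
have E1 : block_mx (y%:M : 'M[R]_n) U (0 : 'M_(m, n)) (1%:M : 'M[R]_m) *m L
          = block_mx (y%:M + U *m W) 0 W y%:M.
  rewrite mulmx_block !mul1mx !mul0mx !add0r mulmx1 mulmxN.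
  by rewrite mul_scalar_mx mul_mx_scalar addNr.
have E2 : block_mx (1%:M : 'M[R]_n) 0 (- W) (1%:M : 'M[R]_m) *m L
          = block_mx 1%:M (- U) 0 (y%:M + W *m U).
  rewrite mulmx_block !mul1mx !mul0mx !addr0 mulmx1 mulmxN mulNmx opprK addNr.
  by rewrite addrC.
have := congr1 determinant E1; have := congr1 determinant E2.
rewrite !det_mulmx !det_ublock !det_lblock !det1 !det_scalar !mul1r !mulr1 => ->.
by rewrite mulrC => ->; rewrite mulrC.
Qed.

Record retract P := Retract {
  rt_n : nat;
  rt_i : {linear P -> 'rV[R]_rt_n};
  rt_r : {linear 'rV[R]_rt_n -> P};
  rt_K : cancel rt_i rt_r }.

Lemma fgp_retract_ex P : fg_projective P -> exists t : retract P, True.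
Proof.
move=> [[n [g gs]] pP]; have [h hE] := pP _ _ g idfun gs.
by exists (Retract (rt_i := h) (rt_r := g) hE).
Qed.

(** This is det (phi + id) on P + ker r = R^n, written without the complement. *)
Definition rdet P (t : retract P) (phi : P -> P) : R :=
  \det (1%:M + lin1_mx (fun v => rt_i t (phi (rt_r t v) - rt_r t v))).

Lemma eq_lin1_mx m n (f g : 'rV[R]_m -> 'rV[R]_n) : f =1 g -> lin1_mx f = lin1_mx g.
Proof. by move=> e; apply/matrixP => i j; rewrite !mxE e. Qed.

Lemma lin1_mx_comp m n p (f : {linear 'rV[R]_m -> 'rV[R]_n})
    (g : {linear 'rV[R]_n -> 'rV[R]_p}) :
  lin1_mx (g \o f) = lin1_mx f *m lin1_mx g.
Proof. by apply/row_matrixP => i; rewrite !rowE mulmxA !mul_rV_lin1. Qed.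

(** The two endomorphisms are 1 + X Y and 1 + Y X; taking P = Q with two
    different retractions shows that the determinant does not depend on the
    retraction. *)
Lemma rdet_sylv P Q (t : retract P) (u : retract Q) (X : {linear Q -> P})
    (Y : {linear P -> Q}) (phi : P -> P) (psi : Q -> Q) :
  (forall x, phi x = x + X (Y x)) -> (forall y, psi y = y + Y (X y)) ->
  rdet t phi = rdet u psi.
Proof.
move=> hphi hpsi; rewrite /rdet.
pose U := lin1_mx (rt_i u \o Y \o rt_r t).
pose W := lin1_mx (rt_i t \o X \o rt_r u).
have -> : lin1_mx (fun v => rt_i t (phi (rt_r t v) - rt_r t v)) = U *m W.
  rewrite -lin1_mx_comp; apply: eq_lin1_mx => v /=.
  by rewrite hphi addrC addKr rt_K.
have -> : lin1_mx (fun v => rt_i u (psi (rt_r u v) - rt_r u v)) = W *m U.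
  rewrite -lin1_mx_comp; apply: eq_lin1_mx => v /=.
  by rewrite hpsi addrC addKr rt_K.
exact: det_1addC.
Qed.

Definition mdet P (hP : fg_projective P) : (P -> P) -> R :=
  rdet (sval (cid (fgp_retract_ex hP))).

Lemma mdet_rdet P (hP : fg_projective P) (t : retract P) (phi : {linear P -> P}) :
  mdet hP phi = rdet t phi.
Proof.
apply: (@rdet_sylv _ _ _ _ idfun (phi \- idfun)) => x /=.
  by rewrite addrC subrK.
by rewrite addrC subrK.
Qed.

Lemma eq_mdet P (hP : fg_projective P) (phi psi : P -> P) :
  phi =1 psi -> mdet hP phi = mdet hP psi.
Proof. by move=> e; congr (\det (_ + _)); apply: eq_lin1_mx => v; rewrite e. Qed.

Lemma mdet_sylv P Q (hP : fg_projective P) (hQ : fg_projective Q)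
    (X : {linear Q -> P}) (Y : {linear P -> Q}) (phi : P -> P) (psi : Q -> Q) :
  (forall x, phi x = x + X (Y x)) -> (forall y, psi y = y + Y (X y)) ->
  mdet hP phi = mdet hQ psi.
Proof. exact: rdet_sylv. Qed.

Lemma mdet_id P (hP : fg_projective P) (phi : P -> P) : phi =1 id -> mdet hP phi = 1.
Proof.
move=> e; rewrite /mdet /rdet.
rewrite (_ : lin1_mx _ = 0) ?addr0 ?det1 //.
by apply/matrixP => i j; rewrite !mxE e subrr linear0 mxE.
Qed.

(** Covers elementary automorphisms, transvections and Eichler
    transformations at once: each is 1 + X Y with Y X = 0. *)
Lemma mdet_nil P Q (hP : fg_projective P) (hQ : fg_projective Q)
    (X : {linear Q -> P}) (Y : {linear P -> Q}) (phi : P -> P) :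
  (forall x, phi x = x + X (Y x)) -> (forall y, Y (X y) = 0) -> mdet hP phi = 1.
Proof.
move=> hphi YX; rewrite (@mdet_sylv _ _ hP hQ X Y _ id hphi); last first.
  by move=> y; rewrite YX addr0.
exact: mdet_id.
Qed.

Lemma mdetM P (hP : fg_projective P) (phi psi : {linear P -> P}) :
  mdet hP (fun x => phi (psi x)) = mdet hP phi * mdet hP psi.
Proof.
rewrite /mdet; set t := sval _; rewrite [RHS]mulrC -det_mulmx; congr (\det _).
pose F (f : {linear P -> P}) := idfun \+ (rt_i t \o (f \- idfun) \o rt_r t).
have E (f : {linear P -> P}) :
    1%:M + lin1_mx (fun v => rt_i t (f (rt_r t v) - rt_r t v)) = lin1_mx (F f).
  apply/row_matrixP => i; rewrite linearD /= !rowE mulmx1 !mul_rV_lin1 /F /=.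
  congr (_ + _); rewrite -[lin1_mx _]/(lin1_mx (rt_i t \o (f \- idfun) \o rt_r t)).
  by rewrite mul_rV_lin1.
rewrite (E phi) (E psi) (E (phi \o psi)) -lin1_mx_comp; apply: eq_lin1_mx => v.
have rF : rt_r t (F psi v) = psi (rt_r t v).
  by rewrite /F /= linearD /= rt_K addrC subrK.
rewrite [RHS]/(F phi (F psi v)) {1}/F /= rF /F /= -addrA -linearD /=.
by congr (_ + rt_i t _); rewrite [RHS]addrC addrA subrK.
Qed.

(** An endomorphism of a direct summand and its extension by the identity on a
    complement have the same determinant; conjugation is a special case. *)
Lemma mdet_ext P K (hP : fg_projective P) (hK : fg_projective K)
    (J : {linear P -> K}) (rho : {linear K -> P}) (phi : {linear P -> P}) (psi : K -> K) :
  cancel J rho -> (forall x, psi x = x + J (phi (rho x) - rho x)) ->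
  mdet hK psi = mdet hP phi.
Proof.
move=> JK h; rewrite (@mdet_sylv _ _ hK hP J ((phi \- idfun) \o rho) _ phi) //.
by move=> y /=; rewrite JK addrC subrK.
Qed.

Lemma mdet_conj P Q (hP : fg_projective P) (hQ : fg_projective Q)
    (h : {linear P -> Q}) (k : {linear Q -> P}) (phi : {linear P -> P}) (psi : Q -> Q) :
  cancel h k -> cancel k h -> (forall x, psi (h x) = h (phi x)) ->
  mdet hQ psi = mdet hP phi.
Proof.
move=> hK kK e; apply: (@mdet_ext _ _ hP hQ h k) => // x.
by rewrite linearB /= kK -e kK addrC subrK.
Qed.

Lemma mdet_inv P (hP : fg_projective P) (phi psi : {linear P -> P}) :
  cancel psi phi -> mdet hP phi * mdet hP psi = 1.
Proof. by move=> h; rewrite -mdetM mdet_id. Qed.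

Lemma mdet_free P (hP : fg_projective P) n (k : {linear 'rV[R]_n -> P})
    (k' : {linear P -> 'rV[R]_n}) (phi : {linear P -> P}) :
  cancel k k' -> cancel k' k -> mdet hP phi = \det (lin1_mx (k' \o phi \o k)).
Proof.
move=> kK k'K; rewrite (mdet_rdet hP (Retract k'K)) /rdet; congr (\det _).
apply/row_matrixP => i; rewrite linearD /= !rowE mulmx1 mul_rV_lin1 /=.
rewrite (_ : lin1_mx _ = lin1_mx (k' \o (phi \- idfun) \o k)) //.
by rewrite mul_rV_lin1 /= linearB /= kK addrC subrK.
Qed.

Lemma has_det_mdet P (hP : fg_projective P) (phi : {linear P -> P}) (d : R) :
  has_det phi d <-> mdet hP phi = d.
Proof.
split.
  move=> [n [Q [f [A [bf hA <-]]]]].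
  have [g [fK gK]] := bij_linear_inv bf.
  pose il : {linear P -> (P * Q)%type} := lpair idfun \0.
  have iK : cancel (f \o il) (fst \o g) by move=> x; rewrite /= fK.
  rewrite (mdet_rdet hP (Retract iK)) /rdet /=; congr (\det _).
  apply/row_matrixP => i; rewrite linearD /= !rowE mulmx1.
  set v := delta_mx 0 i.
  rewrite (_ : lin1_mx _ = lin1_mx (f \o il \o (phi \- idfun) \o (fst \o g))) //.
  rewrite mul_rV_lin1 /=.
  rewrite -[in RHS](gK v); case E : (g v) => [x y]; rewrite -hA.
  rewrite -[in LHS](gK v) E -linearD /=; congr (f _).
  by congr pair; rewrite /= ?addr0 // addrC subrK.
move=> <-; rewrite /mdet; move: (sval _) => t.
pose F := idfun \+ (rt_i t \o (phi \- idfun) \o rt_r t).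
pose f : {linear (P * lker (rt_r t))%type -> 'rV[R]_(rt_n t)} :=
  (rt_i t \o fst) \+ ((val : {linear lker (rt_r t) -> _}) \o snd).
exists (rt_n t), (lker (rt_r t)), f, (1%:M + lin1_mx (rt_i t \o (phi \- idfun) \o rt_r t)).
have kin v : v - rt_i t (rt_r t v) \in lker_pred (rt_r t).
  by apply: lkerP; rewrite linearB /= rt_K subrr.
have rf x (k : lker (rt_r t)) : rt_r t (rt_i t x + val k) = x.
  by rewrite linearD /= rt_K lkerE addr0.
split => //.
  exists (fun v => (rt_r t v, Lker (kin v))).
    move=> [x k]; rewrite /f /=.
    congr pair; first exact: rf.
    by apply: val_inj => /=; rewrite rf addrC addKr.
  by move=> v; rewrite /f /= addrC subrK.
move=> x k; rewrite mulmxDr mulmx1 mul_rV_lin1 /f /= rf.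
by rewrite linearB /= addrAC [rt_i t (phi x) - _]addrC addNKr.
Qed.

Lemma in_SLP P (hP : fg_projective P) (phi : {linear P -> P}) :
  in_SL phi <-> bijective phi /\ mdet hP phi = 1.
Proof. by split=> -[b h]; split=> //; apply/(has_det_mdet hP). Qed.

(** After inverting nu, the maps w and f / nu identify P with a free module, in
    which det phi is the determinant of f phi w / nu.  Clearing denominators
    leaves a power of nu that depends on the retraction only. *)
Lemma mdet_frame P (hP : fg_projective P) : exists n, forall k (nu : R)
    (w : {linear 'rV[R]_k -> P}) (f : {linear P -> 'rV[R]_k}) (phi : {linear P -> P}),
  (forall x, w (f x) = nu *: x) -> (forall v, f (w v) = nu *: v) ->
  nu ^+ (k + n) * mdet hP phi = nu ^+ n * \det (lin1_mx (f \o phi \o w)).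
Proof.
rewrite /mdet; move: (sval _) => t.
exists (rt_n t) => k nu w f phi wf fw.
pose U := lin1_mx (f \o (phi \- idfun) \o rt_r t).
pose W := lin1_mx (rt_i t \o w).
have := det_scalar_addC nu U W.
have -> : nu%:M + U *m W = nu *: (1%:M + lin1_mx (fun v => rt_i t (phi (rt_r t v) - rt_r t v))).
  rewrite scalerDr scale_scalar_mx mulr1; congr (_ + _).
  rewrite -lin1_mx_comp; apply/row_matrixP => i; rewrite linearZ /= !rowE !mul_rV_lin1 /=.
  rewrite wf (_ : lin1_mx _ = lin1_mx (rt_i t \o (phi \- idfun) \o rt_r t)) //.
  by rewrite mul_rV_lin1 /= linearZ.
have -> : nu%:M + W *m U = lin1_mx (f \o phi \o w).
  rewrite -lin1_mx_comp; apply/row_matrixP => i; rewrite linearD /= !rowE !mul_rV_lin1 /=.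
  rewrite mul_mx_scalar rt_K linearB /= fw addrC subrK.
  by [].
by rewrite detZ mulrA -exprD.
Qed.
End Det.

(** * Kronecker's theorem and the stable range *)
Section Kronecker.
Context (R : comPzRingType).
Implicit Types (I J p : R -> Prop).

(** Krull: an ideal maximal among those containing I and disjoint from a
    multiplicative set S is prime. *)
Lemma prime_avoiding I (S : R -> Prop) : is_ideal I -> S 1 ->
    (forall x y, S x -> S y -> S (x * y)) -> (forall x, I x -> ~ S x) ->
  exists p, [/\ is_prime p, forall x, I x -> p x & forall x, p x -> ~ S x].
Proof.
move=> [I0 ID IM] S1 SM IS.
pose U (A : set R) : R -> Prop := fun x => I x \/ A x.
(* Using I \/ A instead of A lets the empty chain have the empty union as bound. *)
pose good (A : set R) := is_ideal (U A) /\ forall x, A x -> ~ S x.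
have [|A [[idA AS] maxA]] := @Zorn_bigcup R good.
  move=> F FP totF; split; last by move=> x [A FA Ax]; exact: (FP _ FA).2.
  have UF A x : F A -> U A x -> U (\bigcup_(X in F) X)%classic x.
    by move=> FA [|Ax]; [left | right; exists A].
  split; first by left.
  - move=> x y [Ix|[A FA Ax]] [Iy|[B FB By]].
    + by left; exact: ID.
    + by apply: (UF B) => //; have [[_ h _] _] := FP _ FB; apply: h; [left | right].
    + by apply: (UF A) => //; have [[_ h _] _] := FP _ FA; apply: h; [right | left].
    + have [sAB|sBA] := totF _ _ FA FB.
        by apply: (UF B) => //; have [[_ h _] _] := FP _ FB; apply: h; right => //; exact: sAB.
      by apply: (UF A) => //; have [[_ h _] _] := FP _ FA; apply: h; right => //; exact: sBA.
  - move=> r x [Ix|[A FA Ax]]; first by left; exact: IM.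
    by apply: (UF A) => //; have [[_ _ h] _] := FP _ FA; apply: h; right.
have [_ pD pM] := idA.
have pS x : U A x -> ~ S x by case; [exact: IS | exact: AS].
have meetS z : ~ U A z -> exists q r, U A q /\ S (q + r * z).
  move=> nz; apply: contrapT => no.
  pose J (w : R) := exists q r, U A q /\ w = q + r * z.
  have AJ w : U A w -> J w by move=> Aw; exists w, 0; rewrite mul0r addr0.
  apply: (maxA J).
    split; first by move=> w Aw; apply: AJ; right.
    move=> JA; apply: nz; right; apply: JA; exists 0, 1.
    by rewrite mul1r add0r; split=> //; left.
  have EJ w : U J w -> J w by case=> // Iw; apply: AJ; left.
  split; last by move=> _ [q [r [Aq ->]]] Sw; apply: no; exists q, r.
  split; first by left.
  - move=> _ _ /EJ [q [r [Aq ->]]] /EJ [q' [r' [Aq' ->]]]; right.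
    by exists (q + q'), (r + r'); split; [exact: pD | rewrite mulrDl addrACA].
  - move=> s _ /EJ [q [r [Aq ->]]]; right.
    by exists (s * q), (s * r); split; [exact: pM | rewrite mulrDr mulrA].
exists (U A); split=> //; last by move=> x; left.
split=> //; first by move=> /pS.
move=> x y Axy; apply: contrapT => /not_orP [nx ny].
have [q [r [Aq Sq]]] := meetS _ nx; have [q' [r' [Aq' Sq']]] := meetS _ ny.
apply: (pS _ _ (SM _ _ Sq Sq')).
have -> : (q + r * x) * (q' + r' * y) = (q' + r' * y) * q + ((r * x) * q' + (r * r') * (x * y)).
  by ring.
by apply: (pD); [exact: pM | apply: (pD); exact: pM].
Qed.

Definition chain_above (k : nat) I := exists p : nat -> R -> Prop,
  [/\ forall i, (i <= k)%N -> is_prime (p i),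
      forall i, (i < k)%N -> (forall x, p i x -> p i.+1 x) /\ exists x, p i.+1 x /\ ~ p i x &
      forall x, I x -> p 0 x].

Lemma primeX p x n : is_prime p -> p (x ^+ n) -> p x.
Proof.
move=> hp; elim: n => [|n IH]; first by rewrite expr0 => /(prime_proper hp).
by rewrite exprS => /(prime_mul hp) [|/IH].
Qed.

(** The ideal is I + R a + (sqrt I : a), the boundary of a.  A prime p above it
    strictly contains a prime above I that avoids a: the set of the s a^n with
    s outside p does not meet I, since s a^n in I puts s a in every prime
    above I, hence s in (sqrt I : a), which lies in p.  So passing to the
    boundary lowers the dimension. *)
Lemma chain_above_extend k I a : is_ideal I ->
  chain_above k (fun z => exists i r y, [/\ I i, z = i + r * a + y &
    forall q, is_prime q -> (forall x, I x -> q x) -> q (y * a)]) ->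
  chain_above k.+1 I.
Proof.
move=> idI [p [pp ps pJ]].
have hp0 := pp 0%N isT; have [[_ _ p0M] _ _] := hp0.
have [||||q [hq Iq qS]] := @prime_avoiding I (fun z => exists s n, ~ p 0%N s /\ z = s * a ^+ n).
- exact: idI.
- by exists 1, 0%N; rewrite mul1r expr0; split=> //; exact: prime_proper hp0.
- move=> _ _ [s [n [ps' ->]]] [s' [n' [ps'' ->]]]; exists (s * s'), (n + n')%N.
  by split; [move=> /(prime_mul hp0) [] | rewrite mulrACA exprD].
- move=> z Iz [s [n [nps E]]]; rewrite {z}E in Iz; apply: nps; apply: pJ.
  exists 0, 0, s; split; [exact: ideal0 | by rewrite mul0r !add0r | move=> q hq Iq].
  have [[_ _ qM] _ _] := hq.
  have [qs|/(primeX hq) qa] := prime_mul hq (Iq _ Iz); last exact: qM.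
  by rewrite mulrC; exact: qM.
have qa : ~ q a by move=> /qS; apply; exists 1, 1%N; rewrite mul1r expr1; split=> //; exact: prime_proper hp0.
have q0 x : q x -> p 0%N x.
  move=> qx; apply: contrapT => nx; apply: (qS _ qx).
  by exists x, 0%N; rewrite expr0 mulr1.
exists (fun i => if i is j.+1 then p j else q); split=> //.
  by move=> [|i] //; exact: pp.
move=> [|i]; last exact: ps.
move=> _; split=> //; exists a; split=> //; apply: pJ.
exists 0, 1, 0; split; [exact: ideal0 | by rewrite mul1r add0r addr0 |].
by move=> q' hq' _; rewrite mul0r; exact: ideal0 (prime_ideal hq').
Qed.

(** Heitmann's proof of Kronecker's theorem.  By induction modulo the boundary
    of the last element a' one finds b^n = i + r a' + y + (a combination of the
    a_i + b t_i) with y a' in sqrt I.  Then a' + b y is the right replacement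
    of a': a prime above I that contains it contains y a', hence either b or both
    a' and y, and in the second case b^n. *)
Lemma kronecker_mod k I (b : R) (a : nat -> R) : is_ideal I -> ~ chain_above k I ->
  exists t : nat -> R, forall p, is_prime p -> (forall x, I x -> p x) ->
    (forall i, (i < k)%N -> p (a i + b * t i)) -> p b.
Proof.
elim: k I => [|k IH] I idI noch.
  exists (fun=> 0) => p hp Ip _; exfalso; apply: noch.
  by exists (fun=> p); split=> // -[].
have [I0 ID IM] := idI.
pose a' := a k.
pose J (z : R) := exists i r y, [/\ I i, z = i + r * a' + y &
    forall q, is_prime q -> (forall x, I x -> q x) -> q (y * a')].
have idJ : is_ideal J.
  split.
  - exists 0, 0, 0; split=> //; first by rewrite mul0r !addr0.
    by move=> q hq _; rewrite mul0r; exact: ideal0 (prime_ideal hq).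
  - move=> _ _ [i [r [y [Ii -> hy]]]] [i2 [r2 [y2 [Ii2 -> hy2]]]].
    exists (i + i2), (r + r2), (y + y2); split; [exact: ID | by ring |].
    move=> q hq Iq; rewrite mulrDl; apply: (idealD (prime_ideal hq)); [exact: hy|exact: hy2].
  - move=> s _ [i [r [y [Ii -> hy]]]]; exists (s * i), (s * r), (s * y).
    split; [exact: IM | by ring |].
    by move=> q hq Iq; rewrite -mulrA; apply: (idealM (prime_ideal hq)); exact: hy.
have [t ht] := IH J idJ (fun c => noch (chain_above_extend idI c)).
pose L (z : R) := exists j (c : nat -> R), J j /\ z = j + \sum_(i < k) c i * (a i + b * t i).
have idL : is_ideal L.
  split.
  - exists 0, (fun=> 0); split; first exact: ideal0.
    by rewrite big1 ?addr0 // => i _; rewrite mul0r.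
  - move=> _ _ [j [c [Jj ->]]] [j2 [c2 [Jj2 ->]]]; exists (j + j2), (fun i => c i + c2 i).
    split; first exact: (idealD idJ).
    rewrite addrACA -big_split /=; congr (_ + _).
    by apply: eq_bigr => i _; rewrite mulrDl.
  - move=> s _ [j [c [Jj ->]]]; exists (s * j), (fun i => s * c i).
    split; first exact: (idealM idJ).
    by rewrite mulrDr mulr_sumr; congr (_ + _); apply: eq_bigr => i _; rewrite mulrA.
have [n [j [c [[i0 [r [y [Ii0 Ej hy]]]] Eb]]]] : exists n, L (b ^+ n).
  apply: contrapT => no.
  have [||||p [hp Lp pS]] := @prime_avoiding L (fun z => exists n, z = b ^+ n).
  - exact: idL.
  - by exists 0%N.
  - by move=> _ _ [n ->] [m ->]; exists (n + m)%N; rewrite exprD.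
  - by move=> x Lx [n E]; apply: no; exists n; rewrite -E.
  have Jp x : J x -> p x.
    move=> Jx; apply: Lp; exists x, (fun=> 0); split=> //.
    by rewrite big1 ?addr0 // => i _; rewrite mul0r.
  apply: (pS b); last by exists 1%N.
  apply: ht => // i ik; apply: Lp; exists 0, (fun l => (l == i)%:R).
  split; first exact: ideal0.
  rewrite (bigD1 (Ordinal ik)) //= eqxx mul1r big1 ?addr0 ?add0r // => l.
  by rewrite -val_eqE /= => /negPf ->; rewrite mul0r.
exists (fun i => if (i < k)%N then t i else y) => p hp Ip hpi.
have [[p0 pD pM] _ _] := hp.
have pt i : (i < k)%N -> p (a i + b * t i).
  by move=> ik; have := hpi i (ltnW ik); rewrite ik.
have pa : p (a' + b * y) by have := hpi k (leqnn _); rewrite ltnn.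
have sub x z : p (x + z) -> p z -> p x.
  move=> h1 h2; have -> : x = (x + z) + (-1) * z by ring.
  by apply: (pD) => //; exact: pM.
have fin : p a' -> p y -> p b.
  move=> pa' py; apply: (primeX (n := n) hp); rewrite Eb Ej.
  apply: (pD).
    by apply: (pD) => //; apply: (pD); [exact: Ip | exact: pM].
  elim/big_ind: _ => // i _; apply: pM; exact: pt.
have [py|pa'] := prime_mul hp (hy p hp Ip).
  by apply: fin => //; apply: sub pa _; exact: pM.
have := sub _ _ _ pa'; rewrite addrC in pa.
move=> h; have [//|py] := prime_mul hp (sub _ _ pa pa'); exact: fin.
Qed.

Lemma kronecker k (b : R) (a : nat -> R) : Krull_dim_le R k ->
  exists t : nat -> R, forall p, is_prime p ->
    (forall i, (i <= k)%N -> p (a i + b * t i)) -> p b.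
Proof.
move=> dimR; have id0 : is_ideal (fun x : R => x = 0).
  by split=> // [x y -> ->|r x ->]; rewrite ?addr0 ?mulr0.
have [|t ht] := @kronecker_mod k.+1 _ b a id0.
  by move=> [p [pp ps _]]; apply: dimR; exists p; split.
by exists t => p hp; apply: ht => // x ->; exact: ideal0 (prime_ideal hp).
Qed.
End Kronecker.

Section StableRange.
Context (R : comPzRingType).
Implicit Types M L : lmodType R.

Definition unimodular M (v : M) := exists g : {linear M -> R^o}, g v = 1.
Definition vanishes_at M (p : R -> Prop) (v : M) := forall g : {linear M -> R^o}, p (g v).

(** The values of the linear forms at v make up an ideal. *)
Lemma unimodularP M (v : M) : (forall p, is_prime p -> ~ vanishes_at p v) -> unimodular v.
Proof.
move=> h; apply: contrapT => nu.
pose I (r : R) := exists g : {linear M -> R^o}, g v = r.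
have idI : is_ideal I.
  split; first by exists \0.
    by move=> _ _ [g <-] [k <-]; exists (g \+ k).
  by move=> r _ [g <-]; exists (r \*: g).
have [p hp Ip] := Defs.prime_above idI nu.
by apply: (h p hp) => g; apply: Ip; exists g.
Qed.

Definition framed (k : nat) (nu : R) M := exists (f : {linear M -> 'rV[R]_k})
  (w : {linear 'rV[R]_k -> M}), forall v, f (w v) = nu *: v.

Lemma framed_prodl k nu M L : framed k nu M -> framed k nu (M * L)%type.
Proof. by move=> [f [w fw]]; exists (f \o fst), (lpair w \0) => v /=. Qed.

Lemma framed_prodR k nu M : framed k nu M -> framed k.+1 nu (M * R^o)%type.
Proof.
rewrite -addn1.
move=> [f [w fw]].
have lc : linear (fun r : R^o => (r : R) *: (1%:M : 'rV[R]_1)).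
  by move=> c u v; rewrite scalerDl scalerA.
pose f' (x : M * R^o) : 'rV[R]_(k + 1) := row_mx (f x.1) ((x.2 : R) *: 1%:M).
have lf : linear f'.
  move=> c u v; rewrite /f' /= linearP lc.
  by rewrite scale_row_mx add_row_mx.
pose w' (v : 'rV[R]_(k + 1)) : M * R^o := (w (lsubmx v), nu * (rsubmx v) 0 0).
have lw : linear w'.
  move=> c u v; rewrite /w' linearP /= linearP; congr pair.
  by rewrite !mxE mulrDr mulrCA.
exists (Linear_of lf), (Linear_of lw) => v; rewrite /= /f' /w' /= fw.
rewrite -[in RHS](hsubmxK v) scale_row_mx; congr row_mx.
by apply/rowP => i; rewrite !ord1 !mxE /= mulr1.
Qed.

(** Kronecker's theorem applied to the coordinates of m with respect to the
    frame.  The factor nu in nu w(t) makes m and m + b m' agree at the primes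
    containing nu, which would otherwise not be controlled. *)
Lemma framed_general_position k nu M (m : M) (b : R) : Krull_dim_le R k -> framed k.+1 nu M ->
  exists m', forall p, is_prime p -> vanishes_at p (m + b *: m') ->
    vanishes_at p m /\ p (b * nu).
Proof.
move=> dimR [f [w fw]].
have [t ht] := @kronecker _ k (b * nu ^+ 2) (fun i => f m 0 (inord i)) dimR.
pose tv := \row_(i < k.+1) t i.
exists (nu *: w tv) => p hp van.
have [[p0 pD pM] _ _] := hp.
have pb2 : p (b * nu ^+ 2).
  apply: ht => // i ik.
  have lc : linear (fun x : M => f x 0 (inord i) : R^o).
    by move=> c u v; rewrite linearP !mxE.
  have := van (Linear_of lc) => /=.
  rewrite linearD !linearZ /= fw !mxE inordK // => h.
  suff -> : b * nu ^+ 2 * t i = b * (nu * (nu * t i)) by [].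
  by ring.
have pbnu : p (b * nu).
  have [pb|/(primeX hp) pnu] := prime_mul hp pb2; last exact: pM.
  by rewrite mulrC; exact: pM.
split=> // g; have := van g; rewrite linearD !linearZ /= => h.
have -> : (g m : R) = (g m + b * (nu * g (w tv))) + (- g (w tv)) * (b * nu) by ring.
by apply: (pD) => //; exact: pM.
Qed.

(** The elements nu = theta0^-1 (x ^ y) generate the unit ideal because Ext2 P0
    is generated by wedges; induction on an element q of Ext2 P0 moves m into
    general position with respect to theta0^-1 q, and q = theta0 1 finishes. *)
Lemma stable_range k M P0 (theta0 : liso R^o (Ext2 P0)) (m : M) (b : R) : Krull_dim_le R k ->
  (forall x y : P0, framed k.+1 (liso_inv theta0 (wedge2 x y)) M) ->
  unimodular ((m, b) : M * R^o) -> exists m', unimodular (m + b *: m').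
Proof.
move=> dimR fr [g gmb].
have key (q : Ext2 P0) : forall m : M, exists m', forall p, is_prime p ->
    vanishes_at p (m + b *: m') -> vanishes_at p m /\ p (b * liso_inv theta0 q).
  have sth := liso_inv_scalar theta0.
  have [th0 thD thZ] := scalar_facts sth.
  elim/pmod_genP: q => [|q1 q2 h1 h2|r q h|[x y]] m1.
  - by exists 0 => p hp; rewrite scaler0 addr0 th0 mulr0; split=> //; exact: ideal0 (prime_ideal hp).
  - have [m2 hm2] := h1 m1; have [m3 hm3] := h2 (m1 + b *: m2).
    exists (m2 + m3) => p hp; rewrite scalerDr addrA => /(hm3 p hp) [/(hm2 p hp) [v1 p1] p2].
    by split=> //; rewrite thD mulrDr; apply: (idealD (prime_ideal hp)).
  - have [m2 hm2] := h m1; exists m2 => p hp /(hm2 p hp) [v1 p1]; split=> //.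
    by rewrite thZ mulrCA; exact: (idealM (prime_ideal hp)).
  - exact: (framed_general_position m1 b dimR (fr x y)).
have [m' hm'] := key (theta0 1) m; exists m'; apply: unimodularP => p hp /(hm' p hp) [van].
rewrite lisoK mulr1 => pb.
apply: (prime_proper hp); rewrite -[1]gmb.
pose il : {linear M -> (M * R^o)%type} := lpair idfun \0.
have -> : ((m, b) : M * R^o) = il m + b *: ((0, 1) : M * R^o).
  by congr pair; rewrite /= ?scaler0 ?addr0 // add0r /GRing.scale /= mulr1.
rewrite linearD linearZ; apply: (idealD (prime_ideal hp)); first exact: (van (g \o il)).
by have := idealM (prime_ideal hp) (g (0, 1)) pb; rewrite mulrC.
Qed.
End StableRange.

(** * Pfaffians of sequences of vectors *)
Section Contract.
Context (R : comPzRingType) (T : Type).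
Implicit Types (l : T -> R) (F G : seq T -> R) (s : seq T).

(** Contraction of F with a linear form: the alternating sum of the
    l(s_j) F(s minus s_j).  The recursion on s avoids all index shifts. *)
Fixpoint ctr l F s : R :=
  if s is y :: s' then l y * F s' - ctr l (fun t => F (y :: t)) s' else 0.

Lemma eq_ctr l F G s : F =1 G -> ctr l F s = ctr l G s.
Proof. by elim: s F G => [|y s IH] F G e //=; rewrite e (IH _ (fun t => G (y :: t))). Qed.

Lemma ctr0 l s : ctr l (fun=> 0) s = 0.
Proof. by elim: s => [|y s IH] //=; rewrite IH mulr0 subr0. Qed.

Lemma ctr_linF l c F G s :
  ctr l (fun t => c * F t + G t) s = c * ctr l F s + ctr l G s.
Proof.
elim: s F G => [|y s IH] F G /=; first by rewrite mulr0 addr0.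
by rewrite IH; ring.
Qed.

Lemma ctr_linl l l1 l2 c F s : (forall y, l y = c * l1 y + l2 y) ->
  ctr l F s = c * ctr l1 F s + ctr l2 F s.
Proof.
move=> h; elim: s F => [|y s IH] F /=; first by rewrite mulr0 addr0.
by rewrite IH h; ring.
Qed.

(** Contracting twice with the same form gives 0, as in an exterior algebra;
    this is what makes the Pfaffian vanish when its first two vectors agree. *)
Lemma ctr_sq l F s : ctr l (ctr l F) s = 0.
Proof.
elim: s F => [|y s IH] F //=.
have /= -> := ctr_linF l (l y) F (fun t => - ctr l (fun u => F (y :: u)) t) s.
rewrite opprD addrA subrr add0r.
have E t : - ctr l (fun u => F (y :: u)) t = -1 * ctr l (fun u => F (y :: u)) t + 0.
  by rewrite addr0 mulN1r.
by rewrite (eq_ctr _ _ E) ctr_linF ctr0 IH mulr0 addr0 oppr0.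
Qed.

Lemma ctr_cat l F s t : (forall u, ctr l (fun v => F (u ++ v)) t = 0) ->
  ctr l F (s ++ t) = ctr l (fun u => F (u ++ t)) s.
Proof.
elim: s F => [|y s IH] F h /=; first exact: (h [::]).
by rewrite IH // => u; exact: (h (y :: u)).
Qed.

(** The Pfaffian of the Gram matrix of 2n vectors, by expansion along the first
    one.  It is 0 on sequences of any other length, so that it is multilinear
    and alternating on all sequences. *)
Fixpoint pfp (w : T -> T -> R) (n : nat) s : R :=
  match n, s with
  | 0, [::] => 1
  | n'.+1, x :: s' => ctr (w x) (pfp w n') s'
  | _, _ => 0
  end.

Lemma ctr_enum l F m (f : 'I_m.+1 -> T) :
  ctr l F [seq f i | i <- enum 'I_m.+1]
  = \sum_(j < m.+1) (-1) ^+ j * l (f j) * F [seq f (lift j i) | i <- enum 'I_m].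
Proof.
elim: m F f => [|m IH] F f.
  rewrite big_ord_recl big_ord0 enum_ordSl (size0nil (size_enum_ord 0)) /=.
  by rewrite expr0 mul1r addr0 subr0.
rewrite enum_ordSl map_cons -map_comp big_ord_recl /= expr0 mul1r.
congr (_ + _).
rewrite (IH _ (f \o lift ord0)) -sumrN; apply: eq_bigr => j _ /=.
rewrite [bump 0 j]/bump leq0n exprS mulN1r !mulNr; congr (- (_ * F _)).
rewrite [in RHS]enum_ordSl /= -map_comp; congr (f _ :: _); first exact: val_inj.
apply: eq_map => i /=; congr (f _); apply: val_inj => /=.
by rewrite /bump !leq0n !add1n ltnS addnS.
Qed.

Lemma Pf_pfp n (w : T -> T -> R) (f : 'I_(n.*2) -> T) :
  Pf (\matrix_(i, j) w (f i) (f j)) = pfp w n [seq f i | i <- enum 'I_(n.*2)].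
Proof.
elim: n f => [|n IH] f; first by rewrite (size0nil (size_enum_ord 0)).
rewrite [LHS]/= [in RHS]enum_ordSl /= -map_comp.
rewrite (ctr_enum _ _ (f \o lift ord0)); apply: eq_bigr => j _ /=.
rewrite mxE -IH; congr (_ * Pf _).
by apply/matrixP => a b; rewrite !mxE.
Qed.
End Contract.

Lemma ctr_map (R : comPzRingType) (T T' : Type) (h : T -> T') (l : T' -> R) F s :
  ctr l F (map h s) = ctr (l \o h) (F \o map h) s.
Proof. by elim: s F => [|y s IH] F //=; rewrite IH. Qed.

Lemma pfp_map (R : comPzRingType) (T T' : Type) (h : T -> T') (w : T' -> T' -> R) n s :
  pfp w n (map h s) = pfp (fun x y => w (h x) (h y)) n s.
Proof.
elim: n s => [|n IH] [|x s] //=; rewrite ctr_map.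
by apply: eq_ctr => t /=; exact: IH.
Qed.

Lemma eq_ctrl (R : comPzRingType) (T : Type) (l l' : T -> R) F s :
  l =1 l' -> ctr l F s = ctr l' F s.
Proof. by move=> e; elim: s F => [|y s IH] F //=; rewrite e IH. Qed.

Lemma eq_pfp (R : comPzRingType) (T : Type) (w w' : T -> T -> R) n s :
  (forall x y, w x y = w' x y) -> pfp w n s = pfp w' n s.
Proof.
move=> e; elim: n s => [|n IH] [|x s] //=.
by rewrite (eq_ctrl _ _ (e x)); exact: eq_ctr.
Qed.

Section Orthogonal.
Context (R : comPzRingType) (T : eqType).

Lemma eq_in_ctr (l : T -> R) F G s :
  (forall u, (size u).+1 = size s -> {subset u <= s} -> F u = G u) -> ctr l F s = ctr l G s.
Proof.
elim: s F G => [|y s IH] F G h //=.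
rewrite h //; last by move=> x xs; rewrite inE xs orbT.
congr (_ - _); apply: IH => u su sub; apply: h => /=; first by rewrite su.
by move=> x; rewrite !inE => /orP [->//|/sub ->]; rewrite orbT.
Qed.

Lemma ctr_orth (l : T -> R) F s : (forall y, y \in s -> l y = 0) -> ctr l F s = 0.
Proof.
elim: s F => [|y s IH] F h //=; rewrite h ?mem_head // mul0r sub0r IH ?oppr0 //.
by move=> z zs; apply: h; rewrite inE zs orbT.
Qed.

(** Contraction with a vector of s only sees s, because s and t are
    orthogonal. *)
Lemma pfp_cat (w : T -> T -> R) n m s t : size s = n.*2 ->
  (forall x y, x \in s -> y \in t -> w x y = 0) ->
  pfp w (n + m) (s ++ t) = pfp w n s * pfp w m t.
Proof.
elim: n s => [|n IH] [|x s] //=; first by rewrite mul1r.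
case=> ss h; rewrite ctr_cat; last first.
  by move=> u; apply: ctr_orth => y yt; apply: h => //; rewrite mem_head.
rewrite (@eq_in_ctr _ _ (fun u => pfp w m t * pfp w n u + 0)) => [|u su sub].
  by rewrite ctr_linF ctr0 addr0 mulrC.
rewrite addr0 mulrC; apply: IH; first by apply: succn_inj; rewrite su ss.
by move=> a b /sub au; apply: h; rewrite inE au orbT.
Qed.
End Orthogonal.

Section Alternating.
Context (R : comPzRingType).

Record altf (K : lmodType R) (w : K -> K -> R) : Prop := Altf {
  altf_l : forall y, scalar (w^~ y);
  altf_r : forall x, scalar (w x);
  altf_xx : forall x, w x x = 0 }.

Lemma altf_altiso (K : lmodType R) (w : altiso K) : altf w.
Proof. by split; [exact: aform_linl | exact: aform_linr | exact: aform_alt]. Qed.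

Lemma altfC (K : lmodType R) (w : K -> K -> R) x y : altf w -> w x y = - w y x.
Proof.
move=> hw; have [_ Dl _] := scalar_facts (altf_l hw (x + y)).
have [_ Drx _] := scalar_facts (altf_r hw x).
have [_ Dry _] := scalar_facts (altf_r hw y).
have := altf_xx hw (x + y); rewrite Dl Drx Dry !(altf_xx hw) addr0 add0r.
by move=> /eqP; rewrite addr_eq0 => /eqP.
Qed.

Context (K : lmodType R).
Implicit Types (F : seq K -> R).

Definition multilin F := forall s1 s2 c x y,
  F (s1 ++ (c *: x + y) :: s2) = c * F (s1 ++ x :: s2) + F (s1 ++ y :: s2).
Definition alternating F := forall s1 s2 x, F (s1 ++ x :: x :: s2) = 0.

Lemma ctr_multilin (l : K -> R) F : scalar l -> multilin F -> multilin (ctr l F).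
Proof.
move=> sl hF s1; elim: s1 F hF => [|z s1 IH] F hF s2 c x y /=.
  rewrite sl (@eq_ctr _ _ _ _ (fun t => c * F (x :: t) + F (y :: t))) => [|t].
    by rewrite ctr_linF; ring.
  exact: (hF [::]).
rewrite hF (IH (fun t => F (z :: t))); first by ring.
by move=> t1 t2 d u v; exact: (hF (z :: t1)).
Qed.

Lemma ctr_alternating (l : K -> R) F : alternating F -> alternating (ctr l F).
Proof.
move=> hF s1; elim: s1 F hF => [|z s1 IH] F hF s2 x /=.
  rewrite (@eq_ctr _ _ _ _ (fun=> 0)) ?ctr0 ?subr0 ?subrr //.
  by move=> t; exact: (hF [::]).
rewrite hF (IH (fun t => F (z :: t))) ?subr0 ?mulr0 //.
by move=> t1 t2 u; exact: (hF (z :: t1)).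
Qed.

Lemma pfp_multilin (w : K -> K -> R) n : altf w -> multilin (pfp w n).
Proof.
move=> hw; elim: n => [|n IH] [|z s1] s2 c x y /=; rewrite ?mulr0 ?addr0 //.
  by apply: ctr_linl => z; exact: altf_l.
by apply: ctr_multilin => //; exact: altf_r.
Qed.

Lemma pfp_alternating (w : K -> K -> R) n : altf w -> alternating (pfp w n).
Proof.
move=> hw; elim: n => [|n IH] [|z s1] s2 x //=; last exact: ctr_alternating.
case: n IH => [|n] _ /=; rewrite altf_xx // mul0r sub0r.
  by rewrite ctr0 oppr0.
by rewrite ctr_sq oppr0.
Qed.

Context (F : seq K -> R) (mF : multilin F) (aF : alternating F).

Lemma alternating_swap s1 s2 x y : F (s1 ++ x :: y :: s2) = - F (s1 ++ y :: x :: s2).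
Proof.
have D t1 t2 u v : F (t1 ++ (u + v) :: t2) = F (t1 ++ u :: t2) + F (t1 ++ v :: t2).
  by have := mF t1 t2 1 u v; rewrite scale1r mul1r.
have := aF s1 s2 (x + y); have Dx := D (rcons s1 x) s2 x y; have Dy := D (rcons s1 y) s2 x y.
rewrite !cat_rcons in Dx Dy; rewrite D Dx Dy !aF add0r addr0.
by move=> /eqP; rewrite addr_eq0 => /eqP.
Qed.

Lemma alternating_rep s1 s2 s3 x : F (s1 ++ x :: s2 ++ x :: s3) = 0.
Proof.
elim: s2 s1 => [|y s2 IH] s1 /=; first exact: aF.
by rewrite alternating_swap -cat_rcons IH oppr0.
Qed.
End Alternating.

(** * Uniqueness of the determinant *)
Section DetUnique.
Context (R : comPzRingType) (N : nat).
Implicit Types (A B C : 'M[R]_N).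

Lemma row_row_perm (s : 'S_N) A i : row i (row_perm s A) = row (s i) A.
Proof. by apply/rowP => j; rewrite !mxE. Qed.

Definition setrow A (k : 'I_N) (v : 'rV[R]_N) : 'M[R]_N :=
  \matrix_(i, j) (if i == k then v 0 j else A i j).

Lemma row_setrow A k v i : row i (setrow A k v) = if i == k then v else row i A.
Proof. by apply/rowP => j; rewrite !mxE; case: eqP; rewrite ?mxE. Qed.

Lemma setrow_id A k : setrow A k (row k A) = A.
Proof. by apply/row_matrixP => i; rewrite row_setrow; case: eqP => // ->. Qed.

Context (D : 'M[R]_N -> R)
  (linD : forall A k c u v,
     D (setrow A k (c *: u + v)) = c * D (setrow A k u) + D (setrow A k v))
  (altD : forall A i j, i != j -> row i A = row j A -> D A = 0).

Lemma rowwise_swap A i j : i != j -> D (xrow i j A) = - D A.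
Proof.
move=> ij; pose M u v := setrow (setrow A i u) j v.
have DD u u' v : D (M (u + u') v) = D (M u v) + D (M u' v).
  have sw w : M w v = setrow (setrow A j v) i w.
    apply/row_matrixP => l; rewrite !row_setrow.
    by case: eqP => [->|//]; rewrite eq_sym (negPf ij).
  by have := linD (setrow A j v) i 1 u u'; rewrite scale1r mul1r !sw.
have DD' u v v' : D (M u (v + v')) = D (M u v) + D (M u v').
  by have := linD (setrow A i u) j 1 v v'; rewrite scale1r mul1r.
have M0 u : D (M u u) = 0.
  apply: (altD ij); rewrite !row_setrow eqxx (negPf ij).
  by rewrite eqxx.
have := M0 (row i A + row j A); rewrite DD !DD' !M0 add0r addr0.
have -> : M (row i A) (row j A) = A by rewrite /M setrow_id setrow_id.
have -> : M (row j A) (row i A) = xrow i j A.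
  apply/row_matrixP => l; rewrite !row_setrow row_row_perm.
  by case: eqP => [->|lj]; [rewrite tpermR | case: eqP => [->|li]; [rewrite tpermL | rewrite tpermD // eq_sym; apply/eqP]].
by move=> /eqP; rewrite addrC addr_eq0 => /eqP.
Qed.

Lemma rowwise_perm (s : 'S_N) : D 1%:M = 0 -> D (perm_mx s) = 0.
Proof.
move=> D1; have [ts -> dts] := prod_tpermP s.
elim: ts dts => [|[i j] ts IH] /=; first by rewrite big_nil perm_mx1.
move=> /andP [ij dts]; rewrite big_cons perm_mxM -xrowE rowwise_swap //.
by rewrite IH // oppr0.
Qed.

(** Replacing the rows by basis vectors, one at a time, reduces to matrices
    whose rows are basis vectors: either two rows agree, or the matrix is a
    permutation matrix. *)
Lemma rowwise_zero : D 1%:M = 0 -> forall A, D A = 0.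
Proof.
move=> D1; suff H k : forall A, (forall i : 'I_N, (k <= i)%N ->
    exists j, row i A = delta_mx 0 j) -> D A = 0.
  by move=> A; apply: (H N) => i; rewrite leqNgt ltn_ord.
elim: k => [|k IH] A hA.
  have [f fE] := fin_all_exists (fun i => hA i isT).
  have [/injectiveP injf|/injectivePn [i [j ij eij]]] := boolP (injectiveb f).
    have -> : A = perm_mx (perm injf).
      by apply/row_matrixP => i; rewrite fE row_row_perm permE row1.
    exact: rowwise_perm.
  by apply: (altD ij); rewrite !fE eij.
have [kN|Nk] := ltnP k N; last first.
  by apply: IH => i; rewrite leqNgt (leq_trans (ltn_ord i) Nk).
pose k0 := Ordinal kN.
have lin0 : D (setrow A k0 0) = 0.
  by have := linD A k0 0 0 0; rewrite scaler0 addr0 mul0r add0r => h; have := linD A k0 (-1) 0 0; rewrite scaler0 addr0 mulN1r addNr.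
rewrite -(setrow_id A k0) (row_sum_delta (row k0 A)).
elim/big_ind: _ => // [u v hu hv|j _].
  by have := linD A k0 1 u v; rewrite scale1r mul1r hu hv addr0.
have := linD A k0 (row k0 A 0 j) (delta_mx 0 j) 0; rewrite addr0 lin0 addr0 => ->.
rewrite IH ?mulr0 // => i ki; rewrite row_setrow; case: eqP => [_|ik]; first by exists j.
apply: hA; rewrite ltn_neqAle ki andbT; apply/eqP => e; apply: ik; exact: val_inj.
Qed.
End DetUnique.

Section AlternatingDet.
Context (R : comPzRingType).

Definition rows (N : nat) (A : 'M[R]_N) := [seq row i A | i <- enum 'I_N].

(** The difference of the two sides is multilinear and alternating in the rows
    and vanishes at the identity matrix. *)
Lemma alternating_det N (F : seq 'rV[R]_N -> R) (A : 'M[R]_N) :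
  multilin F -> alternating F -> F (rows A) = \det A * F (rows 1%:M).
Proof.
move=> mF aF; apply/eqP; rewrite -subr_eq0; apply/eqP.
have sp (k : 'I_N) : exists s1 s2, [/\ enum 'I_N = s1 ++ k :: s2, k \notin s1 & k \notin s2].
  have kin : k \in enum 'I_N by rewrite mem_enum.
  move: (enum_uniq 'I_N); case/splitPr: kin => s1 s2.
  rewrite cat_uniq /= negb_or => /and3P [_ /andP [k1 _] /andP [k2 _]].
  by exists s1, s2.
pose D B := F (rows B) - \det B * F (rows 1%:M).
suff : forall B, D B = 0 by apply.
apply: rowwise_zero; last by rewrite /D det1 mul1r subrr.
  move=> B k c u v; have [s1 [s2 [E k1 k2]]] := sp k.
  have rE w : rows (setrow B k w) = [seq row i B | i <- s1] ++ w :: [seq row i B | i <- s2].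
    rewrite /rows E map_cat /= row_setrow eqxx; congr (_ ++ _ :: _).
      by apply/eq_in_map => i i1; rewrite row_setrow; case: eqP => // ik; rewrite -ik i1 in k1.
    by apply/eq_in_map => i i2; rewrite row_setrow; case: eqP => // ik; rewrite -ik i2 in k2.
  have row'E w : row' k (setrow B k w) = row' k B.
    by apply/matrixP => i j; rewrite !mxE eq_sym (negPf (neq_lift k i)).
  rewrite /D !rE mF.
  rewrite (determinant_multilinear (A := setrow B k (c *: u + v)) (B := setrow B k u)
    (C := setrow B k v) (i0 := k) (b := c) (c := 1)) ?row'E //; last first.
    by rewrite !row_setrow eqxx scale1r.
  by rewrite mul1r; ring.
move=> B i j ij e; rewrite /D (determinant_alternate ij) ?mul0r ?subr0; last first.
  by move=> l; have /rowP/(_ l) := e; rewrite !mxE.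
have [s1 [s2 [E k1 k2]]] := sp i.
have : j \in enum 'I_N by rewrite mem_enum.
rewrite /rows E mem_cat inE eq_sym (negPf ij) /= => /orP [/splitPr|/splitPr].
  case=> t1 t2; rewrite -catA map_cat /= map_cat /= e.
  exact: alternating_rep.
case=> t1 t2; rewrite map_cat /= map_cat /= e; exact: alternating_rep.
Qed.

Lemma alternating_mdet (K : lmodType R) (hK : fg_projective K) N (k : {linear 'rV[R]_N -> K})
    (k' : {linear K -> 'rV[R]_N}) (phi : {linear K -> K}) (F : seq K -> R) :
  cancel k k' -> cancel k' k -> multilin F -> alternating F ->
  F [seq phi (k (delta_mx 0 i)) | i <- enum 'I_N]
  = mdet hK phi * F [seq k (delta_mx 0 i) | i <- enum 'I_N].
Proof.
move=> kK k'K mF aF; rewrite (mdet_free hK phi kK k'K).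
set A := lin1_mx _.
have mkF : multilin (F \o map k).
  by move=> s1 s2 c x y /=; rewrite !map_cat /= linearP mF.
have akF : alternating (F \o map k) by move=> s1 s2 x /=; rewrite map_cat /=; exact: aF.
have /= := @alternating_det N _ A mkF akF.
have -> : map k (rows A) = [seq phi (k (delta_mx 0 i)) | i <- enum 'I_N].
  by rewrite /rows -map_comp; apply: eq_map => i /=; rewrite rowE mul_rV_lin1 /= k'K.
move=> ->; congr (_ * F _).
by rewrite /rows -map_comp; apply: eq_map => i /=; rewrite row1.
Qed.
End AlternatingDet.

(** * Forms on direct summands *)
Section AltfTheory.
Context (R : comPzRingType) (K : lmodType R) (w : K -> K -> R) (hw : altf w).

Lemma altfDl x x' y : w (x + x') y = w x y + w x' y.
Proof. by have [_ -> _] := scalar_facts (altf_l hw y). Qed.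
Lemma altfDr x y y' : w x (y + y') = w x y + w x y'.
Proof. by have [_ -> _] := scalar_facts (altf_r hw x). Qed.
Lemma altfZl c x y : w (c *: x) y = c * w x y.
Proof. by have [_ _ ->] := scalar_facts (altf_l hw y). Qed.
Lemma altfZr c x y : w x (c *: y) = c * w x y.
Proof. by have [_ _ ->] := scalar_facts (altf_r hw x). Qed.
Lemma altf0l y : w 0 y = 0.
Proof. by have [-> _ _] := scalar_facts (altf_l hw y). Qed.
Lemma altf0r x : w x 0 = 0.
Proof. by have [-> _ _] := scalar_facts (altf_r hw x). Qed.
Lemma altfNl x y : w (- x) y = - w x y.
Proof. by rewrite -scaleN1r altfZl mulN1r. Qed.
Lemma altfNr x y : w x (- y) = - w x y.
Proof. by rewrite -scaleN1r altfZr mulN1r. Qed.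
Definition altfE := (altfDl, altfDr, altfNl, altfNr, altfZl, altfZr, altf0l, altf0r, altf_xx hw).
End AltfTheory.

Section Forms.
Context (R : comPzRingType).
Implicit Types P K : lmodType R.

Lemma altf_pull P K (h : {linear P -> K}) (w : K -> K -> R) :
  altf w -> altf (fun x y => w (h x) (h y)).
Proof.
move=> hw; split=> [y c u v|x c u v|x]; last exact: altf_xx.
  by rewrite linearP altf_l.
by rewrite linearP altf_r.
Qed.

Lemma altfD P (f g : P -> P -> R) : altf f -> altf g -> altf (fun x y => f x y + g x y).
Proof.
move=> hf hg; split=> [y c u v|x c u v|x].
- by rewrite (altf_l hf) (altf_l hg) /=; ring.
- by rewrite (altf_r hf) (altf_r hg) /=; ring.
- by rewrite !altf_xx // addr0.
Qed.

Lemma altf_scale P (f : P -> P -> R) (a : R) : altf f -> altf (fun x y => a * f x y).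
Proof.
move=> hf; split=> [y c u v|x c u v|x].
- by rewrite (altf_l hf) /=; ring.
- by rewrite (altf_r hf) /=; ring.
- by rewrite altf_xx // mulr0.
Qed.

Definition pform P P' (f : P -> P -> R) (g : P' -> P' -> R) (x y : P * P') : R :=
  f x.1 y.1 + g x.2 y.2.

Lemma altf_pform P P' (f : P -> P -> R) (g : P' -> P' -> R) :
  altf f -> altf g -> altf (pform f g).
Proof.
by move=> hf hg; apply: altfD; [exact: (altf_pull fst hf) | exact: (altf_pull snd hg)].
Qed.

Section Extension.
Context (P K : lmodType R) (J : {linear P -> K}) (rho : {linear K -> P})
  (w : K -> K -> R).

(** For J : P -> K with retraction rho, the form on K = J(P) + ker rho that is f
    on the first summand and w on the second, the two being orthogonal. *)
Definition extf (f : P -> P -> R) (x y : K) : R :=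
  f (rho x) (rho y) + w (x - J (rho x)) (y - J (rho y)).

(** phi on J(P) and the identity on ker rho. *)
Definition extend (phi : P -> P) (x : K) : K := x + J (phi (rho x) - rho x).

Lemma extend_linear (phi : {linear P -> P}) : linear (extend phi).
Proof.
by move=> c u v; rewrite -[LHS]/((idfun \+ (J \o (phi \- idfun) \o rho)) (c *: u + v)) linearP.
Qed.
HB.instance Definition _ (phi : {linear P -> P}) :=
  GRing.isLinear.Build R K K *:%R (extend phi) (extend_linear phi).

Lemma altf_extf f : altf f -> altf w -> altf (extf f).
Proof.
move=> hf hw; apply: altfD; first exact: altf_pull.
exact: (altf_pull (idfun \- (J \o rho)) hw).
Qed.

Hypothesis JK : cancel J rho.

Lemma extf_extend f (phi : {linear P -> P}) x y :
  extf f (extend phi x) (extend phi y) = extf (fun u v => f (phi u) (phi v)) x y.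
Proof.
have rE z : rho (extend phi z) = phi (rho z).
  by rewrite /extend linearD /= JK addrC subrK.
have kE z : extend phi z - J (rho (extend phi z)) = z - J (rho z).
  by rewrite rE /extend linearB /= addrA addrAC addrK.
by rewrite /extf !kE !rE.
Qed.

(** The hypothesis says that rho is the orthogonal projection onto the
    non-degenerate subspace J(P). *)
Lemma extf_orth g : altf w -> (forall x y, w (J x) y = g x (rho y)) -> altf g ->
  forall x y, extf g x y = w x y.
Proof.
move=> hw Jw hg x y; have k0 z : rho (z - J (rho z)) = 0 by rewrite linearB /= JK subrr.
have kJ u z : w (u - J (rho u)) (J z) = 0.
  by rewrite (altfC _ _ hw) Jw k0 (altf0r hg) oppr0.
by rewrite /extf (altfDr hw) (altfNr hw) kJ subr0 (altfDl hw) (altfNl hw) Jw; ring.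
Qed.
End Extension.

Lemma altiso_adjoint P K (g : altiso P) (J : {linear P -> K}) (w : K -> K -> R) : altf w ->
  exists rho : {linear K -> P}, forall x y, w (J x) y = g x (rho y).
Proof.
move=> hw; have hg := altf_altiso g.
have ex y : exists p, forall x, w (J x) y = g x p.
  have l : linear (fun x => w (J x) y : R^o).
    by move=> c u v; rewrite linearP altf_l.
  have [p hp] := aform_surj g (Linear_of l); exists (- p) => x.
  by rewrite (altfNr hg) (altfC _ _ hg) opprK hp.
pose r y := sval (cid (ex y)); have rE y : forall x, w (J x) y = g x (r y) := svalP (cid (ex y)).
have lr : linear r.
  move=> c u v; apply/eqP; rewrite -subr_eq0; apply/eqP; apply: (@aform_inj _ _ g) => x.
  rewrite (altfC _ _ hg) (altfDr hg) (altfNr hg) (altfDr hg) (altfZr hg) -!rE.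
  by rewrite (altfDr hw) (altfZr hw) subrr oppr0.
by exists (Linear_of lr).
Qed.

Lemma altiso_adjointK P K (g : altiso P) (J : {linear P -> K}) (rho : {linear K -> P})
    (w : K -> K -> R) : (forall x y, w (J x) y = g x (rho y)) ->
  (forall x y, w (J x) (J y) = g x y) -> cancel J rho.
Proof.
move=> Jw Jg y; have hg := altf_altiso g.
apply/eqP; rewrite -subr_eq0; apply/eqP; apply: (@aform_inj _ _ g) => x.
by rewrite (altfC _ _ hg) (altfDr hg) (altfNr hg) -Jw Jg subrr oppr0.
Qed.
End Forms.

Section StdEmbedding.
Context (R : comPzRingType).
Implicit Types P : lmodType R.

Lemma psi_formS n (u v : 'rV[R]_2) (x y : 'rV[R]_(n.*2)) :
  mx_form (psi R n.+1) (row_mx u x : 'rV_(2 + n.*2)) (row_mx v y : 'rV_(2 + n.*2))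
  = u 0 0 * v 0 1 - u 0 1 * v 0 0 + mx_form (psi R n) x y.
Proof.
rewrite /mx_form /=.
rewrite (@mul_row_block _ 1 2 n.*2 2 n.*2) !mulmx0 addr0 add0r.
rewrite (@tr_row_mx _ 1 2 n.*2) (@mul_row_col _ 1 2 n.*2) mxE; congr (_ + _).
rewrite !mxE !big_ord_recl !big_ord0 !mxE !big_ord_recl !big_ord0 !mxE /=.
rewrite (_ : lift ord0 ord0 = 1); last exact: val_inj.
by ring.
Qed.

(** A sum of n terms c /\ d is the pullback of n hyperbolic planes. *)
Lemma std_embedding_sum n P (c d : 'I_n -> {linear P -> R^o}) :
  exists J : {linear P -> 'rV[R]_(n.*2)}, forall x y,
    mx_form (psi R n) (J x) (J y) = \sum_a ((c a x : R) * d a y - (d a x : R) * c a y).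
Proof.
elim: n c d => [|n IH] c d.
  by exists \0 => x y; rewrite big_ord0; exact: (altf0l (altf_altiso (mx_altiso (psi R 0)))).
have [J JE] := IH (c \o lift ord0) (d \o lift ord0).
pose h x : 'rV[R]_2 := \row_i (if i == 0 then c ord0 x : R else d ord0 x).
have lh : linear h.
  by move=> a u v; apply/rowP => i; rewrite !mxE; case: eqP => _; rewrite linearP.
pose J' x : 'rV[R]_(2 + n.*2) := row_mx (h x) (J x).
have lJ : linear J'.
  by move=> a u v; rewrite /J' lh linearP scale_row_mx add_row_mx.
exists (Linear_of lJ) => x y.
rewrite [LHS]psi_formS JE big_ord_recl !mxE /=; congr (_ + _).
Qed.

(** Since h is alternating it is k - k^t for the bilinear form
    k(x, y) = sum over a < b of x_a y_b h(q_a, q_b) in the coordinates x_a of a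
    retraction onto P with q_a the images of the basis vectors.  So
    x |-> (x, k(-, x)) is an isometric embedding. *)
Lemma std_embedding P (hP : fg_projective P) (h : altiso P) :
  exists n (J : {linear P -> 'rV[R]_(n.*2)}), forall x y,
    mx_form (psi R n) (J x) (J y) = h x y.
Proof.
have [t _] := fgp_retract_ex hP; have ah := altf_altiso h.
pose q (a : 'I_(rt_n t)) := rt_r t (delta_mx 0 a).
have lc a : linear (fun x => rt_i t x 0 a : R^o) by move=> s u v; rewrite linearP !mxE.
have ld (a : 'I_(rt_n t)) : linear (fun x => \sum_(b < rt_n t | (a < b)%N) rt_i t x 0 b * h (q a) (q b) : R^o).
  move=> s u v; rewrite scaler_sumr -big_split; apply: eq_bigr => b _ /=.
  by rewrite linearP !mxE mulrDl -mulrA.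
have [J JE] := std_embedding_sum (fun a => Linear_of (lc a)) (fun a => Linear_of (ld a)).
exists (rt_n t), J => x y; rewrite {}JE.
(* h x y is the sum of all E a b; the terms with a < b and those with b < a
   are the two halves of the hyperbolic form. *)
pose E a b := rt_i t x 0 a * rt_i t y 0 b * h (q a) (q b).
have dec z : z = \sum_a rt_i t z 0 a *: q a.
  rewrite -{1}(rt_K t z) {1}[rt_i t z]row_sum_delta linear_sum.
  by apply: eq_bigr => a _; rewrite linearZ.
have -> : h x y = \sum_a \sum_b E a b.
  rewrite {1}(dec x) {1}(dec y).
  rewrite (big_morph (fun z => h z _) (fun u v => altfDl ah u v _) (altf0l ah _)).
  apply: eq_bigr => a _; rewrite (altfZl ah).
  rewrite (big_morph (h (q a)) (altfDr ah (q a)) (altf0r ah _)) mulr_sumr.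
  by apply: eq_bigr => b _; rewrite (altfZr ah) mulrA.
have split_a (a : 'I_(rt_n t)) : \sum_b E a b =
    \sum_(b < rt_n t | (a < b)%N) E a b + \sum_(b < rt_n t | (b < a)%N) E a b.
  rewrite (bigID (fun b : 'I_(rt_n t) => (a < b)%N)) /=; congr (_ + _).
  rewrite (bigD1 a) ?ltnn //= {1}/E aform_alt mulr0 add0r.
  by apply: eq_bigl => b; rewrite -leqNgt -val_eqE /= [RHS]ltn_neqAle andbC.
under [RHS]eq_bigr do rewrite split_a.
rewrite [RHS]big_split sumrB /=; congr (_ + _).
  by apply: eq_bigr => a _; rewrite mulr_sumr; apply: eq_bigr => b _; rewrite mulrA.
rewrite -sumrN [RHS](exchange_big_dep predT) //=; apply: eq_bigr => a _.
rewrite mulr_suml -sumrN; apply: eq_bigr => b _.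
by rewrite /E (altfC (q b) (q a) ah); ring.
Qed.
End StdEmbedding.

(** * The Pfaffian of one form relative to another *)
Lemma map_enum_split m n (T : Type) (f : 'I_(m + n) -> T) :
  [seq f i | i <- enum 'I_(m + n)]
  = [seq f (lshift n i) | i <- enum 'I_m] ++ [seq f (rshift m i) | i <- enum 'I_n].
Proof.
suff -> : enum 'I_(m + n) = map (lshift n) (enum 'I_m) ++ map (@rshift m n) (enum 'I_n).
  by rewrite map_cat -(map_comp f (lshift n)) -(map_comp f (@rshift m n)).
apply: (inj_map val_inj); transitivity (iota 0 (m + n)); first exact: val_enum_ord.
rewrite map_cat -(map_comp val (lshift n)) -(map_comp val (@rshift m n)) iotaD; congr (_ ++ _).
  by rewrite -[LHS]val_enum_ord.
rewrite add0n -{1}(addn0 m) iotaDl.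
transitivity (map (addn m) (map val (enum 'I_n))); first by rewrite val_enum_ord.
by rewrite -(map_comp (addn m) val).
Qed.

Section PsiPf.
Context (R : comPzRingType).

Lemma Pf_psi n : Pf (psi_mx R n) = 1.
Proof.
elim: n => [|n IH] //; rewrite [LHS]/=.
have E (M : 'M[R]_(2 + n.*2)) (i j i' j' : 'I_(2 + n.*2)) :
  val i = val i' -> val j = val j' -> M i j = M i' j'.
  by move=> /val_inj -> /val_inj ->.
pose B : 'M[R]_(2 + n.*2) := block_mx (psi2_mx R) 0 0 (psi_mx R n).
rewrite big_ord_recl big1 => [|j _].
  rewrite addr0 expr0 mul1r [X in X * _](_ : _ = 1); last first.
    apply: (etrans (E B _ _ (lshift n.*2 ord0) (lshift n.*2 (lift ord0 ord0)) _ _)) => //.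
    by rewrite block_mxEul mxE.
  rewrite mul1r -[RHS]IH; congr Pf; apply/matrixP => i j; rewrite 4!mxE.
  apply: (etrans (E B _ _ (rshift 2 i) (rshift 2 j) _ _)) => //.
  by rewrite block_mxEdr.
rewrite [X in _ * X * _](_ : _ = 0) ?mulr0 ?mul0r //.
apply: (etrans (E B _ _ (lshift n.*2 ord0) (rshift 2 j) _ _)) => //.
by rewrite block_mxEur mxE.
Qed.
End PsiPf.

Section Ambient.
Context (R : comPzRingType).
Implicit Types P K : lmodType R.

Definition delta_basis K N (k : {linear 'rV[R]_N -> K}) := [seq k (delta_mx 0 i) | i <- enum 'I_N].

(** (P, g) as an orthogonal summand of a free module with a basis for which the
    Pfaffian of the form is 1.  Arbitrary free modules are allowed, and not
    only the standard hyperbolic ones, so that two of them can be added. *)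
Record ambient P (g : P -> P -> R) := Ambient {
  am_K : lmodType R;
  am_n : nat;
  am_N : nat;
  am_k : {linear 'rV[R]_am_N -> am_K};
  am_k' : {linear am_K -> 'rV[R]_am_N};
  am_w : am_K -> am_K -> R;
  am_J : {linear P -> am_K};
  am_rho : {linear am_K -> P};
  am_kK : cancel am_k am_k';
  am_k'K : cancel am_k' am_k;
  am_wP : altf am_w;
  am_JK : cancel am_J am_rho;
  am_Jw : forall x y, am_w (am_J x) y = g x (am_rho y);
  am_size : am_N = am_n.*2;
  am_unit : pfp am_w am_n (delta_basis am_k) = 1 }.

Arguments am_k {P g} a.
Arguments am_k' {P g} a.
Arguments am_w {P g} a.
Arguments am_J {P g} a.
Arguments am_rho {P g} a.

(** Pf(f _|_ w') / Pf(g _|_ w'), where w' is the form on the complement of P. *)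
Definition am_pf P (g : P -> P -> R) (A : ambient g) (f : P -> P -> R) : R :=
  pfp (extf (am_J A) (am_rho A) (am_w A) f) (am_n A) (delta_basis (am_k A)).

Lemma am_pf_base P (g : P -> P -> R) (A : ambient g) : altf g -> am_pf A g = 1.
Proof.
move=> hg; rewrite -[RHS](am_unit A); apply: eq_pfp.
move=> x y; exact: (extf_orth (@am_JK _ _ A) (am_wP A) (@am_Jw _ _ A) hg).
Qed.

Lemma eq_am_pf P (g : P -> P -> R) (A : ambient g) f f' :
  (forall x y, f x y = f' x y) -> am_pf A f = am_pf A f'.
Proof. by move=> e; apply: eq_pfp => x y; rewrite /extf e. Qed.

Lemma fgp_am P (g : P -> P -> R) (A : ambient g) : fg_projective (am_K A).
Proof. exact: fgp_retract (@am_k'K _ _ A) (fgp_row R (am_N A)). Qed.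

(** The pullback of f along phi extends to the pullback of the extension of f
    along phi + id, whose effect on the Pfaffian is det (phi + id). *)
Lemma am_pf_pull P (hP : fg_projective P) (g : P -> P -> R) (A : ambient g) f
    (phi : {linear P -> P}) : altf f ->
  am_pf A (fun x y => f (phi x) (phi y)) = mdet hP phi * am_pf A f.
Proof.
move=> hf; pose E : {linear am_K A -> am_K A} := extend (am_J A) (am_rho A) phi.
have hF := altf_extf (am_J A) (am_rho A) hf (am_wP A).
rewrite /am_pf -(@mdet_ext _ _ _ hP (fgp_am A) _ _ phi E (@am_JK _ _ A)) //.
have /= <- := alternating_mdet (fgp_am A) E (@am_kK _ _ A) (@am_k'K _ _ A)
  (pfp_multilin (am_n A) hF) (pfp_alternating (am_n A) hF).
rewrite -[in RHS]/(map _ _) map_comp pfp_map; apply: eq_pfp => x y.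
by rewrite -(extf_extend _ (@am_JK _ _ A)).
Qed.

Section Product.
Context (P P' : lmodType R) (g : P -> P -> R) (g' : P' -> P' -> R).
Context (A : ambient g) (A' : ambient g').

Definition prod_k (v : 'rV[R]_(am_N A + am_N A')) : am_K A * am_K A' :=
  (am_k A (lsubmx v), am_k A' (rsubmx v)).
Lemma prod_k_linear : linear prod_k.
Proof. by move=> c u v; rewrite /prod_k !linearP. Qed.
HB.instance Definition _ := GRing.isLinear.Build R _ _ *:%R prod_k prod_k_linear.
Definition prod_k' (x : am_K A * am_K A') : 'rV[R]_(am_N A + am_N A') :=
  row_mx (am_k' A x.1) (am_k' A' x.2).
Lemma prod_k'_linear : linear prod_k'.
Proof. by move=> c u v; rewrite /prod_k' !linearP /= scale_row_mx add_row_mx. Qed.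
HB.instance Definition _ := GRing.isLinear.Build R _ _ *:%R prod_k' prod_k'_linear.

Lemma prod_basis : delta_basis prod_k =
  [seq (x, 0) | x <- delta_basis (am_k A)] ++ [seq (0, x) | x <- delta_basis (am_k A')].
Proof.
rewrite /delta_basis map_enum_split -!map_comp; congr (_ ++ _); apply: eq_map => i /=.
  by rewrite /prod_k delta_mx_lshift row_mxKl row_mxKr linear0.
by rewrite /prod_k delta_mx_rshift row_mxKl row_mxKr linear0.
Qed.

Lemma prod_pfp (f : am_K A -> am_K A -> R) (f' : am_K A' -> am_K A' -> R) :
  altf f -> altf f' ->
  pfp (pform f f') (am_n A + am_n A') (delta_basis prod_k)
  = pfp f (am_n A) (delta_basis (am_k A)) * pfp f' (am_n A') (delta_basis (am_k A')).
Proof.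
move=> hf hf'; rewrite prod_basis pfp_cat.
- rewrite !pfp_map; congr (_ * _); apply: eq_pfp => x y; rewrite /pform /=.
    by rewrite (altf0l hf') addr0.
  by rewrite (altf0l hf) add0r.
- by rewrite 2!size_map size_enum_ord am_size.
- move=> _ _ /mapP [x _ ->] /mapP [y _ ->]; rewrite /pform /=.
  by rewrite (altf0l hf') (altf0r hf) addr0.
Qed.

Lemma prod_am : exists B : ambient (pform g g'), forall f f', altf f -> altf f' ->
  am_pf B (pform f f') = am_pf A f * am_pf A' f'.
Proof.
have kK : cancel prod_k prod_k'.
  by move=> v; rewrite /prod_k /prod_k' /= !am_kK hsubmxK.
have k'K : cancel prod_k' prod_k.
  by move=> [x y]; rewrite /prod_k /prod_k' /= row_mxKl row_mxKr !am_k'K.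
have wP := altf_pform (am_wP A) (am_wP A').
have JK : cancel (prod_map (am_J A) (am_J A')) (prod_map (am_rho A) (am_rho A')).
  by move=> [x y]; rewrite /= /lpair /= !am_JK.
have Jw x y : pform (am_w A) (am_w A') (prod_map (am_J A) (am_J A') x) y
            = pform g g' x (prod_map (am_rho A) (am_rho A') y).
  by rewrite /pform /= !am_Jw.
have sz : (am_N A + am_N A')%N = (am_n A + am_n A').*2 by rewrite !am_size doubleD.
have un : pfp (pform (am_w A) (am_w A')) (am_n A + am_n A') (delta_basis prod_k) = 1.
  by rewrite prod_pfp ?am_unit ?mulr1 //; exact: am_wP.
exists (Ambient kK k'K wP JK Jw sz un) => f f' hf hf'.
rewrite /am_pf -prod_pfp; [|exact: altf_extf (am_wP _)..].
by apply: eq_pfp => x y; rewrite /extf /pform /=; ring.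
Qed.
End Product.

(** Exchanges the summands up to a sign, which forms do not see; unlike the swap
    it has determinant 1 whatever the rank of P. *)
Definition rot P : {linear (P * P)%type -> (P * P)%type} := lpair (\- snd) fst.

Lemma mdet_rot P (hP : fg_projective (P * P)%type) : mdet hP (rot P) = 1.
Proof.
pose U : {linear (P * P)%type -> (P * P)%type} := lpair (fst \- snd) snd.
pose L : {linear (P * P)%type -> (P * P)%type} := lpair fst (snd \+ fst).
have dU : mdet hP U = 1.
  apply: (@mdet_nil _ _ _ hP hP (lpair (\- snd) \0) (lpair \0 snd)) => -[x y] //.
  by apply: injective_projections; rewrite /= ?addr0.
have dL : mdet hP L = 1.
  apply: (@mdet_nil _ _ _ hP hP (lpair \0 fst) (lpair fst \0)) => -[x y] //.
  by apply: injective_projections; rewrite /= ?addr0.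
have e1 : mdet hP (U \o L) = 1 by rewrite (mdetM hP U L) dU dL mulr1.
have := mdetM hP (U \o L) U; rewrite e1 dU mulr1 => <-.
apply: eq_mdet => -[x y]; apply: injective_projections; rewrite /= [y + _]addrC subrK //.
by rewrite addrAC subrr sub0r.
Qed.

(** In the sum of the two ambient spaces the rotation carries f2 _|_ f1 to
    f1 _|_ f2 and has determinant 1.  For f0 = f1 this says that the relative
    Pfaffian does not depend on the ambient space. *)
Lemma am_pf_cocycle P (hP : fg_projective P) (f0 f1 f2 : P -> P -> R)
    (A : ambient f0) (A' : ambient f1) : altf f1 -> altf f2 ->
  am_pf A f2 = am_pf A f1 * am_pf A' f2.
Proof.
move=> h1 h2; have [B BE] := prod_am A A'.
rewrite -BE // -[LHS]mulr1 -(am_pf_base A' h1) -BE //.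
have := am_pf_pull (fgp_prod hP hP) B (rot P) (altf_pform h2 h1).
rewrite mdet_rot mul1r => <-; apply: eq_am_pf => x y.
by rewrite /pform /= (altfNl h2) (altfNr h2) opprK addrC.
Qed.

Lemma std_ambient P (hP : fg_projective P) (g : altiso P) :
  exists n (J : {linear P -> 'rV[R]_(n.*2)}) (rho : {linear 'rV[R]_(n.*2) -> P}),
    [/\ cancel J rho, forall x y, mx_form (psi R n) (J x) y = g x (rho y) &
     exists A : ambient g, forall f, am_pf A f =
      Pf (\matrix_(i, j) extf J rho (mx_form (psi R n)) f (delta_mx 0 i) (delta_mx 0 j))].
Proof.
have [n [J JE]] := std_embedding hP g.
have ha := altf_altiso (mx_altiso (psi R n)).
have [rho rE] := altiso_adjoint g J ha.
have JK := altiso_adjointK rE JE.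
exists n, J, rho; split=> //.
have un : pfp (mx_form (psi R n)) n (delta_basis (idfun : {linear 'rV[R]_(n.*2) -> _})) = 1.
  rewrite -(Pf_psi R n) /delta_basis -Pf_pfp; congr Pf; apply/matrixP => i j.
  rewrite mxE /mx_form -rowE /= trmx_delta -colE; by rewrite !mxE.
pose A := @Ambient P g _ n _ idfun idfun _ J rho (fun=> erefl) (fun=> erefl) ha JK rE erefl un.
by exists A => f; rewrite /am_pf /delta_basis -Pf_pfp.
Qed.

Definition std_am P (hP : fg_projective P) (g : altiso P) : ambient g :=
  sval (cid (let: ex_intro _ (ex_intro _ (ex_intro _ (And3 _ _ (ex_intro A _)))) :=
    std_ambient hP g in ex_intro (fun _ : ambient g => True) A I)).

Definition pf P (hP : fg_projective P) (g : altiso P) (f : P -> P -> R) : R :=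
  am_pf (std_am hP g) f.

Section PfTheory.
Context (P : lmodType R) (hP : fg_projective P) (g : altiso P).

Lemma eq_pf f f' : (forall x y, f x y = f' x y) -> pf hP g f = pf hP g f'.
Proof. exact: eq_am_pf. Qed.

Lemma pf_am (A : ambient g) f : altf f -> am_pf A f = pf hP g f.
Proof.
move=> hf; have hg := altf_altiso g.
by rewrite (am_pf_cocycle hP A (std_am hP g) hg hf) am_pf_base // mul1r.
Qed.

Lemma pf_base : pf hP g g = 1.
Proof. exact: am_pf_base (altf_altiso g). Qed.

Lemma pf_pull f (phi : {linear P -> P}) : altf f ->
  pf hP g (fun x y => f (phi x) (phi y)) = mdet hP phi * pf hP g f.
Proof. exact: am_pf_pull. Qed.

Lemma pf_cocycle (f : altiso P) f' : altf f' -> pf hP g f' = pf hP g f * pf hP f f'.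
Proof. by move=> hf'; apply: am_pf_cocycle => //; exact: altf_altiso. Qed.
End PfTheory.

Lemma pf_pform P P' (hP : fg_projective P) (hP' : fg_projective P')
    (hPP' : fg_projective (P * P')%type) (g : altiso P) (g' : altiso P') f f' :
  altf f -> altf f' -> pf hPP' (perp g g') (pform f f') = pf hP g f * pf hP' g' f'.
Proof.
move=> hf hf'; have [B BE] := prod_am (std_am hP g) (std_am hP' g').
rewrite /pf -BE //; symmetry.
exact: (@pf_am _ hPP' (perp g g') B _ (altf_pform hf hf')).
Qed.

Lemma pf_psi n (hn : fg_projective 'rV[R]_(n.*2)) (M : altmx R n.*2) :
  pf hn (mx_altiso (psi R n)) (mx_form M) = Pf M.
Proof.
have ha := altf_altiso (mx_altiso (psi R n)).
have mxE_delta (N : altmx R n.*2) : \matrix_(i, j) mx_form N (delta_mx 0 i) (delta_mx 0 j) = N.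
  by apply/matrixP => i j; rewrite mxE /mx_form -rowE /= trmx_delta -colE !mxE.
have un : pfp (mx_form (psi R n)) n (delta_basis (idfun : {linear 'rV[R]_(n.*2) -> _})) = 1.
  by rewrite -(Pf_psi R n) /delta_basis -Pf_pfp mxE_delta.
pose A := @Ambient _ (mx_altiso (psi R n)) _ n _ idfun idfun _ idfun idfun
  (fun=> erefl) (fun=> erefl) ha (fun=> erefl) (fun _ _ => erefl) erefl un.
rewrite -(pf_am hn A (altf_altiso (mx_altiso M))) /am_pf /delta_basis -Pf_pfp; congr Pf.
have h0 y : mx_form (psi R n) 0 y = 0 := altf0l ha y.
rewrite -[RHS]mxE_delta; apply/matrixP => i j; rewrite 2!mxE /extf /= !subrr.
by rewrite h0 addr0.
Qed.
End Ambient.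

(** * Stable isometry and the group V_SL(R) *)
Section IsoSL.
Context (R : comPzRingType).
Implicit Types P Q : lmodType R.

Definition isoSL P (hP : fg_projective P) (g f : P -> P -> R) :=
  exists phi : {linear P -> P},
    [/\ bijective phi, mdet hP phi = 1 & forall x y, f (phi x) (phi y) = g x y].

Lemma eq_isoSL P (hP : fg_projective P) g f : (forall x y, f x y = g x y) -> isoSL hP g f.
Proof. by move=> e; exists idfun; split=> //; [exists id | exact: mdet_id]. Qed.

Lemma isoSL_trans P (hP : fg_projective P) g f k :
  isoSL hP g f -> isoSL hP f k -> isoSL hP g k.
Proof.
move=> [a [ba da Ea]] [b [bb db Eb]]; exists (b \o a); split.
- exact: bij_comp.
- by rewrite (mdetM hP b a) da db mulr1.
- by move=> x y /=; rewrite Eb Ea.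
Qed.

Lemma isoSL_sym P (hP : fg_projective P) g f : isoSL hP g f -> isoSL hP f g.
Proof.
move=> [a [/bij_linear_inv [b [aK bK]] da Ea]]; exists b; split.
- by exists a.
- by rewrite -[LHS]mul1r -da mdet_inv.
- by move=> x y; rewrite -Ea !bK.
Qed.

Lemma isoSL_transport P Q (hP : fg_projective P) (hQ : fg_projective Q)
    (h : {linear P -> Q}) g f g' f' : bijective h ->
  (forall x y, g x y = g' (h x) (h y)) -> (forall x y, f x y = f' (h x) (h y)) ->
  isoSL hP g f -> isoSL hQ g' f'.
Proof.
move=> /bij_linear_inv [k [hK kK]] gE fE [a [ba da Ea]].
exists (h \o a \o k); split.
- by apply: bij_comp; [apply: bij_comp => //; exists k | exists h].
- by rewrite -da; apply: (@mdet_conj _ _ _ hP hQ h k) => // x /=; rewrite hK.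
- by move=> x y /=; rewrite -fE Ea gE !kK.
Qed.

Lemma prod_map_bij P P' Q Q' (a : {linear P -> P'}) (b : {linear Q -> Q'}) :
  bijective a -> bijective b -> bijective (prod_map a b).
Proof.
move=> [a' aK a'K] [b' bK b'K]; exists (fun x => (a' x.1, b' x.2)) => -[x y].
  by rewrite /= /lpair /= aK bK.
by rewrite /= /lpair /= a'K b'K.
Qed.

Lemma mdet_prod_map P Q (hP : fg_projective P) (hQ : fg_projective Q)
    (hPQ : fg_projective (P * Q)%type) (a : {linear P -> P}) (b : {linear Q -> Q}) :
  mdet hPQ (prod_map a b) = mdet hP a * mdet hQ b.
Proof.
rewrite -(@mdet_ext _ _ _ hP hPQ (lpair idfun \0) fst a (prod_map a idfun)) //; last first.
  move=> [x y]; apply: injective_projections; rewrite /= ?addr0 //.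
  by rewrite addrC subrK.
rewrite -(@mdet_ext _ _ _ hQ hPQ (lpair \0 idfun) snd b (prod_map idfun b)) //; last first.
  move=> [x y]; apply: injective_projections; rewrite /= ?addr0 //.
  by rewrite addrC subrK.
by rewrite -mdetM; apply: eq_mdet => -[x y].
Qed.

Lemma isoSL_prod P Q (hP : fg_projective P) (hQ : fg_projective Q)
    (hPQ : fg_projective (P * Q)%type) g f g' f' :
  isoSL hP g f -> isoSL hQ g' f' -> isoSL hPQ (pform g g') (pform f f').
Proof.
move=> [a [ba da Ea]] [b [bb db Eb]]; exists (prod_map a b); split.
- exact: prod_map_bij.
- by rewrite (mdet_prod_map hP hQ) da db mulr1.
- by move=> [x x'] [y y']; rewrite /pform /= Ea Eb.
Qed.

Lemma rot_bij P : bijective (@rot R P).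
Proof.
exists (fun x => (x.2, - x.1)) => -[x y]; rewrite /= /lpair /=; by rewrite opprK.
Qed.

Lemma rot_form P (f g : P -> P -> R) : altf g ->
  forall x y, pform g f (rot P x) (rot P y) = pform f g x y.
Proof. by move=> hg x y; rewrite /pform /= (altfNl hg) (altfNr hg) opprK addrC. Qed.

Lemma isoSL_rot P (hPP : fg_projective (P * P)%type) (g f : P -> P -> R) : altf f ->
  isoSL hPP (pform g f) (pform f g).
Proof.
move=> hf; exists (rot P); split; [exact: rot_bij | exact: mdet_rot |].
exact: rot_form.
Qed.

Definition exch (A B C D : lmodType R) :
  {linear ((A * B) * (C * D))%type -> ((A * C) * (B * D))%type} :=
  lpair (lpair (fst \o fst) (fst \o snd)) (lpair (snd \o fst) (snd \o snd)).
Lemma exch_bij A B C D : bijective (exch A B C D).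
Proof. by exists (exch A C B D) => -[[a b] [c d]]. Qed.
Definition assocm (A B C : lmodType R) :
  {linear (A * (B * C))%type -> ((A * B) * C)%type} :=
  lpair (lpair fst (fst \o snd)) (snd \o snd).
Lemma assocm_bij A B C : bijective (assocm A B C).
Proof. by exists (fun x => (x.1.1, (x.1.2, x.2))) => [[a [b c]]|[[a b] c]]. Qed.
Definition swapm (A B : lmodType R) : {linear (A * B)%type -> (B * A)%type} := lpair snd fst.
Lemma swapm_bij A B : bijective (swapm A B).
Proof. by exists (swapm B A) => -[a b]. Qed.
End IsoSL.
Arguments isoSL_transport {R P Q hP hQ} h {g f g' f'}.

Section Triples.
Context (R : comPzRingType).
Implicit Types (t u v : triple R).

Definition tadd t u : triple R :=
  Triple (fgp_prod (tfgp t) (tfgp u)) (perp (tform0 t) (tform0 u)) (perp (tform1 t) (tform1 u)).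
Definition topp t : triple R := Triple (tfgp t) (tform1 t) (tform0 t).
Definition tzero : triple R :=
  Triple (fgp_row R 0) (mx_altiso (psi R 0)) (mx_altiso (psi R 0)).

(** The triples that become trivial in V_SL(R). *)
Definition stabSL t := exists Q (hQ : fg_projective Q) (h : altiso Q),
  isoSL (fgp_prod (tfgp t) hQ) (perp (tform0 t) h) (perp (tform1 t) h).

Lemma isometricI t u (h : {linear tmod t -> tmod u}) : bijective h ->
  (forall x y, tform0 t x y = tform0 u (h x) (h y)) ->
  (forall x y, tform1 t x y = tform1 u (h x) (h y)) -> isometric t u.
Proof. by move=> *; exists h. Qed.

Arguments isometricI {t u} h.

Lemma stabSL_isometric t u : isometric t u -> stabSL t -> stabSL u.
Proof.
move=> [h [bh h0 h1]] [Q [hQ [k i]]]; exists Q, hQ, k.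
apply: (isoSL_transport (prod_map h idfun)) i.
- by apply: prod_map_bij => //; exists id.
- by move=> x y; rewrite /= /perp_form h0.
- by move=> x y; rewrite /= /perp_form h1.
Qed.

Lemma stabSL_add t u : stabSL t -> stabSL u -> stabSL (tadd t u).
Proof.
move=> [Q [hQ [k i]]] [Q' [hQ' [k' i']]]; exists (Q * Q')%type, (fgp_prod hQ hQ'), (perp k k').
have := isoSL_prod (fgp_prod (fgp_prod (tfgp t) hQ) (fgp_prod (tfgp u) hQ')) i i'.
apply: (isoSL_transport (exch _ _ _ _)); first exact: exch_bij.
  by move=> x y; rewrite /pform /= /perp_form /= /perp_form addrACA.
by move=> x y; rewrite /pform /= /perp_form /= /perp_form addrACA.
Qed.

Lemma stabSL_cancel t Q (hQ : fg_projective Q) (k : altiso Q) :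
  stabSL (tadd t (Triple hQ k k)) -> stabSL t.
Proof.
move=> [Q' [hQ' [k' i]]]; exists (Q * Q')%type, (fgp_prod hQ hQ'), (perp k k').
have [s [sK Ks]] := bij_linear_inv (assocm_bij (tmod t) Q Q').
apply: (isoSL_transport (s)) i; first by exists (assocm (tmod t) Q Q').
  move=> x y; rewrite -[in LHS](Ks x) -[in LHS](Ks y).
  by rewrite /= /perp_form /= /perp_form addrA.
move=> x y; rewrite -[in LHS](Ks x) -[in LHS](Ks y).
by rewrite /= /perp_form /= /perp_form addrA.
Qed.

Lemma stabSL_opp t : stabSL t -> stabSL (topp t).
Proof. by move=> [Q [hQ [k /isoSL_sym i]]]; exists Q, hQ, k. Qed.

Lemma isoSL_stabSL t : isoSL (tfgp t) (tform0 t) (tform1 t) -> stabSL t.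
Proof.
move=> i; exists (tmod tzero), (tfgp tzero), (tform0 tzero).
have j : isoSL (tfgp tzero) (tform0 tzero) (tform0 tzero) by exact: eq_isoSL.
exact: isoSL_prod i j.
Qed.

Lemma stabSL_trans t (f : altiso (tmod t)) :
  isoSL (tfgp t) (tform1 t) f -> stabSL t -> stabSL (Triple (tfgp t) (tform0 t) f).
Proof.
move=> i [Q [hQ [k j]]]; exists Q, hQ, k; apply: isoSL_trans j _.
by apply: (isoSL_prod (fgp_prod (tfgp t) hQ) i (eq_isoSL hQ _)).
Qed.

(** Equality in V_SL(R), expressed as triviality of the difference. *)
Definition teq t u := stabSL (tadd t (topp u)).

Lemma teq_refl t : teq t t.
Proof. by apply: isoSL_stabSL; apply: isoSL_rot; exact: altf_altiso. Qed.

Lemma teq_isometric t u : isometric t u -> teq t u.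
Proof.
move=> [h [bh h0 h1]]; apply: stabSL_isometric (teq_refl t).
apply: (@isometricI (tadd t (topp t)) (tadd t (topp u)) (prod_map idfun h)); first by apply: prod_map_bij => //; exists id.
  by move=> x y; rewrite /= /perp_form h1.
by move=> x y; rewrite /= /perp_form h0.
Qed.

Lemma teq_sym t u : teq t u -> teq u t.
Proof.
move=> /stabSL_opp; apply: stabSL_isometric.
apply: (@isometricI (topp (tadd t (topp u))) (tadd u (topp t)) (swapm _ _)).
- exact: swapm_bij.
- by move=> x y; rewrite /= /perp_form addrC.
- by move=> x y; rewrite /= /perp_form addrC.
Qed.

(** The sum of t - u and u - v is t - v plus forms on tmod u + tmod u that are
    exchanged by a rotation, and can therefore be cancelled. *)
Lemma teq_trans u t v : teq t u -> teq u v -> teq t v.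
Proof.
move=> tu uv.
apply: (@stabSL_cancel _ _ (fgp_prod (tfgp u) (tfgp u)) (perp (tform1 u) (tform0 u))).
pose T := Triple (fgp_prod (fgp_prod (tfgp t) (tfgp v)) (fgp_prod (tfgp u) (tfgp u)))
  (perp (perp (tform0 t) (tform1 v)) (perp (tform1 u) (tform0 u)))
  (perp (perp (tform1 t) (tform0 v)) (perp (tform0 u) (tform1 u))).
have sT : stabSL T.
  apply: stabSL_isometric (stabSL_add tu uv).
  apply: (@isometricI (tadd (tadd t (topp u)) (tadd u (topp v))) T (lpair (lpair (fst \o fst) (snd \o snd)) (lpair (snd \o fst) (fst \o snd)))).
  - exists (fun x => ((x.1.1, x.2.1), (x.2.2, x.1.2))) => -[[a b] [c d]] //.
  - by move=> x y; rewrite /= /perp_form /= /perp_form /=; ring.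
  - by move=> x y; rewrite /= /perp_form /= /perp_form /=; ring.
apply: (@stabSL_trans T _ _ sT).
exact: (isoSL_prod (tfgp T) (eq_isoSL (fgp_prod (tfgp t) (tfgp v)) (fun _ _ => erefl))
  (isoSL_rot (fgp_prod (tfgp u) (tfgp u)) (tform0 u) (altf_altiso (tform1 u)))).
Qed.

Lemma teq_add t t' u u' : teq t t' -> teq u u' -> teq (tadd t u) (tadd t' u').
Proof.
move=> h1 h2; apply: stabSL_isometric (stabSL_add h1 h2).
apply: (@isometricI (tadd (tadd t (topp t')) (tadd u (topp u')))
  (tadd (tadd t u) (topp (tadd t' u'))) (exch _ _ _ _)); first exact: exch_bij.
  by move=> x y; rewrite /= /perp_form /= /perp_form addrACA.
by move=> x y; rewrite /= /perp_form /= /perp_form addrACA.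
Qed.

Lemma teq_opp t u : teq t u -> teq (topp t) (topp u).
Proof. exact: stabSL_opp. Qed.

Lemma tadd0 t : teq (tadd tzero t) t.
Proof.
have z (x y : 'rV[R]_0) : mx_form (psi R 0) x y = 0.
  by rewrite (thinmx0 x); exact: (altf0l (altf_altiso (mx_altiso (psi R 0)))).
apply: teq_isometric; apply: (@isometricI (tadd tzero t) t snd).
- by exists (fun x => (0, x)) => // -[x y]; rewrite (thinmx0 x).
- by move=> x y; rewrite /= /perp_form /= z add0r.
- by move=> x y; rewrite /= /perp_form /= z add0r.
Qed.

Lemma taddC t u : teq (tadd t u) (tadd u t).
Proof.
apply: teq_isometric; apply: (@isometricI (tadd t u) (tadd u t) (swapm _ _)).
- exact: swapm_bij.
- by move=> x y; rewrite /= /perp_form addrC.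
- by move=> x y; rewrite /= /perp_form addrC.
Qed.

Lemma taddA t u v : teq (tadd t (tadd u v)) (tadd (tadd t u) v).
Proof.
apply: teq_isometric; apply: (@isometricI (tadd t (tadd u v)) (tadd (tadd t u) v) (assocm _ _ _)).
- exact: assocm_bij.
- by move=> x y; rewrite /= /perp_form /= /perp_form addrA.
- by move=> x y; rewrite /= /perp_form /= /perp_form addrA.
Qed.

Lemma stabSL_teq0 t : stabSL t -> teq t tzero.
Proof. by move=> h; apply: stabSL_add h _; apply: isoSL_stabSL; exact: eq_isoSL. Qed.

Lemma taddN t : teq (tadd (topp t) t) tzero.
Proof. by apply: stabSL_teq0; apply: isoSL_stabSL; apply: isoSL_rot; exact: altf_altiso. Qed.

Lemma taddNK t u : teq (tadd t (tadd (topp t) u)) u.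
Proof.
apply: teq_trans (taddA _ _ _) _; apply: teq_trans (tadd0 u).
by apply: teq_add (teq_refl _); apply: teq_trans (taddC _ _) (taddN _).
Qed.

Lemma taddKN t u : teq (tadd (topp t) (tadd t u)) u.
Proof.
apply: teq_trans (taddA _ _ _) _; apply: teq_trans (tadd0 u).
exact: teq_add (taddN _) (teq_refl _).
Qed.

Lemma taddACA t u v w : teq (tadd (tadd t u) (tadd v w)) (tadd (tadd t v) (tadd u w)).
Proof.
apply: teq_isometric.
apply: (@isometricI (tadd (tadd t u) (tadd v w)) (tadd (tadd t v) (tadd u w)) (exch _ _ _ _)); first exact: exch_bij.
  by move=> x y; rewrite /= /perp_form /= /perp_form addrACA.
by move=> x y; rewrite /= /perp_form /= /perp_form addrACA.
Qed.

Definition tmul (n : int) t : triple R :=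
  match n with
  | Posz k => iter k (tadd t) tzero
  | Negz k => iter k.+1 (tadd (topp t)) tzero
  end.

Lemma tmul_eq n t u : teq t u -> teq (tmul n t) (tmul n u).
Proof.
move=> h; case: n => k /=.
  by elim: k => [|k IH] /=; [exact: teq_refl | exact: teq_add].
apply: teq_add (teq_opp h) _; elim: k => [|k IH] /=; [exact: teq_refl |].
exact: teq_add (teq_opp h) IH.
Qed.

Lemma tmul_addr n t u : teq (tmul n (tadd t u)) (tadd (tmul n t) (tmul n u)).
Proof.
have H t' u' k : teq (iter k (tadd (tadd t' u')) tzero)
    (tadd (iter k (tadd t') tzero) (iter k (tadd u') tzero)).
  elim: k => [|k IH] /=; first exact: teq_sym (tadd0 _).
  by apply: teq_trans (taddACA _ _ _ _); apply: teq_add IH; exact: teq_refl.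
case: n => k; first exact: H.
exact: (H (topp t) (topp u) k.+1).
Qed.

Lemma tmul1D n t : teq (tmul (1 + n) t) (tadd t (tmul n t)).
Proof.
case: n => [k|[|k]].
- by rewrite -intS; exact: teq_refl.
- by rewrite (_ : 1 + Negz 0 = 0) ?NegzE ?subrr //; exact: teq_sym (taddNK _ _).
- rewrite (_ : 1 + Negz k.+1 = Negz k); first exact: teq_sym (taddNK _ _).
  by rewrite !NegzE [in LHS]intS opprD addrA subrr add0r.
Qed.

(** Adding 1 to a preserves the claim, and so does subtracting 1 since t can be
    cancelled. *)
Lemma tmulD a b t : teq (tmul (a + b) t) (tadd (tmul a t) (tmul b t)).
Proof.
have up n : teq (tmul (n + b) t) (tadd (tmul n t) (tmul b t)) ->
            teq (tmul (1 + n + b) t) (tadd (tmul (1 + n) t) (tmul b t)).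
  move=> h; rewrite -addrA; apply: teq_trans (tmul1D _ _) _.
  apply: teq_trans (teq_add (teq_refl _) h) _; apply: teq_trans (taddA _ _ _) _.
  exact: teq_add (teq_sym (tmul1D _ _)) (teq_refl _).
have down n : teq (tmul (1 + n + b) t) (tadd (tmul (1 + n) t) (tmul b t)) ->
            teq (tmul (n + b) t) (tadd (tmul n t) (tmul b t)).
  move=> h.
  have h' : teq (tadd t (tmul (n + b) t)) (tadd t (tadd (tmul n t) (tmul b t))).
    apply: teq_trans (teq_sym (tmul1D _ _)) _; rewrite addrA; apply: teq_trans h _.
    apply: teq_trans (teq_add (tmul1D _ _) (teq_refl _)) _.
    exact: teq_sym (taddA _ _ _).
  apply: teq_trans (teq_sym (taddKN t _)) _.
  by apply: teq_trans (taddKN t _); apply: teq_add h'; exact: teq_refl.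
elim/int_rect: a => [|n IH|n IH].
- by rewrite add0r; exact: teq_sym (tadd0 _).
- by rewrite intS; exact: up.
- by apply: down; rewrite (_ : 1 + - n.+1%:Z = - n%:Z) // intS opprD addrA subrr add0r.
Qed.

(** The value of n x as a single triple.  Multiplying the coefficient n into the
    subterms turns the module axioms for the scalars into identities of
    integers, except for distributivity, which is [nfD]. *)
Fixpoint nf (n : int) (x : mterm int (triple R)) : triple R :=
  match x with
  | MZero => tzero
  | MGen t => tmul n t
  | MAdd x y => tadd (nf n x) (nf n y)
  | MScale r x => nf (n * r) x
  end.

Lemma nfD a b x : teq (nf (a + b) x) (tadd (nf a x) (nf b x)).
Proof.
elim: x a b => [|t|x hx y hy|r x hx] a b /=.
- exact: teq_sym (tadd0 _).
- exact: tmulD.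
- by apply: teq_trans (teq_add (hx _ _) (hy _ _)) (taddACA _ _ _ _).
- by rewrite mulrDl; exact: hx.
Qed.

Lemma nf0 x : teq (nf 0 x) tzero.
Proof.
elim: x => [|t|x hx y hy|r x hx] /=; [exact: teq_refl | exact: teq_refl | | by rewrite mul0r].
exact: teq_trans (teq_add hx hy) (tadd0 _).
Qed.

(** A cyclic permutation of three summands is a product of two rotations. *)
Lemma teq_V_trans P (hP : fg_projective P) (f0 f1 f2 : altiso P) :
  teq (tadd (Triple hP f0 f1) (Triple hP f1 f2)) (Triple hP f0 f2).
Proof.
apply: isoSL_stabSL => /=.
pose hPP := fgp_prod hP hP.
have h1 := altf_altiso f1; have h2 := altf_altiso f2.
apply: (@isoSL_trans _ _ _ _ (pform (pform f1 f0) f2)).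
  exact: (isoSL_prod (fgp_prod hPP hP) (isoSL_rot hPP f0 h1) (eq_isoSL hP (fun _ _ => erefl))).
have i : isoSL (fgp_prod hP hPP) (pform f1 (pform f0 f2)) (pform f1 (pform f2 f0)).
  exact: (isoSL_prod (fgp_prod hP hPP) (eq_isoSL hP (fun _ _ => erefl)) (isoSL_rot hPP f0 h2)).
apply: (isoSL_transport (assocm P P P)) i; first exact: assocm_bij.
  by move=> x y; rewrite /pform /= addrA.
by move=> x y; rewrite /pform /= /perp_form /= addrA.
Qed.

Lemma teq_SL P (hP : fg_projective P) (g f : altiso P) (phi : {linear P -> P})
    (bphi : bijective phi) : mdet hP phi = 1 ->
  teq (Triple hP g f) (Triple hP g (pullback bphi f)).
Proof.
move=> dphi; apply: isoSL_stabSL => /=.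
apply: (@isoSL_trans _ _ _ _ (pform (pullback bphi f) g)).
  exact: isoSL_rot (altf_altiso _).
apply: isoSL_prod; last exact: eq_isoSL.
by exists phi; split.
Qed.

Lemma VSL_eq_nf x y : VSL_eq x y -> forall n, teq (nf n x) (nf n y).
Proof.
elim=> {x y} /=.
- move=> x y [{}x {}y [t u h|P P' hP hP' g f g' f'|P hP f0 f1 f2]|P hP g f phi sl] n /=.
  + exact/tmul_eq/teq_isometric.
  + exact: (tmul_addr n (Triple hP g f) (Triple hP' g' f')).
  + apply: teq_trans (teq_sym (tmul_addr _ _ _)) _; apply: tmul_eq; exact: teq_V_trans.
  + by apply/tmul_eq/teq_SL; exact/(has_det_mdet hP)/(proj2 sl).
- by move=> x n; exact: teq_refl.
- by move=> x y _ h n; exact: teq_sym.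
- by move=> x y z _ h1 _ h2 n; exact: teq_trans (h1 n) (h2 n).
- by move=> x x' y y' _ h1 _ h2 n; exact: teq_add.
- by move=> r x x' _ h n; exact: h.
- by move=> x y z n; exact: taddA.
- by move=> x y n; exact: taddC.
- by move=> x n; exact: tadd0.
- move=> x n; apply: teq_trans (teq_sym (nfD _ _ _)) _.
  by rewrite mulrN1 addNr; exact: nf0.
- by move=> r s x n; rewrite mulrA; exact: teq_refl.
- by move=> x n; rewrite mulr1; exact: teq_refl.
- by move=> r x y n; exact: teq_refl.
- by move=> r s x n; rewrite mulrDr; exact: nfD.
Qed.

Lemma VSL_eq_teq t u : VSL_eq (MGen t) (MGen u) -> teq t u.
Proof.
move=> /VSL_eq_nf /(_ 1) /= h.
have e v : teq (tadd v tzero) v by apply: teq_trans (taddC _ _) (tadd0 _).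
exact: teq_trans (teq_sym (e t)) (teq_trans h (e u)).
Qed.

Definition tpf t := pf (tfgp t) (tform0 t) (tform1 t).

Lemma tpf_add t u : tpf (tadd t u) = tpf t * tpf u.
Proof. by apply: pf_pform; exact: altf_altiso. Qed.

Lemma tpf_stabSL t : stabSL t -> tpf t = 1.
Proof.
move=> [Q [hQ [h [phi [_ d E]]]]].
have e := pf_pull (fgp_prod (tfgp t) hQ) (perp (tform0 t) h) phi (altf_altiso (perp (tform1 t) h)).
rewrite d mul1r (eq_pf _ _ E) pf_base in e.
have e' := tpf_add t (Triple hQ h h).
rewrite [X in _ = _ * X](pf_base hQ h) mulr1 in e'.
by rewrite -e'; exact: esym e.
Qed.

Lemma tpf_oppK t : tpf t * tpf (topp t) = 1.
Proof. by rewrite -[RHS](pf_base (tfgp t) (tform0 t)) (pf_cocycle _ _ (tform1 t)) //; exact: altf_altiso. Qed.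

(** The relative Pfaffian is an invariant of V_SL(R). *)
Lemma tpf_teq t u : teq t u -> tpf t = tpf u.
Proof.
move=> /tpf_stabSL; rewrite tpf_add => h.
by rewrite -[LHS]mulr1 -(tpf_oppK u) mulrCA h mulr1.
Qed.
End Triples.

(** * Representatives by matrices *)
Section Stabilise.
Context (R : comPzRingType).
Implicit Types P Q K : lmodType R.

Lemma extend_bij P K (J : {linear P -> K}) (rho : {linear K -> P}) (phi : {linear P -> P}) :
  cancel J rho -> bijective phi -> bijective (extend J rho phi).
Proof.
move=> JK /bij_linear_inv [psi [fK Kf]].
have E (a b : {linear P -> P}) : cancel a b -> cancel (extend J rho a) (extend J rho b).
  move=> ab x; have rE : rho (x + J (a (rho x) - rho x)) = a (rho x).
    by rewrite linearD /= JK addrC subrK.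
  rewrite /extend rE ab.
  by rewrite -addrA -linearD /= addrA subrK subrr linear0 addr0.
by exists (extend J rho psi); apply: E.
Qed.

Lemma extf_pform P Q K (J : {linear Q -> K}) (rho : {linear K -> Q}) (w : K -> K -> R)
    (g a : P -> P -> R) (b : Q -> Q -> R) : altf g -> forall x y,
  extf (prod_map idfun J) (prod_map idfun rho) (pform g w) (pform a b) x y
  = pform a (extf J rho w b) x y.
Proof.
by move=> hg x y; rewrite /extf /pform /= !subrr (altf0l hg) add0r addrA.
Qed.

Lemma prod_mapK P Q K (J : {linear Q -> K}) (rho : {linear K -> Q}) :
  cancel J rho -> cancel (prod_map (idfun : {linear P -> P}) J) (prod_map idfun rho).
Proof. by move=> JK [x y]; rewrite /= /lpair /= JK. Qed.

(** The stabilising space (Q, h) embeds in a hyperbolic space, and the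
    automorphism of P + Q extends by the identity on the complement of Q. *)
Lemma stabSL_std (t : triple R) : stabSL t -> exists n,
  isoSL (fgp_prod (tfgp t) (fgp_row R n.*2)) (perp (tform0 t) (mx_altiso (psi R n)))
    (perp (tform1 t) (mx_altiso (psi R n))).
Proof.
move=> [Q [hQ [h [phi [bphi dphi E]]]]].
have [n [J [rho [JK Jw _]]]] := std_ambient hQ h.
have hw := altf_altiso (mx_altiso (psi R n)).
have h0 := altf_altiso (tform0 t).
have J1K := prod_mapK (P := tmod t) JK.
have ee (f : altiso (tmod t)) x y :
    extf (prod_map idfun J) (prod_map idfun rho) (pform (tform0 t) (mx_form (psi R n))) (pform f h) x y
    = perp f (mx_altiso (psi R n)) x y.
  by rewrite extf_pform // /pform (extf_orth JK hw Jw (altf_altiso h)).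
exists n, (extend (prod_map idfun J) (prod_map idfun rho) phi); split.
- exact: extend_bij.
- by rewrite -dphi; apply: (mdet_ext _ _ J1K).
- move=> x y; rewrite -!ee extf_extend //.
  by rewrite /extf; congr (_ + _); exact: E.
Qed.

Lemma form_mxE n (w : 'rV[R]_n -> 'rV[R]_n -> R) : altf w -> forall x y,
  w x y = (x *m (\matrix_(i, j) w (delta_mx 0 i) (delta_mx 0 j)) *m y^T) 0 0.
Proof.
move=> hw x y; rewrite {1}(row_sum_delta x) {1}(row_sum_delta y).
rewrite (big_morph (fun z => w z _) (fun u v => altfDl hw u v _) (altf0l hw _)) -mulmxA mxE.
apply: eq_bigr => i _; rewrite (altfZl hw); congr (_ * _).
rewrite (big_morph (w _) (altfDr hw _) (altf0r hw _)) mxE.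
by apply: eq_bigr => j _; rewrite (altfZr hw) !mxE mulrC.
Qed.

Lemma altf_mx n (w : 'rV[R]_n -> 'rV[R]_n -> R) : altf w ->
  (forall g : {linear 'rV[R]_n -> R^o}, exists x, forall y, w x y = g y) ->
  exists M : altmx R n, (M = \matrix_(i, j) w (delta_mx 0 i) (delta_mx 0 j) :> 'M_n) /\
    forall x y, mx_form M x y = w x y.
Proof.
move=> hw sw; set M := \matrix_(i, j) _.
have sk i j : M i j = - M j i by rewrite !mxE (altfC _ _ hw).
have dg i : M i i = 0 by rewrite mxE (altf_xx hw).
have lc (j : 'I_n) : linear (fun v : 'rV[R]_n => v 0 j : R^o).
  by move=> c u v; rewrite !mxE.
have [v vE] := fin_all_exists (fun j => sw (Linear_of (lc j))).
pose N := \matrix_(i, j) v i 0 j.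
have NM : N *m M = 1%:M.
  apply/row_matrixP => i; rewrite row_mul; apply/rowP => j.
  have := vE i (delta_mx 0 j); rewrite (form_mxE hw) /= trmx_delta -colE.
  rewrite (_ : row i N = v i); last by apply/rowP => l; rewrite !mxE.
  by rewrite !mxE => ->; rewrite eqxx andTb eq_sym.
have MT : M^T = - M by apply/matrixP => i j; rewrite !mxE (altfC _ _ hw).
have MN' : M *m (- N^T) = 1%:M.
  by rewrite mulmxN -mulNmx -MT -trmx_mul NM trmx1.
have inv : exists N', M *m N' = 1%:M /\ N' *m M = 1%:M.
  exists N; split=> //; suff -> : N = - N^T by rewrite MN'.
  by rewrite -[LHS]mulmx1 -MN' mulmxA NM mul1mx.
by exists (AltMx sk dg inv); split=> // x y; rewrite (form_mxE hw).
Qed.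

Lemma meq_cancel (I : Type) (rel : mterm int I -> mterm int I -> Prop) c :
  meq rel (MAdd c c) c -> meq rel c MZero.
Proof.
move=> h; apply: meq_trans (meq_sym (meq_add0 _ c)) _.
apply: meq_trans (meq_add (meq_sym (meq_addN _ c)) (meq_refl _ c)) _.
apply: meq_trans (meq_sym (meq_addA _ _ _ _)) _.
by apply: meq_trans (meq_add (meq_refl _ _) h) (meq_addN _ c).
Qed.

Lemma V_class_id P (hP : fg_projective P) (f : altiso P) :
  V_eq (V_class hP f f) MZero.
Proof. apply: meq_cancel; apply: meq_rel; exact: V_trans. Qed.

(** Embed (P, g) in a hyperbolic space N and let F be f on P and the form of N on
    the complement.  In P + N the rotation of the two copies of P is an
    isometry that shows [P, g, f] + [N, psi, psi] = [P, g, g] + [N, psi, F];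
    so no complement of P in N has to be constructed. *)
Lemma V_class_std P (hP : fg_projective P) (g f : altiso P) :
  exists n (M : altmx R n.*2),
    Pf M = pf hP g f /\
    V_eq (V_class hP g f) (V_class (fgp_row R n.*2) (mx_altiso (psi R n)) (mx_altiso M)).
Proof.
have [n [J [rho [JK Jw [A AE]]]]] := std_ambient hP g.
have hw := altf_altiso (mx_altiso (psi R n)).
have [hg hf] := (altf_altiso g, altf_altiso f).
pose F := extf J rho (mx_form (psi R n)) f.
have hF : altf F by exact: altf_extf.
have [|M [EM ME]] := altf_mx hF.
  move=> k; have [p hp] := aform_surj f (k \o J).
  have [x0 hx0] := aform_surj (mx_altiso (psi R n)) k.
  exists (J p + (x0 - J (rho x0))) => y.
  have r0 z : rho (z - J (rho z)) = 0 by rewrite linearB /= JK subrr.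
  rewrite /F /extf linearD /= JK r0 addr0 hp /= [J p + _]addrC addrK.
  rewrite -[mx_form _]/(aform (mx_altiso (psi R n))) (altfDl hw) (altfNl hw) hx0.
  have -> : mx_altiso (psi R n) (J (rho x0)) (y - J (rho y)) = 0.
    by rewrite [LHS]Jw r0 (altf0r hg).
  by rewrite subr0 linearB /= addrC subrK.
exists n, M; split; first by rewrite EM -AE (pf_am hP).
pose hN := fgp_row R n.*2; pose w := mx_altiso (psi R n); pose FM := mx_altiso M.
have s1 : V_eq (V_class (fgp_prod hP hN) (perp g w) (perp f w)) (V_class hP g f).
  apply: meq_trans (meq_rel (V_perp hP hN g f w w)) _.
  apply: meq_trans (meq_add (meq_refl _ _) (V_class_id hN w)) _.
  by apply: meq_trans (meq_addC _ _ _) (meq_add0 _ _).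
have s2 : V_eq (V_class (fgp_prod hP hN) (perp g w) (perp g FM)) (V_class hN w FM).
  apply: meq_trans (meq_rel (V_perp hP hN g g w FM)) _.
  by apply: meq_trans (meq_add (V_class_id hP g) (meq_refl _ _)) (meq_add0 _ _).
apply: meq_trans (meq_sym s1) (meq_trans _ s2); apply/meq_rel/V_isometry.
have J1K := prod_mapK (P := P) JK.
pose Phi := extend (prod_map idfun J) (prod_map idfun rho) (rot P).
exists Phi; rewrite /=.
have ee (a b : altiso P) x y :
    extf (prod_map idfun J) (prod_map idfun rho) (pform g w) (pform a b) x y
    = pform a (extf J rho w b) x y by exact: extf_pform.
have wE x y : w x y = extf J rho w g x y by rewrite (extf_orth JK hw Jw hg).
have rotE (a b : altiso P) x y :
    pform a (extf J rho w b) (Phi x) (Phi y) = pform b (extf J rho w a) x y.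
  rewrite -!ee extf_extend // /extf; congr (_ + _).
  by rewrite (rot_form _ (altf_altiso a)).
split.
- exact: extend_bij (rot_bij P).
- move=> x y; rewrite -[LHS]/(pform g w x y) -[RHS]/(pform g w (Phi x) (Phi y)).
  by rewrite /pform !wE; exact: esym (rotE g g x y).
- move=> x y; rewrite -[LHS]/(pform f w x y) -[RHS]/(pform g FM (Phi x) (Phi y)).
  have -> : pform g FM (Phi x) (Phi y) = pform g (extf J rho w f) (Phi x) (Phi y).
    by rewrite /pform -[FM _ _]/(mx_form M _ _) ME.
  by rewrite rotE /pform wE.
Qed.
End Stabilise.

(** * Eichler transformations and cancellation of hyperbolic planes *)
Section Eichler.
Context (R : comPzRingType) (N : lmodType R) (hN : fg_projective N) (w : altiso N).
Let hw := altf_altiso w.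

Section Def.
Context (e x : N) (c : R).

Definition eichler_pairing (v : N) : R^o * R^o := (w v x, w v e).
Lemma eichler_pairing_linear : linear eichler_pairing.
Proof.
by move=> a u v; rewrite /eichler_pairing !(altfDl hw) !(altfZl hw).
Qed.
HB.instance Definition _ := GRing.isLinear.Build R _ _ *:%R eichler_pairing eichler_pairing_linear.

Definition eichler_comb (s : R^o * R^o) : N := (s.1 + c * s.2 : R) *: e + (s.2 : R) *: x.
Lemma eichler_comb_linear : linear eichler_comb.
Proof.
move=> a u v; rewrite /eichler_comb /= scalerDr !scalerA addrACA -!scalerDl.
by congr (_ *: _ + _); rewrite /GRing.scale /=; ring.
Qed.
HB.instance Definition _ := GRing.isLinear.Build R _ _ *:%R eichler_comb eichler_comb_linear.

(** v |-> v + w(v, x) e + w(v, e) x + c w(v, e) e, factored through R^2.  The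
    last term cannot be absorbed in x without dividing by 2. *)
Definition eichler : {linear N -> N} := idfun \+ (eichler_comb \o eichler_pairing).
End Def.

Lemma eichlerE e x c v : eichler e x c v = v + ((w v x + c * w v e) *: e + w v e *: x).
Proof. by []. Qed.

Definition isoaut (phi : {linear N -> N}) :=
  [/\ bijective phi, mdet hN phi = 1 & forall x y, w (phi x) (phi y) = w x y].

Lemma isoaut_comp phi psi : isoaut phi -> isoaut psi -> isoaut (phi \o psi).
Proof.
move=> [b1 d1 e1] [b2 d2 e2]; split; first exact: bij_comp.
  by rewrite (mdetM hN phi psi) d1 d2 mulr1.
by move=> x y /=; rewrite e1 e2.
Qed.

Lemma eichler_isoaut e x c : w x e = 0 -> isoaut (eichler e x c).
Proof.
move=> xe; have ex : w e x = 0 by rewrite (altfC _ _ hw) xe oppr0.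
have pe d v : w (eichler e x d v) e = w v e.
  by rewrite eichlerE (altfDl hw) (altfDl hw) !(altfZl hw) aform_alt xe !mulr0 !addr0.
have px d v : w (eichler e x d v) x = w v x.
  by rewrite eichlerE (altfDl hw) (altfDl hw) !(altfZl hw) aform_alt ex !mulr0 !addr0.
split.
- have inv y d : w y e = 0 -> w e y = 0 -> cancel (eichler e y d) (eichler e (- y) (- d)).
    move=> ye ey v.
    have pe' : w (eichler e y d v) e = w v e.
      by rewrite eichlerE (altfDl hw) (altfDl hw) !(altfZl hw) aform_alt ye !mulr0 !addr0.
    have py' : w (eichler e y d v) y = w v y.
      by rewrite eichlerE (altfDl hw) (altfDl hw) !(altfZl hw) aform_alt ey !mulr0 !addr0.
    rewrite eichlerE (altfNr hw) pe' py' eichlerE mulNr -opprD scaleNr scalerN -opprD.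
    by rewrite addrK.
  exists (eichler e (- x) (- c)); first exact: inv.
  have := inv (- x) (- c); rewrite !opprK; apply.
    by rewrite (altfNl hw) xe oppr0.
  by rewrite (altfNr hw) ex oppr0.
- apply: (@mdet_nil _ _ _ hN (fgp_prod (fgp_regular R) (fgp_regular R))
    (eichler_comb e x c) (eichler_pairing e x)) => // s.
  by congr pair; rewrite /eichler_comb (altfDl hw) !(altfZl hw) aform_alt ?xe ?ex !mulr0 addr0.
- move=> u v; rewrite !eichlerE !(altfDl hw, altfDr hw, altfZl hw, altfZr hw, aform_alt) xe ex.
  by rewrite (altfC e v hw) (altfC x v hw); ring.
Qed.
End Eichler.

Section Cancellation.
Context (R : comPzRingType).
Implicit Types Q : lmodType R.

Definition stable_range_at (M : lmodType R) := forall (m : M) (b : R),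
  unimodular ((m, b) : M * R^o) -> exists m', unimodular (m + b *: m').

Section Hyperbolic.
Context (Q : lmodType R) (hQ : fg_projective Q) (f : altiso Q).
Let N : lmodType R := (Q * R^o * R^o)%type.
Let hN : fg_projective N := fgp_prod (fgp_prod hQ (fgp_regular R)) (fgp_regular R).
Let w : altiso N := perp_psi2 f.
Let hf := altf_altiso f.

Let E : N := (0, 1, 0).
Let F : N := (0, 0, 1).

Lemma perp_psi2E (g : altiso Q) q a b q' a' b' :
  perp_psi2 g ((q, a, b) : N) ((q', a', b') : N) = g q q' + (a * b' - b * a').
Proof. by []. Qed.

Lemma shift_E x c : exists s, isoaut hN w s /\
  forall q a b, s (q, a, b) = (q + b *: x, a - f q x + c * b, b).
Proof.
exists (eichler w E (- x, 0, 0) (- c)); split.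
  by apply: eichler_isoaut; rewrite /w perp_psi2E (altf0r hf); ring.
move=> q a b; rewrite eichlerE !/w !perp_psi2E.
apply: injective_projections; last first.
  by rewrite /= /GRing.scale /=; ring.
apply: injective_projections; rewrite /=.
  rewrite scaler0 add0r (altf0r hf) add0r scalerN -scaleNr; congr (_ + _ *: _); ring.
rewrite (altf0r hf) (altfNr hf) /GRing.scale /=; ring.
Qed.

Lemma shift_F x c : exists s, isoaut hN w s /\
  forall q a b, s (q, a, b) = (q + a *: x, a, b + f q x + c * a).
Proof.
exists (eichler w F (x, 0, 0) c); split.
  by apply: eichler_isoaut; rewrite /w perp_psi2E (altf0r hf); ring.
move=> q a b; rewrite eichlerE !/w !perp_psi2E.
apply: injective_projections; last first.
  by rewrite /= (altf0r hf) /GRing.scale /=; ring.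
apply: injective_projections; rewrite /=.
  rewrite scaler0 add0r (altf0r hf) add0r; congr (_ + _ *: _); ring.
rewrite /GRing.scale /=; ring.
Qed.

(** Let v = (q, a, b).  The stable range condition and a first transformation
    make (q, a) unimodular: the extra term f(q, x) in the second coordinate
    equals f(q + b x, x), so it does not affect unimodularity.  A second
    transformation makes the last coordinate 1, and a third one clears the
    other two. *)
Lemma unimodular_transitive (v : N) : stable_range_at (Q * R^o)%type -> unimodular v ->
  exists s, isoaut hN w s /\ s v = F.
Proof.
move=> stab; case: v => [[q a] b] uv.
have [[x r] [g gE]] := stab _ _ uv.
have [s1 [i1 s1E]] := shift_E x r.
pose q1 := q + b *: x; pose a1 := a - f q x + r * b.
have [y [t yE]] : exists y t, f q1 y + t * a1 = 1.
  pose il : {linear Q -> (Q * R^o)%type} := lpair idfun \0.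
  pose t : R := g (0, 1).
  have [p hp] := aform_surj f (g \o il).
  exists (t *: x - p), t; rewrite (altfDr hf) (altfNr hf) (altfZr hf) (altfC q1 p hf) opprK hp.
  rewrite -gE.
  have -> : ((q, a) : Q * R^o) + b *: ((x, r) : Q * R^o) = il q1 + (a + b * r) *: ((0, 1) : Q * R^o).
    apply: injective_projections; rewrite /= ?scaler0 ?addr0 //.
    by rewrite add0r /GRing.scale /= mulr1.
  rewrite [in RHS]linearD linearZ /= -/t /q1 /a1 (altfDl hf) (altfZl hf) aform_alt /GRing.scale /=.
  by ring.
have [s2 [i2 s2E]] := shift_F ((1 - b) *: y) ((1 - b) * t).
pose q2 := q1 + a1 *: ((1 - b) *: y).
have [s3 [i3 s3E]] := shift_E (- q2) (- a1).
exists (s3 \o s2 \o s1); split.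
  by apply: isoaut_comp i1; exact: isoaut_comp.
rewrite /= s1E -/q1 -/a1 s2E -/q2 s3E.
have -> : b + f q1 ((1 - b) *: y) + (1 - b) * t * a1 = 1.
  by rewrite (altfZr hf) -addrA -mulrA -mulrDr yE mulr1 addrC subrK.
rewrite scale1r subrr (altfNr hf) aform_alt; congr (_, _, _).
by rewrite mulr1; ring.
Qed.

Lemma fix_hyperbolic (g1 g2 : altiso Q) (phi : {linear N -> N}) :
  (forall x y, perp_psi2 g2 (phi x) (phi y) = perp_psi2 g1 x y) -> phi E = E -> phi F = F ->
  forall q, phi (q, 0, 0) = ((phi (q, 0, 0)).1.1, 0, 0).
Proof.
move=> iso pE pF q.
have [hg1 hg2] := (altf_altiso g1, altf_altiso g2).
have := iso (q, 0, 0) F; have := iso (q, 0, 0) E; rewrite pE pF.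
case: (phi (q, 0, 0)) => [[q' a'] b']; rewrite /E /F !perp_psi2E /=.
rewrite !(altf0r hg1) !(altf0r hg2) !add0r !mulr1 !mulr0 !subr0 !sub0r.
by move=> /eqP; rewrite oppr_eq0 => /eqP -> ->.
Qed.
End Hyperbolic.

(** An isometry phi of determinant 1 can be corrected on the left so that it
    fixes the hyperbolic pair E, F: transitivity brings phi F back to F, and
    then phi E = (q, 1, b) since it pairs to 1 with F, which a transformation
    fixing F moves to E.  What is left maps the orthogonal complement Q of the
    pair to itself. *)
Lemma hyperbolic_cancel Q (hQ : fg_projective Q) (g f : altiso Q) :
  stable_range_at (Q * R^o)%type ->
  isoSL (fgp_prod (fgp_prod hQ (fgp_regular R)) (fgp_regular R)) (perp_psi2 g) (perp_psi2 f) ->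
  isoSL hQ g f.
Proof.
move=> stab [phi [bphi dphi iso]].
pose N : lmodType R := (Q * R^o * R^o)%type.
pose hQR := fgp_prod hQ (fgp_regular R); pose hN : fg_projective N := fgp_prod hQR (fgp_regular R).
have [hg hf] := (altf_altiso g, altf_altiso f).
have hw := altf_altiso (perp_psi2 f).
pose E : N := (0, 1, 0); pose F : N := (0, 0, 1).
have gEF : perp_psi2 g E F = 1 by rewrite perp_psi2E (altf0r hg); ring.
have uF : unimodular (phi F).
  have l : linear (perp_psi2 f (phi E) : N -> R^o).
    by move=> c u v; rewrite (altfDr hw) (altfZr hw).
  by exists (Linear_of l); exact: (etrans (iso E F) gEF).
have [s [[bs ds es] sF]] := unimodular_transitive hQ f stab uF.
have := erefl (s (phi E)); case: {2}(s (phi E)) => [[q a] b] sE.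
have a1 : a = 1.
  have := es (phi E) (phi F); rewrite sE sF iso gEF perp_psi2E (altf0r hf) mulr1 mulr0.
  by rewrite subr0 add0r.
have [s' [[bs' ds' es'] s'E]] := shift_F hQ f (- q) (- b).
pose phi2 : {linear N -> N} := s' \o s \o phi.
have p2E : phi2 E = E.
  rewrite /phi2 /= sE a1 s'E scale1r subrr (altfNr hf) aform_alt; congr (_, _, _).
  by rewrite mulr1; ring.
have p2F : phi2 F = F.
  rewrite /phi2 /= sF s'E scale0r addr0 (altf0l hf); congr (_, _, _).
  by rewrite mulr0; ring.
have b2 : bijective phi2 by apply: bij_comp => //; exact: bij_comp.
have d2 : mdet hN phi2 = 1.
  by rewrite (mdetM hN (s' \o s) phi) (mdetM hN s' s) ds' ds dphi !mulr1.
have iso2 x y : perp_psi2 f (phi2 x) (phi2 y) = perp_psi2 g x y.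
  exact: etrans (es' _ _) (etrans (es _ _) (iso _ _)).
have [psi [pK Kp]] := bij_linear_inv b2.
have iso2' x y : perp_psi2 g (psi x) (psi y) = perp_psi2 f x y by rewrite -iso2 !Kp.
have q2E : psi E = E by rewrite -[in LHS]p2E pK.
have q2F : psi F = F by rewrite -[in LHS]p2F pK.
have fixphi := fix_hyperbolic iso2 p2E p2F; have fixpsi := fix_hyperbolic iso2' q2E q2F.
pose il : {linear Q -> N} := lpair (lpair idfun \0) \0.
pose phiQ : {linear Q -> Q} := fst \o fst \o phi2 \o il.
pose psiQ : {linear Q -> Q} := fst \o fst \o psi \o il.
have phiQE q0 : phi2 (q0, 0, 0) = (phiQ q0, 0, 0) := fixphi q0.
have psiQE q0 : psi (q0, 0, 0) = (psiQ q0, 0, 0) := fixpsi q0.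
exists phiQ; split.
- exists psiQ => q0.
    by have := psiQE (phiQ q0); rewrite -phiQE pK => -[].
  by have := phiQE (psiQ q0); rewrite -psiQE Kp => -[].
- rewrite -d2.
  transitivity (mdet hN (prod_map (prod_map phiQ idfun) idfun)).
    rewrite (mdet_prod_map hQR (fgp_regular R)) (mdet_prod_map hQ (fgp_regular R)).
    by rewrite (@mdet_id _ _ (fgp_regular R) idfun) // !mulr1.
  apply: eq_mdet => -[[q0 a0] b0].
  have -> : ((q0, a0, b0) : N) = il q0 + ((a0 : R) *: E + (b0 : R) *: F).
    apply: injective_projections; first apply: injective_projections;
      by rewrite /= ?scaler0 ?addr0 ?add0r // /GRing.scale /= mulr1.
  rewrite !linearD !linearZ p2E p2F [phi2 (il q0)]phiQE.
  apply: injective_projections; first apply: injective_projections;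
      by rewrite /= ?scaler0 ?addr0 ?add0r ?linear0 ?scaler0 ?addr0.
- move=> x y; have := iso2 (x, 0, 0) (y, 0, 0); rewrite !phiQE !perp_psi2E.
  by rewrite mulr0 subr0 !addr0.
Qed.

Lemma hyperbolic_destabilise P (hP : fg_projective P) (g f : altiso P) n :
  (forall k, stable_range_at ((P * 'rV[R]_(k.*2)) * R^o)%type) ->
  isoSL (fgp_prod hP (fgp_row R n.*2)) (perp g (mx_altiso (psi R n)))
    (perp f (mx_altiso (psi R n))) -> isoSL hP g f.
Proof.
move=> stab; elim: n => [|n IH].
  have z (x y : 'rV[R]_0) : mx_form (psi R 0) x y = 0.
    by rewrite (thinmx0 x); exact: (altf0l (altf_altiso (mx_altiso (psi R 0)))).
  apply: (isoSL_transport fst).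
  - by exists (fun x => (x, 0)) => // -[x y]; rewrite (thinmx0 y).
  - by move=> x y; rewrite /= /perp_form [mx_altiso _ _ _]z addr0.
  - by move=> x y; rewrite /= /perp_form [mx_altiso _ _ _]z addr0.
move=> i; apply: IH; apply: (hyperbolic_cancel (stab n)).
pose h (x : P * 'rV[R]_(2 + n.*2)) : P * 'rV[R]_(n.*2) * R^o * R^o :=
  (x.1, rsubmx x.2, lsubmx x.2 0 0, lsubmx x.2 0 1).
have lh : linear h by move=> c u v; rewrite /h !linearP /= !mxE.
apply: (isoSL_transport (Linear_of lh)) i.
- exists (fun x => (x.1.1.1, row_mx (\row_j (if j == 0 then x.1.2 else x.2)) x.1.1.2)).
    move=> [p v]; rewrite /h /=; congr pair; rewrite -[RHS](@hsubmxK _ 1 2 n.*2); congr row_mx.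
    apply/rowP => j; rewrite mxE; case: eqP => [->//|/eqP]; case: j => [[|[|]]] // j1 _.
    by congr (lsubmx v _ _); apply: val_inj.
  move=> [[[p v] a] b]; rewrite /h /= row_mxKl row_mxKr !mxE /=; by [].
- move=> [p v] [q u]; have := psi_formS (lsubmx v) (lsubmx u) (rsubmx v) (rsubmx u).
  rewrite !hsubmxK => e.
  rewrite -[LHS]/(g p q + mx_form (psi R n.+1) v u) e.
  rewrite -[RHS]/(g p q + mx_form (psi R n) (rsubmx v) (rsubmx u)
    + (lsubmx v 0 0 * lsubmx u 0 1 - lsubmx v 0 1 * lsubmx u 0 0)).
  by ring.
- move=> [p v] [q u]; have := psi_formS (lsubmx v) (lsubmx u) (rsubmx v) (rsubmx u).
  rewrite !hsubmxK => e.
  rewrite -[LHS]/(f p q + mx_form (psi R n.+1) v u) e.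
  rewrite -[RHS]/(f p q + mx_form (psi R n) (rsubmx v) (rsubmx u)
    + (lsubmx v 0 0 * lsubmx u 0 1 - lsubmx v 0 1 * lsubmx u 0 0)).
  by ring.
Qed.
End Cancellation.

(** * The relative Pfaffian of V(a) *)
Lemma mdet_basis (R : comPzRingType) (P : lmodType R) (hP : fg_projective P) :
  exists n, forall k (nu : R) (W : nat -> P) (F : nat -> {linear P -> R^o})
    (phi : {linear P -> P}),
  (forall z, \sum_(i < k) (F i z : R) *: W i = nu *: z) ->
  (forall i j : 'I_k, (F j (W i) : R) = (i == j)%:R * nu) ->
  nu ^+ (k + n) * mdet hP phi = nu ^+ n * \det (\matrix_(i < k, j < k) (F j (phi (W i)) : R)).
Proof.
have [n H] := mdet_frame hP; exists n => k nu W F phi wf fw.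
pose w (v : 'rV[R]_k) : P := \sum_(i < k) v 0 i *: W i.
have lw : linear w.
  move=> c u v; rewrite /w scaler_sumr -big_split; apply: eq_bigr => i _ /=.
  by rewrite !mxE scalerDl scalerA.
pose f (z : P) : 'rV[R]_k := \row_i (F i z : R).
have lf : linear f by move=> c u v; apply/rowP => i; rewrite !mxE linearP.
have wd i : w (delta_mx 0 i) = W i.
  rewrite /w (bigD1 i) //= big1 ?addr0 => [|j ji]; rewrite !mxE ?eqxx ?(negPf ji) ?scale1r //.
  by rewrite scale0r.
rewrite (H k nu (Linear_of lw) (Linear_of lf) phi) /=; last 2 first.
- by move=> z; rewrite /w -wf; apply: eq_bigr => i _; rewrite !mxE.
- move=> v; rewrite [in RHS](row_sum_delta v) [in LHS](row_sum_delta v).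
  have -> : f (w (\sum_j v 0 j *: delta_mx 0 j)) = \sum_j v 0 j *: f (w (delta_mx 0 j)).
    rewrite -[LHS]/((Linear_of lf \o Linear_of lw) _) linear_sum.
    by apply: eq_bigr => j _; rewrite linearZ.
  rewrite scaler_sumr; apply: eq_bigr => j _; rewrite wd scalerA mulrC -scalerA; congr (_ *: _).
  by apply/rowP => l; rewrite !mxE fw eqxx andTb mulrC eq_sym.
by congr (_ * \det _); apply/matrixP => i j; rewrite !mxE /= wd.
Qed.

Section SmallDet.
Context (R : comPzRingType).

Lemma det_mx2 (f : nat -> nat -> R) :
  \det (\matrix_(i < 2, j < 2) f i j) = f 0 0 * f 1 1 - f 0 1 * f 1 0.
Proof.
rewrite (expand_det_row _ ord0) !big_ord_recl big_ord0 /cofactor !det_mx11 !mxE /=.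
by rewrite /bump /=; ring.
Qed.

Lemma det_mx3 (f : nat -> nat -> R) : \det (\matrix_(i < 3, j < 3) f i j) =
  f 0 2 * (f 1 0 * f 2 1 - f 1 1 * f 2 0) - f 1 2 * (f 0 0 * f 2 1 - f 0 1 * f 2 0)
  + f 2 2 * (f 0 0 * f 1 1 - f 0 1 * f 1 0).
Proof.
rewrite (expand_det_row _ ord0) !big_ord_recl big_ord0 /cofactor.
have minor (j : 'I_3) : \det (row' ord0 (col' j (\matrix_(i < 3, j < 3) f i j)))
    = f 1 (bump j 0) * f 2 (bump j 1) - f 1 (bump j 1) * f 2 (bump j 0).
  rewrite -(det_mx2 (fun i k => f i.+1 (bump j k))); congr (\det _).
  by apply/matrixP => i k; rewrite !mxE.
by rewrite !minor !mxE /= /bump /=; ring.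
Qed.
End SmallDet.

(** If Ext3 K = 0 and Ext2 K = R, any two vectors x, y form a basis of K after
    inverting chi x y, with coordinates given by chi itself. *)
Section RankTwo.
Context (R : comPzRingType) (K : lmodType R) (hK : fg_projective K)
  (van : forall x y z : K, wedge3 x y z = 0) (theta : liso R^o (Ext2 K)).
Let chi : altiso K := triv_altiso hK van theta.
Let hchi := altf_altiso chi.

Lemma triv_contr_form (f : {linear K -> R^o}) x y z :
  (f z : R) * chi x y - (f y : R) * chi x z + (f x : R) * chi y z = 0.
Proof.
have [h0 hD hZ] := scalar_facts (liso_inv_scalar theta).
have := congr1 (liso_inv theta) (triv_contr van f x y z).
by rewrite -scaleNr !hD !hZ h0 mulNr.
Qed.

Lemma rank2_frame x y z : chi z y *: x + chi x z *: y = chi x y *: z.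
Proof.
apply/eqP; rewrite -subr_eq0; apply/eqP; apply: fgp_separated hK _ => f.
have fZ r v : f (r *: v) = r * (f v : R) :> R by rewrite linearZ.
rewrite linearB linearD !fZ; have := triv_contr_form f x y z; rewrite (altfC y z hchi) => h.
by rewrite -[RHS]oppr0 -h; ring.
Qed.

Lemma rank2_plucker x y z z' :
  chi z y * chi x z' + chi x z * chi y z' = chi x y * chi z z'.
Proof.
by rewrite -!(altfZl hchi) -(altfDl hchi) rank2_frame.
Qed.

Lemma triv_form_nonvanishing p : is_prime p -> exists x y, ~ p (chi x y).
Proof.
move=> hp; apply: contrapT => no.
have [h0 hD hZ] := scalar_facts (liso_inv_scalar theta).
have [[p0 pD pM] p1 _] := hp.
have all q : p (liso_inv theta q).
  elim/pmod_genP: q => [|q q' hq hq'|r q hq|[x y]].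
  - by rewrite h0.
  - by rewrite hD; exact: pD.
  - by rewrite hZ; exact: pM.
  - by apply: contrapT => nxy; apply: no; exists x, y.
by apply: p1; have := all (theta 1); rewrite lisoK.
Qed.

(** A form is a linear form on Ext2 K, hence determined by its value at
    theta 1. *)
Lemma altf_rank2 f : altf f -> exists c : R, forall x y, f x y = c * chi x y.
Proof.
move=> hf; pose g (t : K * K) : R^o := f t.1 t.2.
have rel x y : ext2_rel x y -> meval g x = meval g y.
  by case=> * /=; rewrite /g /= ?(altfE hf).
have lin := pmod_lift_linear rel.
exists (pmod_lift g (theta 1)) => x y.
have -> : f x y = pmod_lift g (wedge2 x y) by rewrite [RHS](pmod_liftE rel).
rewrite -[in LHS](liso_invK theta (wedge2 x y)) -[liso_inv _ _]mulr1.
rewrite -[_ * 1]/((liso_inv theta (wedge2 x y) : R) *: (1 : R^o)) linearZ /=.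
have [_ _ ->] := scalar_facts (lin : scalar (pmod_lift g : _ -> R)).
by rewrite mulrC.
Qed.
End RankTwo.

Definition psi2_ext (R : comPzRingType) (Q : lmodType R) (f : Q -> Q -> R)
    (x y : Q * R^o * R^o) : R :=
  f x.1.1 y.1.1 + psi2_form (x.1.2, x.2) (y.1.2, y.2).

Lemma altf_psi2_ext (R : comPzRingType) (Q : lmodType R) (f : Q -> Q -> R) :
  altf f -> altf (psi2_ext f).
Proof.
move=> hf; exact: (altf_pull (Linear_of (@reassoc_linear R Q))
  (altf_pform hf (altf_altiso (psi2 R)))).
Qed.

Section RankOne.
Context (R : comPzRingType) (M N : lmodType R) (F : {linear M -> R^o}) (v : N).
Definition lrank1 (m : M) : N := (F m : R) *: v.
Lemma lrank1_linear : linear lrank1.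
Proof. by move=> c x y; rewrite /lrank1 linearP scalerDl scalerA. Qed.
HB.instance Definition _ := GRing.isLinear.Build R M N *:%R lrank1 lrank1_linear.
End RankOne.

Section VasersteinPf.
Context (R : comPzRingType) (P0 : lmodType R).
Context (fgpP0 : fg_projective P0) (rkP0 : constant_rank P0 2).
Context (theta0 : liso R^o (Ext2 P0)).
Let chi0 : altiso P0 := chi0 fgpP0 rkP0 theta0.
Let h0 := altf_altiso chi0.
Let M1 : lmodType R := (P0 * R^o)%type.
Let P4 : lmodType R := (P0 * R^o * R^o)%type.
Let hM1 : fg_projective M1 := fgp_P0R fgpP0.
Let h4 : fg_projective P4 := fgp_P0RR fgpP0.
Let chi0' : altiso P4 := chi0_psi2 fgpP0 rkP0 theta0.

Section At.
Context (a : Um M1) (s : section_of a).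
Let chia : altiso (kermod a) := chi fgpP0 rkP0 theta0 s.
Let ha := altf_altiso chia.

(** Expansion of the identification of det P0 with det (ker a) through
    Ext3 (P0 + R). *)
Lemma chi_formula (v w : kermod a) : chia v w =
  (s 1).2 * chi0 (val v).1 (val w).1 - (val w).2 * chi0 (val v).1 (s 1).1
  + (val v).2 * chi0 (val w).1 (s 1).1.
Proof.
have [l0 lD lZ] := scalar_facts (liso_inv_scalar theta0).
transitivity (liso_inv theta0 (contr (fst0 P0) (snd0 P0) (wedge3 (val v) (val w) (s 1)))).
  rewrite -[LHS]/(liso_inv theta0 (contr (fst0 P0) (snd0 P0)
    (wedge_last (val : {linear kermod a -> _}) (s 1) (wedge2 v w)))).
  by rewrite wedge_lastE.
by rewrite contrE -scaleNr !lD !lZ mulNr.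
Qed.

(** (u chi_a _|_ psi_2) on P0 + R + R, transported along i_s + 1. *)
Definition Uform (u : R) (x y : P4) : R :=
  psi2_ext (fun k k' => u * chia k k') (stab_split s x) (stab_split s y).

Lemma altf_Uform u : altf (Uform u).
Proof.
exact: (altf_pull (Linear_of (stab_split_linear s)) (altf_psi2_ext (altf_scale u ha))).
Qed.

Lemma Uform1 x y : Uform 1 x y = Vform fgpP0 rkP0 theta0 s x y.
Proof. by rewrite /Uform /psi2_ext mul1r. Qed.

(** Where nu = chi0 x y and mu = chi_a v w are invertible, x, y is a basis of P0
    and v, w one of ker a.  The map Phi1 on M sends x, y, e3 to nu^2 v, nu w,
    s(1), while Phi0 on P0 sends x, y to u mu nu x, nu y.  Both pull back the
    forms in question to u mu nu^2 chi0 _|_ psi_2, so that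
    det Phi1 pf(U) = det Phi0.  Up to powers of nu, both determinants are known:
    det Phi1 = mu nu^2 and det Phi0 = u mu nu^2. *)
Lemma pf_Uform_local u : exists N, forall (x y : P0) (v w : kermod a),
  chi0 x y ^+ N * chia v w * (pf h4 chi0' (Uform u) - u) = 0.
Proof.
have [n1 H1] := mdet_basis hM1; have [n0 H0] := mdet_basis fgpP0.
exists (n1 + n0 + 7)%N => x y v w.
pose nu := chi0 x y; pose mu := chia v w.
have [Fx FxE] : exists F : {linear P0 -> R^o}, forall z, F z = chi0 x z :> R.
  by exists (Linear_of (altf_r h0 x : linear (chi0 x : P0 -> R^o))).
have [Fy FyE] : exists F : {linear P0 -> R^o}, forall z, F z = chi0 z y :> R.
  by exists (Linear_of (altf_l h0 y : linear (chi0^~ y : P0 -> R^o))).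
pose Phi1 : {linear M1 -> M1} := lrank1 (Fy \o fst) (nu *: val v) \+
  (lrank1 (Fx \o fst) (val w) \+ lrank1 snd (s 1)).
have Phi1E m : Phi1 m = (Fy m.1 : R) *: (nu *: val v) + ((Fx m.1 : R) *: val w + (m.2 : R) *: s 1).
  by [].
pose Phi0 : {linear P0 -> P0} := lrank1 Fy ((u * mu) *: x) \+ lrank1 Fx y.
have Phi0E z : Phi0 z = (Fy z : R) *: ((u * mu) *: x) + (Fx z : R) *: y by [].
pose L1 : {linear P4 -> P4} := prod_map Phi1 idfun.
pose L0 : {linear P4 -> P4} := prod_map (prod_map Phi0 idfun) idfun.
have pl z z' : chi0 z y * chi0 x z' - chi0 x z * chi0 z' y = nu * chi0 z z'.
  have := rank2_plucker fgpP0 (wedge3_vanish (constant_rank2_local rkP0)) theta0 x y z z'.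
  rewrite -[X in X = _ -> _]/(chi0 z y * chi0 x z' + chi0 x z * chi0 y z') (altfC y z' h0) mulrN.
  exact.
have dL1 : mdet h4 L1 = mdet hM1 Phi1.
  by rewrite (mdet_prod_map hM1 (fgp_regular R)) [X in _ * X]mdet_id ?mulr1.
have dL0 : mdet h4 L0 = mdet fgpP0 Phi0.
  rewrite (mdet_prod_map hM1 (fgp_regular R)) (mdet_prod_map fgpP0 (fgp_regular R)).
  by rewrite [X in _ * X * X]mdet_id ?mulr1.
have pull (z z' : P4) : Uform u (L1 z) (L1 z') = chi0' (L0 z) (L0 z').
  case: z => [[z r] t]; case: z' => [[z' r'] t'].
  have aphi m : a (Phi1 m) = m.2.
    rewrite Phi1E !linearD !linearZ /= !ker_val0 secK !scaler0 !add0r /GRing.scale /=.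
    by rewrite mulr1.
  have kphi m : ker_proj s (Phi1 m) = (Fy m.1 : R) *: (nu *: v) + (Fx m.1 : R) *: w.
    rewrite Phi1E !linearD !linearZ /= !ker_projK. 
    by rewrite ker_proj_sec scaler0 addr0 !scalerA [_ * nu]mulrC.
  rewrite -[LHS]/(u * chia (ker_proj s (Phi1 (z, r))) (ker_proj s (Phi1 (z', r')))
     + ((a (Phi1 (z, r)) : R) * t' - t * (a (Phi1 (z', r')) : R))).
  rewrite -[RHS]/(chi0 (Phi0 z) (Phi0 z') + (r * t' - t * r')) !aphi !kphi.
  congr (_ + _); rewrite !Phi0E [(z, r).1]/= [(z', r').1]/= !FyE !FxE.
  rewrite !(altfDl ha, altfDr ha, altfZl ha, altfZr ha, aform_alt) (altfC w v ha) -/mu.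
  rewrite !(altfDl h0, altfDr h0, altfZl h0, altfZr h0, aform_alt) (altfC y x h0) -/nu.
  by ring.
have e1 : mdet hM1 Phi1 * pf h4 chi0' (Uform u) = mdet fgpP0 Phi0.
  rewrite -dL1 -(pf_pull h4 chi0' L1 (altf_Uform u)) (eq_pf h4 chi0' pull).
  by rewrite (pf_pull h4 chi0' L0 (altf_altiso chi0')) pf_base mulr1.
pose W0 (i : nat) : P0 := if i is 0 then x else y.
pose F0 (i : nat) : {linear P0 -> R^o} := if i is 0 then Fy else Fx.
have frame z : (Fy z : R) *: x + (Fx z : R) *: y = nu *: z.
  rewrite FyE FxE.
  exact: (rank2_frame fgpP0 (wedge3_vanish (constant_rank2_local rkP0)) theta0 x y z).
have d0 : nu ^+ (2 + n0) * mdet fgpP0 Phi0 = nu ^+ n0 * (u * mu * nu ^+ 4).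
  rewrite (H0 2 nu W0 F0 Phi0); last 2 first.
  - by move=> z; rewrite !big_ord_recl big_ord0 addr0 /=; exact: frame.
  - move=> [[|[|i]] i2] [[|[|j]] j2] //=; rewrite ?FyE ?FxE ?aform_alt ?mul0r ?mul1r //.
  rewrite (det_mx2 (fun i j => F0 j (Phi0 (W0 i)))) /F0 /W0 !Phi0E !FyE !FxE.
  rewrite !(altfDl h0, altfDr h0, altfZl h0, altfZr h0, aform_alt) -/nu.
  by congr (_ * _); ring.
pose W1 (i : nat) : M1 := match i with 0 => (x, 0) | 1 => (y, 0) | _ => (0, 1) end.
pose F1 (i : nat) : {linear M1 -> R^o} :=
  match i with 0 => Fy \o fst | 1 => Fx \o fst | _ => nu \*: snd end.
have d1 : nu ^+ (3 + n1) * mdet hM1 Phi1 = nu ^+ n1 * (nu ^+ 5 * mu).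
  rewrite (H1 3 nu W1 F1 Phi1); last 2 first.
  - move=> [z r]; rewrite !big_ord_recl big_ord0 addr0 /=.
    apply: injective_projections; rewrite /= ?scaler0 ?add0r ?addr0 ?frame //.
    by rewrite /GRing.scale /= mulr1.
  - move=> [[|[|[|i]]] i2] [[|[|[|j]]] j2] //=;
      rewrite ?linear0 ?scaler0 ?FyE ?FxE ?aform_alt ?mul0r ?mul1r //.
    by rewrite /GRing.scale /= mulr1.
  rewrite (det_mx3 (fun i j => F1 j (Phi1 (W1 i)))).
  have PW0 : Phi1 (W1 0%N) = nu ^+ 2 *: val v.
    rewrite Phi1E FyE FxE aform_alt !scale0r !addr0 scalerA -/nu; congr (_ *: _); ring.
  have PW1 : Phi1 (W1 1%N) = nu *: val w.
    by rewrite Phi1E FyE FxE aform_alt scale0r add0r scale0r addr0.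
  have PW2 : Phi1 (W1 2%N) = s 1.
    by rewrite Phi1E FyE FxE (altf0l h0) (altf0r h0) !scale0r !add0r scale1r.
  have F0E m : F1 0%N m = chi0 m.1 y :> R by rewrite /= FyE.
  have F1E m : F1 1%N m = chi0 x m.1 :> R by rewrite /= FxE.
  have F2E m : F1 2%N m = nu * m.2 :> R by [].
  have zE c (m : M1) : (c *: m).1 = c *: m.1 by [].
  have zE2 c (m : M1) : (c *: m).2 = c * m.2 :> R by [].
  rewrite PW0 PW1 PW2 !F0E !F1E !F2E !zE !zE2.
  rewrite !(altfZl h0, altfZr h0) /mu chi_formula.
  have e := pl (val v).1 (val w).1; have e' := pl (val v).1 (s 1).1.
  have e'' := pl (val w).1 (s 1).1.
  congr (_ * _).
  transitivity (nu ^+ 4 * ((s 1).2 * (nu * chi0 (val v).1 (val w).1)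
      - (val w).2 * (nu * chi0 (val v).1 (s 1).1) + (val v).2 * (nu * chi0 (val w).1 (s 1).1))).
    by rewrite -e -e' -e''; ring.
  by ring.
have -> : nu ^+ (n1 + n0 + 7) * mu * (pf h4 chi0' (Uform u) - u)
   = (nu ^+ n1 * (nu ^+ 5 * mu)) * nu ^+ (2 + n0) * pf h4 chi0' (Uform u)
     - nu ^+ (3 + n1) * (nu ^+ n0 * (u * mu * nu ^+ 4)).
  by rewrite !exprD; ring.
by rewrite -d1 -d0 -e1; ring.
Qed.

(** At every prime some nu and some mu are invertible. *)
Lemma pf_Uform u : pf h4 chi0' (Uform u) = u.
Proof.
have [N HN] := pf_Uform_local u.
apply/eqP; rewrite -subr_eq0; apply/eqP.
apply: (@linear_ext_zero R R^o) => p hp.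
have [x [y pxy]] := triv_form_nonvanishing fgpP0 (wedge3_vanish (constant_rank2_local rkP0)) theta0 hp.
have [v [w pvw]] := triv_form_nonvanishing (fgp_ker s (fgp_P0R fgpP0)) (ker_wedge3 rkP0 s)
  (theta rkP0 theta0 s) hp.
exists (chi0 x y ^+ N * chia v w); split; last exact: HN.
by move=> /(prime_mul hp) [/(primeX hp)|].
Qed.
End At.
End VasersteinPf.

(** * Orbits of e4 *)
Lemma meq_mono (R : pzRingType) (I : Type) (rel rel' : mterm R I -> mterm R I -> Prop) x y :
  (forall x y, rel x y -> rel' x y) -> meq rel x y -> meq rel' x y.
Proof.
move=> sub; elim=> {x y}.
- by move=> x y h; apply/meq_rel/sub.
- exact: meq_refl.
- by move=> x y _; exact: meq_sym.
- by move=> x y z _ h1 _ h2; exact: meq_trans h1 h2.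
- by move=> *; exact: meq_add.
- by move=> *; exact: meq_scale.
- exact: meq_addA.
- exact: meq_addC.
- exact: meq_add0.
- exact: meq_addN.
- exact: meq_scaleA.
- exact: meq_scale1.
- exact: meq_scaleDr.
- exact: meq_scaleDl.
Qed.

Lemma tpf_VSL (R : comPzRingType) (t u : triple R) :
  VSL_eq (MGen t) (MGen u) -> tpf t = tpf u.
Proof. by move=> /VSL_eq_teq /tpf_teq. Qed.

Lemma mdet_regular (R : comPzRingType) (d : R) (phi : {linear R^o -> R^o}) :
  (forall c, phi c = d * (c : R) :> R) -> mdet (fgp_regular R) phi = d.
Proof.
move=> phiE.
have lk : linear (fun v : 'rV[R]_1 => v 0 0 : R^o) by move=> c u v; rewrite !mxE.
have lk' : linear (fun c : R^o => \row_(_ < 1) (c : R)).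
  by move=> c u v; apply/rowP => i; rewrite !mxE.
rewrite (@mdet_free _ _ (fgp_regular R) 1 (Linear_of lk) (Linear_of lk')).
- by rewrite det_mx11 mxE /= mxE phiE mxE mulr1.
- by move=> v; apply/rowP => i; rewrite mxE ord1.
- by move=> c; rewrite /= mxE.
Qed.

Section Transvection.
Context (R : comPzRingType) (P : lmodType R) (hP : fg_projective P)
  (l : {linear P -> R^o}) (e : P).
Definition transvection : {linear P -> P} := idfun \+ lrank1 l e.

Lemma transvection_SL : l e = 0 -> bijective transvection /\ mdet hP transvection = 1.
Proof.
move=> le; have lE x c : l (x + c *: e) = l x by rewrite linearD linearZ /= le scaler0 addr0.
split.
  exists (fun x => x - lrank1 l e x) => x; rewrite /transvection /= /lrank1.
    by rewrite lE addrK.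
  by rewrite -scaleNr lE scaleNr subrK.
apply: (@mdet_nil _ _ _ hP (fgp_regular R) (lrank1 idfun e) l) => // c.
by rewrite /lrank1 linearZ /= le scaler0.
Qed.
End Transvection.

Section Orbits.
Context (R : comPzRingType) (dimR : Krull_dim_le R 4) (P0 : lmodType R).
Context (fgpP0 : fg_projective P0) (rkP0 : constant_rank P0 2).
Context (theta0 : liso R^o (Ext2 P0)).
Let chi0 : altiso P0 := chi0 fgpP0 rkP0 theta0.
Let h0 := altf_altiso chi0.
Let M1 : lmodType R := (P0 * R^o)%type.
Let P4 : lmodType R := (P0 * R^o * R^o)%type.
Let hM1 : fg_projective M1 := fgp_P0R fgpP0.
Let h4 : fg_projective P4 := fgp_P0RR fgpP0.
Let chi0' : altiso P4 := chi0_psi2 fgpP0 rkP0 theta0.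
Let E4 : P4 := e4 P0.

Lemma framed_rank2 x y : framed 2 (liso_inv theta0 (wedge2 x y)) P0.
Proof.
pose f (z : P0) : 'rV[R]_2 := \row_i (if i == 0 then chi0 z y else chi0 x z).
have lf : linear f.
  move=> c u v; apply/rowP => i; rewrite !mxE; case: eqP => _.
    by rewrite (altfDl h0) (altfZl h0).
  by rewrite (altfDr h0) (altfZr h0).
pose w (v : 'rV[R]_2) : P0 := v 0 0 *: x + v 0 1 *: y.
have lw : linear w.
  by move=> c u v; rewrite /w !mxE !scalerDl scalerDr !scalerA addrACA.
exists (Linear_of lf), (Linear_of lw) => v; apply/rowP => i.
rewrite [LHS](mxE _ _ 0 i) [RHS]mxE /w -[liso_inv _ _]/(chi0 x y); case: eqP => [->|/eqP i0].
  by rewrite (altfDl h0) !(altfZl h0) aform_alt mulr0 addr0 mulrC.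
rewrite (altfDr h0) !(altfZr h0) aform_alt mulr0 add0r mulrC; congr (_ * v _ _).
by apply: val_inj; case: i i0 => [[|[|]]].
Qed.

Lemma stable_range_P4 k : stable_range_at ((P4 * 'rV[R]_(k.*2)) * R^o)%type.
Proof.
move=> m b; apply: (stable_range (theta0 := theta0) dimR) => x y.
have fr4 : framed 4 (liso_inv theta0 (wedge2 x y)) P4.
  exact: framed_prodR (framed_prodR (framed_rank2 x y)).
have fr4' := framed_prodl 'rV[R]_(k.*2) fr4.
exact: framed_prodR fr4'.
Qed.

Lemma stabSL_P4 (g f : altiso P4) : stabSL (Triple h4 g f) -> isoSL h4 g f.
Proof.
move=> /stabSL_std [n i]; apply: hyperbolic_destabilise i; exact: stable_range_P4.
Qed.

Lemma P4_dec (x : P4) : x = (x.1, 0) + (x.2 : R) *: E4.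
Proof.
apply: injective_projections; rewrite /= ?scaler0 ?addr0 //.
by rewrite add0r /GRing.scale /= mulr1.
Qed.

Section NormalForm.
Context (c : altiso P4) (a : Um M1) (s : section_of a).
Context (aE : forall m, (a m : R) = - c E4 (m, 0)).
Context (pfc : pf h4 chi0' c = 1).
Let hc := altf_altiso c.

(** The transvection x |-> x + c(x, s(1)) e4, with the first coordinate of x
    taken in M, makes e4 and s(1) orthogonal to ker a and leaves c(e4, -)
    unchanged.  What remains on ker a is u chi_a, and u = pf(c) = 1. *)
Lemma normal_form : exists eps : {linear P4 -> P4},
  [/\ bijective eps, mdet h4 eps = 1, eps E4 = E4 &
      forall x y, c (eps x) (eps y) = Vform fgpP0 rkP0 theta0 s x y].
Proof.
pose il : {linear M1 -> P4} := lpair idfun \0.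
pose c1 m m' := c (il m) (il m').
have h1 : altf c1 := altf_pull il hc.
pose l : {linear P4 -> R^o} :=
  Linear_of (altf_l h1 (s 1) : linear (c1^~ (s 1) : M1 -> R^o)) \o fst.
have lE x : l x = c1 x.1 (s 1) :> R by [].
have lE4 : l E4 = 0 by rewrite lE (altf0l h1).
have [be de] := transvection_SL h4 lE4.
pose eps := transvection l E4.
have epsE x : eps x = il x.1 + (x.2 + c1 x.1 (s 1)) *: E4.
  by rewrite /eps /transvection /= {1}(P4_dec x) -addrA /lrank1 lE -scalerDl.
have [u uE] := altf_rank2 (fgp_ker s (fgp_P0R fgpP0)) (ker_wedge3 rkP0 s) (theta rkP0 theta0 s)
  (altf_pull (val : {linear kermod a -> M1}) h1).
have cE x y : c (eps x) (eps y) = Uform fgpP0 rkP0 theta0 s u x y.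
  rewrite !epsE /Uform /psi2_ext -uE.
  have e1 m : c E4 (il m) = - (a m : R) by rewrite aE opprK.
  have e2 m : c (il m) E4 = a m by rewrite (altfC _ _ hc) e1 opprK.
  rewrite !(altfDl hc, altfDr hc, altfZl hc, altfZr hc, aform_alt) e1 e2 -/(c1 _ _).
  have sE m : s (a m) = (a m : R) *: s 1 by rewrite -linearZ /= /GRing.scale /= mulr1.
  rewrite /= /psi2_form /= !sE.
  rewrite !(altfDl h1, altfDr h1, altfNl h1, altfNr h1, altfZl h1, altfZr h1, altf_xx h1).
  by rewrite (altfC (s 1) y.1 h1); ring.
have u1 : u = 1.
  rewrite -(pf_Uform fgpP0 rkP0 theta0 s u) -(eq_pf h4 chi0' cE).
  by rewrite (pf_pull h4 chi0' eps hc) pfc mulr1.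
exists eps; split=> //; first by rewrite epsE /= (altf0l h1) linear0 !add0r addr0 scale1r.
by move=> x y; rewrite cE u1 Uform1.
Qed.

Lemma Vmap_normal_form : VSL_eq (V_class h4 chi0' c) (Vmap fgpP0 rkP0 theta0 s).
Proof.
have [eps [be de _ eE]] := normal_form.
have sl : in_SL eps by apply/(in_SLP h4).
apply: meq_trans (meq_rel (VSL_SL h4 chi0' c sl)) _.
apply/meq_rel/VSL_V/V_isometry; exists idfun; split=> //; first by exists id.
Qed.
End NormalForm.

Lemma pf_Vform (a : Um M1) (s : section_of a) : pf h4 chi0' (Vform fgpP0 rkP0 theta0 s) = 1.
Proof. by rewrite -(eq_pf h4 chi0' (Uform1 fgpP0 rkP0 theta0 s)) pf_Uform. Qed.

Lemma pf_Vtilde (c : altiso P4) : in_Vtilde (V_class h4 chi0' c) -> pf h4 chi0' c = 1.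
Proof.
move=> [n [M [PfM e]]].
have := @tpf_VSL _ (Triple h4 chi0' c)
  (Triple (fgp_row R n.*2) (mx_altiso (psi R n)) (mx_altiso M)).
rewrite /tpf /= pf_psi PfM; apply; apply: meq_mono e; exact: VSL_V.
Qed.

Lemma Vtilde_Vform (a : Um M1) (s : section_of a) :
  in_Vtilde (V_class h4 chi0' (Vform fgpP0 rkP0 theta0 s)).
Proof.
have [n [M [PfM e]]] := V_class_std h4 chi0' (Vform fgpP0 rkP0 theta0 s).
by exists n, M; split=> //; rewrite PfM pf_Vform.
Qed.

Lemma Um_of_form (c : altiso P4) : exists a : Um M1, forall m, (a m : R) = - c E4 (m, 0).
Proof.
have hc := altf_altiso c.
pose il : {linear M1 -> P4} := lpair idfun \0.
pose l : {linear M1 -> R^o} := \- (Linear_of (altf_r hc E4 : linear (c E4 : P4 -> R^o)) \o il).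
have lE m : (l m : R) = - c E4 (m, 0) by [].
have [p hp] := aform_surj c (snd : {linear P4 -> R^o}).
have pE : (l p.1 : R) = 1.
  rewrite lE -[RHS](hp E4) (altfC p E4 hc) {2}(P4_dec p) (altfDr hc) (altfZr hc) aform_alt.
  by rewrite mulr0 addr0.
have sl r : exists x, l x = r.
  exists (r *: p.1); have -> : l (r *: p.1) = r * (l p.1 : R) :> R by rewrite linearZ.
  by rewrite pE mulr1.
by exists (UmPack sl).
Qed.

Lemma section_exists (a : Um M1) : exists s : section_of a, True.
Proof.
have [m am] := um_surj a 1.
have lin : linear (fun r : R^o => (r : R) *: m).
  by move=> c u v; rewrite scalerDl scalerA.
have sK (r : R^o) : a (Linear_of lin r) = r.
  by rewrite /= linearZ /= am /GRing.scale /= mulr1.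
by exists (SectionOf sK).
Qed.

(** Scaling e3 by the inverse of the determinant does not move e4. *)
Lemma Sp_orbit_SL (c : altiso P4) x : lin_orbit (in_Sp c) E4 x -> lin_orbit (@in_SL R _) E4 x.
Proof.
move=> [sg [[bsg _] sgE]].
have [tau [sK tK]] := bij_linear_inv bsg.
pose u := mdet h4 tau; pose v := mdet h4 sg.
have vu : v * u = 1 by exact: mdet_inv.
pose D r : {linear P4 -> P4} := prod_map (prod_map (idfun : {linear P0 -> P0})
  (r \*: (idfun : {linear R^o -> R^o}))) idfun.
have DE r z : D r z = (z.1.1, r * z.1.2, z.2) by [].
have dD r : mdet h4 (D r) = r.
  rewrite (mdet_prod_map hM1 (fgp_regular R)) (mdet_prod_map fgpP0 (fgp_regular R)).
  rewrite [X in X * _ * _]mdet_id // [X in _ * _ * X]mdet_id // mul1r mulr1.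
  exact: mdet_regular.
have DK r r' : r * r' = 1 -> cancel (D r') (D r).
  by move=> rr [[z b] t]; rewrite !DE /= mulrA rr mul1r.
have bD : bijective (D u) by exists (D v); apply: DK => //; rewrite mulrC.
exists (sg \o D u); split.
  apply/(in_SLP h4); split; first exact: bij_comp.
  by rewrite (mdetM h4 sg (D u)) dD.
by rewrite /= -[in LHS]/(D u) DE /= mulr0.
Qed.

Lemma SL_orbit_Sp (c : altiso P4) x : Vmap_injective fgpP0 rkP0 theta0 ->
  pf h4 chi0' c = 1 -> lin_orbit (@in_SL R _) E4 x -> lin_orbit (in_Sp c) E4 x.
Proof.
move=> inj pfc [phi [sl phiE]]; have [bphi dphi] := (in_SLP h4 phi).1 sl.
have hc := altf_altiso c.
pose c' : altiso P4 := pullback (proj1 sl) c.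
have pfc' : pf h4 chi0' c' = 1 by rewrite (pf_pull h4 chi0' phi hc) dphi mul1r.
have [b bE] := Um_of_form c; have [t _] := section_exists b.
have [a aE] := Um_of_form c'; have [s _] := section_exists a.
have st : VSL_eq (Vmap fgpP0 rkP0 theta0 s) (Vmap fgpP0 rkP0 theta0 t).
  apply: meq_trans (meq_sym (Vmap_normal_form s aE pfc')) _.
  apply: (meq_trans _ (Vmap_normal_form t bE pfc)); apply/meq_sym/meq_rel.
  exact: (VSL_SL h4 chi0' c sl).
have [th [/(in_SLP hM1) [bth dth] thE]] := inj a b s t st.
pose phi1 : {linear P4 -> P4} := phi \o prod_map th idfun.
have phi1E m r : phi1 (m, r) = phi (th m, r) by [].
have bphi1 : bijective phi1.
  by apply: bij_comp bphi _; apply: prod_map_bij bth _; exists id.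
have dphi1 : mdet h4 phi1 = 1.
  rewrite (mdetM h4 phi (prod_map th idfun)) dphi mul1r.
  by rewrite (mdet_prod_map hM1 (fgp_regular R)) dth mul1r mdet_id.
have phi1E4 : phi1 E4 = phi E4 by rewrite [LHS]phi1E linear0.
pose c1 : altiso P4 := pullback bphi1 c.
have pfc1 : pf h4 chi0' c1 = 1 by rewrite (pf_pull h4 chi0' phi1 hc) dphi1 mul1r.
have bE1 m : (b m : R) = - c1 E4 (m, 0).
  by rewrite thE aE -[c1 _ _]/(c (phi1 E4) (phi1 (m, 0))) phi1E4 phi1E.
have [eps [beps _ epsE4 epsE]] := normal_form t bE pfc.
have [eps1 [beps1 _ eps1E4 eps1E]] := normal_form t bE1 pfc1.
have [eta [eK Ke]] := bij_linear_inv beps.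
have beta : bijective eta by exists eps.
exists (phi1 \o eps1 \o eta); split; last first.
  by rewrite /= -{1}epsE4 eK eps1E4 [LHS]phi1E4.
split; first by apply: bij_comp beta; exact: bij_comp.
move=> y z; rewrite -[LHS]/(c1 (eps1 (eta y)) (eps1 (eta z))) eps1E -epsE !Ke.
by [].
Qed.

Lemma Vmap_injective_of_orbits :
  (forall c : altiso P4, in_Vtilde (V_class h4 chi0' c) -> forall x,
    lin_orbit (@in_SL R _) E4 x -> lin_orbit (in_Sp c) E4 x) ->
  Vmap_injective fgpP0 rkP0 theta0.
Proof.
move=> orb a b s t /VSL_eq_teq st.
pose fa := Vform fgpP0 rkP0 theta0 s; pose fb := Vform fgpP0 rkP0 theta0 t.
have iso : isoSL h4 fb fa.
  apply: stabSL_P4; apply: (@stabSL_cancel _ (Triple h4 fb fa) _ h4 chi0').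
  have [Q [hQ [k i]]] := st; exists Q, hQ, k; apply: isoSL_trans i.
  exact: (isoSL_prod (fgp_prod (fgp_prod h4 h4) hQ)
    (isoSL_rot (fgp_prod h4 h4) fb (altf_altiso chi0')) (eq_isoSL hQ (fun _ _ => erefl))).
have [phi [bphi dphi phiE]] := iso.
have [|sg [[bsg sgE] sgE4]] := orb fa (Vtilde_Vform s) (phi E4).
  by exists phi; split=> //; apply/(in_SLP h4).
have [tau [sK tK]] := bij_linear_inv bsg.
have tauE x y : fa (tau x) (tau y) = fa x y by rewrite -sgE !tK.
pose psi : {linear P4 -> P4} := tau \o phi.
have psiE4 : psi E4 = E4 := etrans (congr1 tau (esym sgE4)) (sK E4).
have psiE x y : fa (psi x) (psi y) = fb x y := etrans (tauE _ _) (phiE x y).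
have bpsi : bijective psi by apply: bij_comp bphi; exists sg.
have dpsi : mdet h4 psi = 1.
  have := pf_pull h4 chi0' psi (altf_altiso fa); rewrite pf_Vform mulr1 => <-.
  by rewrite (eq_pf h4 chi0' psiE) pf_Vform.
have [psi' [pK p'K]] := bij_linear_inv bpsi.
have psi'E4 : psi' E4 = E4 by rewrite -{1}psiE4 pK.
pose il : {linear M1 -> P4} := lpair idfun \0.
pose th : {linear M1 -> M1} := fst \o psi \o il.
pose th' : {linear M1 -> M1} := fst \o psi' \o il.
pose l : {linear P4 -> R^o} := snd \o psi \o il \o fst.
have psi_dec x : psi x = (th x.1, (l x : R) + x.2).
  rewrite {1}(P4_dec x) linearD linearZ psiE4 -[psi (x.1, 0)]/(psi (il x.1)).
  apply: injective_projections; rewrite /= ?scaler0 ?addr0 //.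
  by rewrite /GRing.scale /= mulr1.
have psi'_dec x : (psi' x).1 = th' x.1.
  rewrite {1}(P4_dec x) linearD linearZ psi'E4 -[psi' (x.1, 0)]/(psi' (il x.1)).
  by rewrite /= scaler0 addr0.
have bth : bijective th.
  exists th' => m.
    by rewrite -[th m]/((psi (il m)).1) -psi'_dec pK.
  have := p'K (il m); rewrite psi_dec psi'_dec => /(congr1 fst).
  by [].
have lE4 : l E4 = 0.
  by rewrite -[l E4]/((psi (il E4.1)).2) (linear0 il : il E4.1 = 0) linear0.
have [_ dtr] := transvection_SL h4 lE4.
have dth : mdet hM1 th = 1.
  have -> : mdet hM1 th = mdet h4 (prod_map th idfun).
    by rewrite (mdet_prod_map hM1 (fgp_regular R)) [X in _ * X]mdet_id ?mulr1.
  rewrite -dpsi -[LHS]mulr1 -[X in _ * X]dtr.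
  rewrite -(mdetM h4 (prod_map th idfun) (transvection l E4)).
  apply: eq_mdet => x; rewrite psi_dec /transvection.
  apply: injective_projections; rewrite /= /lrank1 /=.
    by rewrite scaler0 addr0.
  by rewrite addrC /GRing.scale /= mulr1.
exists th; split; first by apply/(in_SLP hM1).
move=> m; have := psiE E4 (il m); rewrite psiE4 psi_dec.
have VE (d : Um M1) (r : section_of d) m' t' : Vform fgpP0 rkP0 theta0 r E4 (m', t') = - (d m' : R).
  rewrite -[LHS]/(chi fgpP0 rkP0 theta0 r (ker_proj r 0) (ker_proj r m')
    + ((d 0 : R) * t' - 1 * (d m' : R))).
  by rewrite !linear0 (altf0l (altf_altiso _)) mul0r mul1r sub0r add0r.
by rewrite !VE => /oppr_inj ->.
Qed.
End Orbits.

Theorem theorem3p6 (R : comPzRingType) (noethR : Noetherian R)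
    (dimR : Krull_dim_le R 4)
    (P0 : lmodType R) (fgpP0 : fg_projective P0) (rkP0 : constant_rank P0 2)
    (theta0 : liso R^o (Ext2 P0)) :
  Vmap_injective fgpP0 rkP0 theta0
  <->
  forall chi : altiso (P0 * R^o * R^o)%type,
    in_Vtilde (V_class (fgp_P0RR fgpP0) (chi0_psi2 fgpP0 rkP0 theta0) chi) ->
    forall x : (P0 * R^o * R^o)%type,
      lin_orbit (@in_SL R _) (e4 P0) x <-> lin_orbit (in_Sp chi) (e4 P0) x.
Proof.
split.
  move=> inj c /pf_Vtilde pfc x; split; first exact: (SL_orbit_Sp inj pfc).
  exact: Sp_orbit_SL.
move=> orb; apply: Vmap_injective_of_orbits => // c vt x.
exact: (orb c vt x).1.
Qed.
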